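(* Let $k$ be an algebraically closed field and let $\mathcal H=(\mathcal P,\le,\{\Delta_i\}_{i\in\mathcal P})$ be a strict homological system for the finite-dimensional $k$-algebra $\Lambda$. Then the Yoneda graded $S$-algebra $A$ of the $\Lambda$-module $\Delta=\bigoplus_{i\in\mathcal P}\Delta_i$ admits a structure of $A_\infty$-algebra with $S$-$S$-bimodule higher multiplications $\{m_n:A^{\otimes n}\to A\}_{n\ge1}$ such that $m_1=0$, $m_2$ is induced by the product of the Yoneda algebra and, for $n\ge3$, $m_n(z_1\otimes z_2\otimes\cdots\otimes z_n)=0$ whenever $z_i\in\{e_j\mid j\in\mathcal P\}$ for some $i\in\{1,\dots,n\}$.
   Context: $k$ acts centrally on all algebras and bimodules. A preordered set $(\mathcal P,\le)$ is a non-empty set with a reflexive transitive relation; $i\sim j$ means $i\le j$ and $j\le i$. A (finite) homological system $\mathcal H=(\mathcal P,\le,\{\Delta_i\}_{i\in\mathcal P})$ for a finite-dimensional $k$-algebra $\Lambda$ consists of a finite preordered set and pairwise non-isomorphic indecomposable finite-dimensional $\Lambda$-modules $\Delta_i$ such that $\operatorname{Hom}_\Lambda(\Delta_i,\Delta_j)\ne0$ implies $i\le j$, and $\operatorname{Ext}^1_\Lambda(\Delta_i,\Delta_j)\ne0$ implies $i\le j$ and $i\not\sim j$. $\mathcal F(\Delta)$ is the class of finitely generated modules which are $0$ or have a finite filtration with successive quotients isomorphic to modules in $\{\Delta_i\}$. $\mathcal H$ is admissible if $\Lambda\in\mathcal F(\Delta)$ and the number of isoclasses of indecomposable projective $\Lambda$-modules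 equals $|\mathcal P|$. An admissible $\mathcal H$ is strict if for each $n\ge1$, $\operatorname{Ext}^n_\Lambda(\Delta_i,\Delta_j)\ne0$ implies $i\le j$ and $i\not\sim j$. Let $e_i\in\operatorname{End}_\Lambda(\Delta)$ be the idempotent obtained by composing the projection $\Delta\to\Delta_i$ with the inclusion $\Delta_i\to\Delta$, and $S=\bigoplus_{i\in\mathcal P}ke_i\subseteq\operatorname{End}_\Lambda(\Delta)$. The Yoneda algebra of $\Delta$ is the graded $S$-algebra $A=\bigoplus_{n\ge0}\operatorname{Ext}^n_\Lambda(\Delta,\Delta)$. An $A_\infty$-algebra structure on a graded $S$-$S$-bimodule $A$ is a sequence of homogeneous $S$-$S$-bimodule morphisms $m_n:A^{\otimes n}\to A$ ($n\ge1$, $\otimes=\otimes_S$) of degree $2-n$ such that $\sum_{r+s+t=n,\,s\ge1,\,r,t\ge0}(-1)^{r+st}m_{r+1+t}(id^{\otimes r}\otimes m_s\otimes id^{\otimes t})=0$ for every $n\ge1$ (Koszul sign rule). *)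

(* Defs.v *)
From HB Require Import structures.
From mathcomp Require Import all_boot all_order all_algebra all_field.
From mathcomp Require Import boolp classical_sets fsbigop functions cardinality.
From mathcomp Require Import freeg.
Set Implicit Arguments.
Unset Strict Implicit.
Unset Printing Implicit Defensive.
Import GRing.Theory.
Local Open Scope ring_scope.
Local Open Scope quotient_scope.
Local Open Scope classical_set_scope.

(* A submodule is given by its membership predicate; [submod S] is the
   corresponding module and [quomod S] is the quotient V / S. *)
Record submodule (R : pzRingType) (V : lmodType R) := Submodule {
  submodule_pred :> V -> bool;
  submodule_closed : GRing.submod_closed submodule_pred
}.

HB.instance Definition _ (R : pzRingType) (V : lmodType R) (S : submodule V) :=
  GRing.isSubmodClosed.Build R V (submodule_pred S)
    (GRing.submod_closed_semi (submodule_closed S)).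

Section SubmoduleType.
Variables (R : pzRingType) (V : lmodType R) (S : submodule V).

Record submod := Submod { submod_val :> V; submod_valP : S submod_val }.
HB.instance Definition _ := [isSub for submod_val].
HB.instance Definition _ := [Choice of submod by <:].
HB.instance Definition _ := [SubChoice_isSubLmodule of submod by <:].

Definition quomod : Type := Quotient.quot (GRing.ZmodClosed.clone V (submodule_pred S) _).
HB.instance Definition _ := GRing.Zmodule.on quomod.
HB.instance Definition _ := ZmodQuotient.on quomod.

Definition quomod_scale (a : R) (x : quomod) : quomod := \pi_quomod (a *: repr x).

Lemma pi_scale a (v : V) : quomod_scale a (\pi_quomod v) = \pi_quomod (a *: v).
Proof.
apply/eqP; rewrite /quomod_scale -Quotient.idealrBE -scalerBr.
have: repr (\pi_quomod v) - v \in submodule_pred S.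
  rewrite -[_ \in _]/(_ \in GRing.ZmodClosed.clone V (submodule_pred S) _).
  by rewrite Quotient.idealrBE reprK.
move=> H; exact: (rpredZ a H).
Qed.

Fact quomod_scaleA a b x :
  quomod_scale a (quomod_scale b x) = quomod_scale (a * b) x.
Proof. by elim/quotW: x => v; rewrite (pi_scale b v) !pi_scale scalerA. Qed.

Fact quomod_scale1 : left_id 1 quomod_scale.
Proof. by elim/quotW=> v; rewrite pi_scale scale1r. Qed.

Fact quomod_scaleDr : right_distributive quomod_scale +%R.
Proof.
move=> a; elim/quotW=> u; elim/quotW=> v.
by rewrite -raddfD !pi_scale scalerDr raddfD.
Qed.

Fact quomod_scaleDl x : {morph quomod_scale^~ x : a b / a + b}.
Proof. by move=> a b; elim/quotW: x => v; rewrite !pi_scale scalerDl raddfD. Qed.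

HB.instance Definition _ := GRing.Zmodule_isLmodule.Build R quomod
  quomod_scaleA quomod_scale1 quomod_scaleDr quomod_scaleDl.

Definition quo_class (v : V) : quomod := \pi_quomod v.
Definition quo_repr (x : quomod) : V := repr x.
End SubmoduleType.

(* The direct sum of the modules [V i], as finitely supported families. *)
Section DirectSum.
Variables (R : pzRingType) (I : choiceType) (V : I -> lmodType R).

Definition prodmod : Type := forall i, V i.
HB.instance Definition _ := Choice.on prodmod.

Fact prodmod_addA :
  associative (fun (x y : prodmod) => (fun i => x i + y i) : prodmod).
Proof. by move=> x y z; apply: functional_extensionality_dep => i; rewrite addrA. Qed.
Fact prodmod_addC :
  commutative (fun (x y : prodmod) => (fun i => x i + y i) : prodmod).
Proof. by move=> x y; apply: functional_extensionality_dep => i; rewrite addrC. Qed.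
Fact prodmod_add0 : left_id ((fun i => 0) : prodmod)
  (fun (x y : prodmod) => (fun i => x i + y i) : prodmod).
Proof. by move=> x; apply: functional_extensionality_dep => i; rewrite add0r. Qed.
Fact prodmod_addN : left_inverse ((fun i => 0) : prodmod)
  (fun x : prodmod => (fun i => - x i) : prodmod)
  (fun (x y : prodmod) => (fun i => x i + y i) : prodmod).
Proof. by move=> x; apply: functional_extensionality_dep => i; rewrite addNr. Qed.
HB.instance Definition _ := GRing.isZmodule.Build prodmod
  prodmod_addA prodmod_addC prodmod_add0 prodmod_addN.

Definition prodmod_scale a (x : prodmod) : prodmod := fun i => a *: x i.
Fact prodmod_scaleA a b x :
  prodmod_scale a (prodmod_scale b x) = prodmod_scale (a * b) x.
Proof. by apply: functional_extensionality_dep => i; rewrite /prodmod_scale scalerA. Qed.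
Fact prodmod_scale1 : left_id 1 prodmod_scale.
Proof. by move=> x; apply: functional_extensionality_dep => i; rewrite /prodmod_scale scale1r. Qed.
Fact prodmod_scaleDr : right_distributive prodmod_scale +%R.
Proof. by move=> a x y; apply: functional_extensionality_dep => i; apply: scalerDr. Qed.
Fact prodmod_scaleDl x : {morph prodmod_scale^~ x : a b / a + b}.
Proof. by move=> a b; apply: functional_extensionality_dep => i; apply: scalerDl. Qed.
HB.instance Definition _ := GRing.Zmodule_isLmodule.Build R prodmod
  prodmod_scaleA prodmod_scale1 prodmod_scaleDr prodmod_scaleDl.

Definition finsupp : prodmod -> bool :=
  fun x => `[< finite_set [set i | x i != 0] >].

Fact finsupp_closed : GRing.submod_closed finsupp.
Proof.
split.
  apply/asboolP; rewrite [X in finite_set X](_ : _ = set0) ?finite_set0 //.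
  by apply/seteqP; split=> // i /=; rewrite eqxx.
move=> a x y /asboolP fx /asboolP fy; apply/asboolP.
have: finite_set ([set i | x i != 0] `|` [set i | y i != 0]).
  by rewrite finite_setU.
apply: sub_finite_set.
move=> i /= xy0; apply/orP; rewrite -negb_and; apply: contra xy0.
move=> /andP[/eqP x0 /eqP y0]; change (a *: x i + y i == 0).
by rewrite x0 y0 scaler0 addr0.
Qed.

Definition dsum : Type := submod (Submodule finsupp_closed).
HB.instance Definition _ := GRing.Lmodule.on dsum.

Definition dsum_proj i (x : dsum) : V i := (submod_val x : prodmod) i.

Fact dsum_proj_linear i : linear (@dsum_proj i).
Proof. by []. Qed.
HB.instance Definition _ i :=
  GRing.isLinear.Build R dsum (V i) _ (@dsum_proj i) (@dsum_proj_linear i).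

Definition inj_fun i (v : V i) : prodmod :=
  fun j => if i =P j is ReflectT e then ecast j (V j) e v else 0.

Fact inj_fun_finsupp i v : finsupp (@inj_fun i v).
Proof.
apply/asboolP/(sub_finite_set _ (finite_set1 i)) => j /=.
by rewrite /inj_fun; case: eqP => [e _|_]; [exact/esym | rewrite eqxx].
Qed.

Definition dsum_inj i (v : V i) : dsum :=
  @Submod _ _ (Submodule finsupp_closed) _ (inj_fun_finsupp v).

Fact dsum_inj_linear i : linear (@dsum_inj i).
Proof.
move=> a u v; apply/val_inj/functional_extensionality_dep => j.
change (inj_fun (a *: u + v) j = a *: inj_fun u j + inj_fun v j).
by rewrite /inj_fun; case: eqP => [e|_]; [case: j / e | rewrite scaler0 addr0].
Qed.
HB.instance Definition _ i :=
  GRing.isLinear.Build R (V i) dsum _ (@dsum_inj i) (@dsum_inj_linear i).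
End DirectSum.

Section Modules.
Variables (k : fieldType) (L : falgType k).

(* Hom_L(M, N) as a vector space over k, the scalar c acting through its image
   c%:A in L, which is central. *)
Section Hom.
Variables M N : lmodType L.

Definition Hom : Type := {linear M -> N}.

Lemma Hom_eq (f g : Hom) : (forall x, f x = g x) -> f = g.
Proof.
case: f g => [f cf] [g cg] /= fg.
have {}fg : f = g by apply: functional_extensionality_dep.
case: g / fg cg => cg; congr GRing.Linear.Pack.
case: cf cg => [[a0] [b0]] [[a] [b]].
by congr GRing.Linear.Class; congr (_ _); apply: Prop_irrelevance.
Qed.

Definition hom_add (f g : Hom) : Hom := f \+ g.
Definition hom_opp (f : Hom) : Hom := \- f.
Definition hom_zero : Hom := \0.
HB.instance Definition _ := gen_eqMixin Hom.
HB.instance Definition _ := gen_choiceMixin Hom.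
Fact hom_addA : associative hom_add.
Proof. by move=> f g h; apply: Hom_eq => x; exact: addrA. Qed.
Fact hom_addC : commutative hom_add.
Proof. by move=> f g; apply: Hom_eq => x; exact: addrC. Qed.
Fact hom_add0 : left_id hom_zero hom_add.
Proof. by move=> f; apply: Hom_eq => x; exact: add0r. Qed.
Fact hom_addN : left_inverse hom_zero hom_opp hom_add.
Proof. by move=> f; apply: Hom_eq => x; exact: addNr. Qed.
HB.instance Definition _ := GRing.isZmodule.Build Hom
  hom_addA hom_addC hom_add0 hom_addN.

Section Scale.
Variables (c : k) (f : Hom).
Definition hom_scale_fun (x : M) : N := c%:A *: f x.
Fact hom_scale_linear : linear hom_scale_fun.
Proof.
move=> a x y; rewrite /hom_scale_fun linearP scalerDr !scalerA.
by rewrite mulr_algl mulr_algr.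
Qed.
HB.instance Definition _ :=
  GRing.isLinear.Build L M N _ hom_scale_fun hom_scale_linear.
Definition hom_scale : Hom := hom_scale_fun.
End Scale.

Fact hom_scaleA a b f : hom_scale a (hom_scale b f) = hom_scale (a * b) f.
Proof.
by apply: Hom_eq => x; rewrite /= /hom_scale_fun /= /hom_scale_fun scalerA mulr_algl scalerA.
Qed.
Fact hom_scale1 : left_id 1 hom_scale.
Proof. by move=> f; apply: Hom_eq => x; rewrite /= /hom_scale_fun !scale1r. Qed.
Fact hom_scaleDr : right_distributive hom_scale +%R.
Proof. by move=> a f g; apply: Hom_eq => x; exact: scalerDr. Qed.
Fact hom_scaleDl f : {morph hom_scale^~ f : a b / a + b}.
Proof.
move=> a b; apply: Hom_eq => x.
by rewrite /= /hom_scale_fun scalerDl; exact: scalerDl.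
Qed.
HB.instance Definition _ := GRing.Zmodule_isLmodule.Build k Hom
  hom_scaleA hom_scale1 hom_scaleDr hom_scaleDl.
End Hom.

Section Kernel.
Variables (M N : lmodType L) (f : {linear M -> N}).
Fact ker_closed : GRing.submod_closed (fun x => f x == 0).
Proof.
split=> [|a x y /eqP fx /eqP fy]; apply/eqP; first exact: linear0.
by rewrite linearP fx fy scaler0 addr0.
Qed.
Definition kermod : lmodType L := submod (Submodule ker_closed).
End Kernel.

Definition projective (Q : lmodType L) : Prop :=
  forall (M N : lmodType L) (g : {linear M -> N}) (f : {linear Q -> N}),
    (forall y, exists x, g x = y) ->
    exists h : {linear Q -> M}, forall x, g (h x) = f x.

(* An exact sequence of projectives
   ... -> res_obj 1 -> res_obj 0 -> M -> 0. *)
Record projective_resolution (M : lmodType L) := ProjectiveResolution {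
  res_obj :> nat -> lmodType L;
  res_d : forall n, {linear res_obj n.+1 -> res_obj n};
  res_eps : {linear res_obj 0 -> M};
  res_projective : forall n, projective (res_obj n);
  res_eps_surj : forall x, exists y, res_eps y = x;
  res_exact0 : forall x, res_eps x = 0 <-> exists y, res_d 0 y = x;
  res_exact : forall n x, res_d n x = 0 <-> exists y, res_d n.+1 y = x
}.

(* The free resolution of M obtained by iterating the free cover of a module N
   by the free L-module on the set N, and passing to its kernel. *)
Section FreeResolution.

Definition free_lift (M N : lmodType L) (s : M -> N) : {freeg M / L} -> N :=
  fglift s.

Fact free_lift_linear (M N : lmodType L) (s : M -> N) : linear (free_lift s).
Proof.
have sB : zmod_morphism (free_lift s) by exact: lift_is_additive.
pose sA := GRing.isZmodMorphism.Build _ _ (free_lift s) sB.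
pose F : {additive {freeg M / L} -> N} := HB.pack (free_lift s) sA.
have sZ a D : free_lift s (a *: D) = a *: free_lift s D.
  have -> : a *: D = \sum_(x <- dom D) << a * coeff x D *g x >> by [].
  rewrite -[in RHS](freeg_sumE D) [LHS](raddf_sum F).
  rewrite [X in _ = _ *: X](raddf_sum F) scaler_sumr; apply: eq_bigr => x _.
  by rewrite /= /free_lift !liftU scalerA.
by move=> a x y; rewrite -sZ; exact: (raddfD F).
Qed.
HB.instance Definition _ (M N : lmodType L) (s : M -> N) :=
  GRing.isLinear.Build L {freeg M / L} N _ (free_lift s) (free_lift_linear s).

Definition free_cover (M : lmodType L) : {linear {freeg M / L} -> M} := free_lift id.

Lemma free_cover_surj M x : exists y, @free_cover M y = x.
Proof. by exists << x >>; rewrite /free_cover /= /free_lift liftU scale1r. Qed.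

Lemma free_projective (M : lmodType L) : projective {freeg M / L}.
Proof.
move=> A B g f gsurj; pose s x : A := projT1 (cid (gsurj (f << x >>))).
have sP x : g (s x) = f << x >> by rewrite /s; case: cid.
exists (free_lift s) => D; rewrite -[D]freeg_sumE !linear_sum.
apply: eq_bigr => x _; rewrite /= /free_lift liftU linearZ /= sP -linearZ /=.
congr (f _); apply/eqP/freeg_eqP => y.
by rewrite coeffZ !coeffU mul1r.
Qed.

Fixpoint syzygy (M : lmodType L) (n : nat) : lmodType L :=
  if n is n'.+1 then kermod (free_cover (syzygy M n')) else M.

Definition free_obj M n : lmodType L := {freeg (syzygy M n) / L}.

Definition free_d M n (x : free_obj M n.+1) : free_obj M n :=
  val (free_cover (syzygy M n.+1) x).

Fact free_d_linear M n : linear (@free_d M n).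
Proof. by move=> a x y; rewrite /free_d linearP. Qed.
HB.instance Definition _ M n := GRing.isLinear.Build L
  (free_obj M n.+1) (free_obj M n) _ (@free_d M n) (@free_d_linear M n).

Fact free_exact0 M (x : free_obj M 0) :
  free_cover M x = 0 <-> exists y, @free_d M 0 y = x.
Proof.
split=> [x0|[y <-]]; last exact/eqP/(submod_valP (free_cover (syzygy M 1) y)).
have Sx : Submodule (ker_closed (free_cover M)) x by exact/eqP.
by have [y yP] := free_cover_surj (Submod Sx : syzygy M 1); exists y; rewrite /free_d yP.
Qed.

Fact free_exact M n (x : free_obj M n.+1) :
  @free_d M n x = 0 <-> exists y, @free_d M n.+1 y = x.
Proof.
have d0 (z : free_obj M n.+1) : @free_d M n z = 0 <-> free_cover (syzygy M n.+1) z = 0.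
  by rewrite /free_d; split=> [z0|->]; [exact: val_inj|].
split=> [/d0 x0|[y <-]].
  have Sx : Submodule (ker_closed (free_cover (syzygy M n.+1))) x by exact/eqP.
  have [y yP] := free_cover_surj (Submod Sx : syzygy M n.+2).
  by exists y; rewrite /free_d yP.
exact/d0/eqP/(submod_valP (free_cover (syzygy M n.+2) y)).
Qed.

Definition free_resolution M : projective_resolution M :=
  @ProjectiveResolution M (free_obj M) (@free_d M) (free_cover M)
    (fun n => @free_projective (syzygy M n)) (@free_cover_surj M)
    (@free_exact0 M) (@free_exact M).

End FreeResolution.

Section Ext.
Variables (M : lmodType L) (P : projective_resolution M) (N : lmodType L).

Fact cocycle_closed n :
  GRing.submod_closed (fun f : Hom (P n) N => `[< forall x, f (res_d P n x) = 0 >]).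
Proof.
split=> [|a f g /asboolP f0 /asboolP g0]; apply/asboolP => // x.
by rewrite -[LHS]/(a%:A *: f _ + g _) f0 g0 scaler0 addr0.
Qed.
Definition cocycle n : lmodType k := submod (Submodule (@cocycle_closed n)).

Definition is_coboundary n : Hom (P n) N -> Prop :=
  if n is n'.+1 return Hom (P n) N -> Prop
  then fun f => exists h : Hom (P n') N, forall x, f x = h (res_d P n' x)
  else fun f => f = 0.

Fact coboundary_closed n :
  GRing.submod_closed (fun f : cocycle n => `[< is_coboundary (val f) >]).
Proof.
split=> [|a f g /asboolP f0 /asboolP g0]; apply/asboolP.
  by case: n => [|n] //=; exists 0.
case: n f g f0 g0 => [|n] /= f g.
  by move=> f0 g0; change (a *: submod_val f + submod_val g = 0);
    rewrite (f0 : submod_val f = 0) (g0 : submod_val g = 0) scaler0 addr0.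
move=> [h hP] [h' h'P]; exists (a *: h + h') => x.
by rewrite -[LHS]/(a%:A *: val f x + val g x) hP h'P.
Qed.
(* H^n(Hom_L(P, N)) *)
Definition Ext_res n : lmodType k := quomod (Submodule (@coboundary_closed n)).
End Ext.

Definition Ext n (M N : lmodType L) : lmodType k := Ext_res (free_resolution M) N n.

Section HomExt.
Variables (M N : lmodType L) (phi : {linear M -> N}).
Let P := free_resolution M.
Fact hom_cocycle :
  Submodule (@cocycle_closed M P N 0) (phi \o res_eps P : {linear P 0 -> N}).
Proof.
by apply/asboolP=> x /=; rewrite (_ : free_cover M _ = 0) ?linear0 //; apply/free_exact0; exists x.
Qed.
(* The canonical embedding of Hom_L(M, N) into Ext^0: phi |-> [phi \o eps]. *)
Definition hom_Ext0 : Ext 0 M N := quo_class _ (Submod hom_cocycle).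
End HomExt.

Lemma projective_lift (Q A B : lmodType L) (g : {linear A -> B})
    (f : {linear Q -> B}) :
  projective Q -> (forall x, exists a, g a = f x) ->
  exists h : {linear Q -> A}, forall x, g (h x) = f x.
Proof.
move=> projQ fg.
have imC : GRing.submod_closed (fun b : B => `[< exists a, g a = b >]).
  split=> [|c u v /asboolP[u' <-] /asboolP[v' <-]]; apply/asboolP.
    by exists 0; exact: linear0.
  by exists (c *: u' + v'); exact: linearP.
pose im := submod (Submodule imC).
have gI a : Submodule imC (g a) by apply/asboolP; exists a.
have fI x : Submodule imC (f x) by exact/asboolP.
have gL : linear (fun a => Submod (gI a) : im).
  by move=> c u v; apply: val_inj; exact: linearP.
have fL : linear (fun x => Submod (fI x) : im).
  by move=> c u v; apply: val_inj; exact: linearP.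
pose g' : {linear A -> im} := HB.pack (fun a => Submod (gI a) : im)
  (GRing.isLinear.Build _ _ _ _ _ gL).
pose f' : {linear Q -> im} := HB.pack (fun x => Submod (fI x) : im)
  (GRing.isLinear.Build _ _ _ _ _ fL).
have [|h hP] := projQ A im g' f'.
  by case=> b /[dup] /asboolP[a ab] bI; exists a; apply: val_inj.
by exists h => x; have /(congr1 (@submod_val _ _ _)) := hP x.
Qed.

Section ChainLift.
Variables (M N : lmodType L).
Variables (P : projective_resolution M) (Q : projective_resolution N).
Variables (q : nat) (g : cocycle P N q).

Definition is_cycle b : Q b -> Prop :=
  if b is b'.+1 return Q b -> Prop then fun y => res_d Q b' y = 0
  else fun y => res_eps Q y = 0.

Definition liftable b (h : {linear P (b + q) -> Q b}) : Prop :=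
  forall x, is_cycle (h (res_d P (b + q) x)).

Lemma chain_lift0_ex : exists h : {linear P q -> Q 0},
  @liftable 0 h /\ forall x, res_eps Q (h x) = submod_val g x.
Proof.
have [h hP] := @res_projective _ P q _ _ (res_eps Q) (submod_val g) (@res_eps_surj _ Q).
exists h; split=> // x; apply: etrans (hP _) _.
by have /asboolP := submod_valP g; apply.
Qed.

Lemma chain_liftS_ex b (h : {linear P (b + q) -> Q b}) : liftable h ->
  exists h' : {linear P (b.+1 + q) -> Q b.+1},
  liftable h' /\ forall x, res_d Q b (h' x) = h (res_d P (b + q) x).
Proof.
move=> hL.
have hI x : exists a, res_d Q b a = h (res_d P (b + q) x).
  by have := hL x; case: b h {hL} x => [|b] h x; [move/res_exact0|move/res_exact].
have [h' h'P] := @projective_lift _ _ _ (res_d Q b) (h \o res_d P (b + q))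
  (@res_projective _ P (b.+1 + q)) hI.
exists h'; split=> // x; apply: etrans (h'P _) _ => /=.
suff -> : res_d P (b + q) (res_d P (b.+1 + q) x) = 0 by exact: linear0.
by apply/res_exact; exists x.
Qed.

(* A chain map P_(b + q) -> Q_b lifting the cocycle g : P_q -> N. *)
Fixpoint chain_lift_seq b : {h : {linear P (b + q) -> Q b} | liftable h} :=
  if b is b'.+1 return {h : {linear P (b + q) -> Q b} | liftable h} then
    let h := chain_lift_seq b' in
    let h' := cid (chain_liftS_ex (svalP h)) in exist _ (sval h') (svalP h').1
  else let h := cid chain_lift0_ex in exist _ (sval h) (svalP h).1.

Definition chain_lift b : {linear P (b + q) -> Q b} := sval (chain_lift_seq b).

Lemma chain_lift_eps x : res_eps Q (chain_lift 0 x) = submod_val g x.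
Proof. exact: (svalP (cid chain_lift0_ex)).2. Qed.

Lemma chain_lift_d b x : res_d Q b (chain_lift b.+1 x) = chain_lift b (res_d P (b + q) x).
Proof. exact: (svalP (cid (chain_liftS_ex (svalP (chain_lift_seq b))))).2. Qed.
End ChainLift.

(* The Yoneda product of x = [f : Q_p -> Z] and y = [g : P_q -> Y], where P and Q
   resolve X and Y, is the class of f \o g_p : P_(p + q) -> Z, where
   (g_b : P_(b + q) -> Q_b)_b is a chain map lifting g.  That class does not depend
   on the representatives f and g or on the lifting. *)
Section Yoneda.
Variables (X Y Z : lmodType L) (p q : nat).
Variables (x : Ext p Y Z) (y : Ext q X Y).
Let f : cocycle (free_resolution Y) Z p := quo_repr x.
Let g : cocycle (free_resolution X) Y q := quo_repr y.

Fact yoneda_cocycle : Submodule (@cocycle_closed X (free_resolution X) Z (p + q))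
  (submod_val f \o chain_lift (free_resolution Y) g p :
     {linear free_resolution X (p + q) -> Z}).
Proof.
apply/asboolP => u /=; rewrite -chain_lift_d.
by have /asboolP := submod_valP f; apply.
Qed.
Definition yoneda : Ext (p + q) X Z := quo_class _ (Submod yoneda_cocycle).
End Yoneda.

Section YonedaAlgebra.
Variable M : lmodType L.

Definition yoneda_algebra : lmodType k := dsum (fun n => Ext n M M).

Definition yoneda_comp n (x : yoneda_algebra) : Ext n M M :=
  dsum_proj (V := fun n => Ext n M M) n x.

Definition yoneda_inj n (z : Ext n M M) : yoneda_algebra :=
  dsum_inj (V := fun n => Ext n M M) z.

Definition yoneda_degree n (x : yoneda_algebra) : Prop :=
  exists z : Ext n M M, x = yoneda_inj z.

(* The bilinear extension of the Yoneda product to the direct sum; almost all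
   terms vanish, as yoneda 0 y = 0 and yoneda x 0 = 0. *)
Definition yoneda_mul (x y : yoneda_algebra) : yoneda_algebra :=
  \sum_(p \in [set: nat]) \sum_(q \in [set: nat])
    yoneda_inj (yoneda (yoneda_comp p x) (yoneda_comp q y)).

Definition yoneda_of_hom (phi : {linear M -> M}) : yoneda_algebra :=
  yoneda_inj (hom_Ext0 phi).
End YonedaAlgebra.

Definition finite_dimensional (M : lmodType L) : Prop :=
  exists s : seq M, forall x, exists c : 'I_(size s) -> k,
    x = \sum_(i < size s) (c i)%:A *: s`_i.

Definition isomorphic (M N : lmodType L) : Prop :=
  exists (f : {linear M -> N}) (g : {linear N -> M}), cancel f g /\ cancel g f.

Definition indecomposable (M : lmodType L) : Prop :=
  (exists x : M, x != 0) /\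
  forall U V : submodule M,
    (forall x, U x -> V x -> x = 0) ->
    (forall x, exists u v, [/\ U u, V v & x = u + v]) ->
    (forall x, U x -> x = 0) \/ (forall x, V x -> x = 0).

Section Subquotient.
Variables (M : lmodType L) (U V : submodule M).
Fact subquotient_closed :
  GRing.submod_closed (fun x : submod V => U (submod_val x)).
Proof.
have [U0 UL] := submodule_closed U.
by split=> [|a x y Ux Uy]; [exact: U0 | exact: (UL a _ _ Ux Uy)].
Qed.
(* V / (U :&: V), used with U contained in V *)
Definition subquotient : lmodType L := quomod (Submodule subquotient_closed).
End Subquotient.

Section HomologicalSystem.
Variables (d : Order.disp_t) (I : finPreorderType d) (Delta : I -> lmodType L).

Definition filtered (M : lmodType L) : Prop :=
  exists (n : nat) (F : nat -> submodule M),
    [/\ forall x, F 0 x -> x = 0,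
        forall x, F n x &
        forall t, (t < n)%N ->
          (forall x, F t x -> F t.+1 x) /\
          exists i, isomorphic (subquotient (F t) (F t.+1)) (Delta i)].

Definition sim (i j : I) : bool := (i <= j)%O && (j <= i)%O.

Record homological_system : Prop := HomologicalSystem {
  hs_nonempty : (0 < #|I|)%N;
  hs_findim : forall i, finite_dimensional (Delta i);
  hs_indec : forall i, indecomposable (Delta i);
  hs_noniso : forall i j, i != j -> ~ isomorphic (Delta i) (Delta j);
  hs_hom : forall i j, (exists f : Hom (Delta i) (Delta j), f != 0) -> (i <= j)%O;
  hs_ext1 : forall i j, (exists x : Ext 1 (Delta i) (Delta j), x != 0) ->
    (i <= j)%O && ~~ sim i j
}.

Definition indecomposable_projective (Q : lmodType L) : Prop :=
  [/\ finite_dimensional Q, indecomposable Q & projective Q].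

Record admissible_homological_system : Prop := AdmissibleHomologicalSystem {
  admissible_hs : homological_system;
  admissible_regular : filtered L^o;
  (* Q lists the indecomposable projectives up to isomorphism, without repetition *)
  admissible_card : exists Q : I -> lmodType L,
    [/\ forall i, indecomposable_projective (Q i),
        forall i j, isomorphic (Q i) (Q j) -> i = j &
        forall Q', indecomposable_projective Q' -> exists i, isomorphic Q' (Q i)]
}.

Record strict_homological_system : Prop := StrictHomologicalSystem {
  strict_admissible : admissible_homological_system;
  strict_ext : forall n i j, (1 <= n)%N ->
    (exists x : Ext n (Delta i) (Delta j), x != 0) -> (i <= j)%O && ~~ sim i j
}.

Definition Delta_sum : lmodType L := dsum Delta.

Definition idempotent_class (j : I) : yoneda_algebra Delta_sum :=
  yoneda_of_hom (dsum_inj (i := j) \o dsum_proj (V := Delta) j :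
    {linear Delta_sum -> Delta_sum}).

(* The element \sum_j s_j e_j of S = \bigoplus_j k e_j, viewed in the Yoneda
   algebra. *)
Definition S_elt (s : {ffun I -> k}) : yoneda_algebra Delta_sum :=
  \sum_j s j *: idempotent_class j.
End HomologicalSystem.
End Modules.

(* A-infinity structures on a graded S-S-bimodule A with actions [lact] and [ract],
   whose homogeneous elements of degree n are those satisfying [deg n].  An
   S-S-bimodule morphism from the n-th tensor power of A over S to A is a k-multilinear
   map of n arguments that is S-balanced and S-linear on both sides; the map
   m_n is the restriction of [m] to the sequences of size n.  The value of [m] on
   the empty sequence is irrelevant.

   In [Ainf_stasheff], n = size xs and t = n - r - s.  By the Koszul rule, evaluating
   id^r (x) m_s (x) id^t on homogeneous x_1, ..., x_n, of degrees ds, produces the sign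
   (-1)^((2 - s) (|x_1| + ... + |x_r|)) = (-1)^(s (|x_1| + ... + |x_r|)). *)
Section AInfinity.
Variables (k : fieldType) (A : lmodType k) (deg : nat -> A -> Prop).
Variables (S : Type) (lact : S -> A -> A) (ract : A -> S -> A).

Definition homogeneous_seq (ds : seq nat) (xs : seq A) : Prop :=
  size ds = size xs /\
  forall i, (i < size xs)%N -> deg (nth 0 ds i) (nth 0 xs i).

Record A_infinity_structure (m : seq A -> A) : Prop := AInfinityStructure {
  Ainf_linear : forall u v a x y,
    m (u ++ (a *: x + y) :: v) = a *: m (u ++ x :: v) + m (u ++ y :: v);
  Ainf_balanced : forall u v x s y,
    m (u ++ ract x s :: y :: v) = m (u ++ x :: lact s y :: v);
  Ainf_left : forall s x v, m (lact s x :: v) = lact s (m (x :: v));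
  Ainf_right : forall u x s, m (rcons u (ract x s)) = ract (m (rcons u x)) s;
  (* m_n has degree 2 - n, and A vanishes in negative degrees *)
  Ainf_degree : forall ds xs, homogeneous_seq ds xs -> (1 <= size xs)%N ->
    if (size xs <= sumn ds + 2)%N then deg (sumn ds + 2 - size xs)%N (m xs)
    else m xs = 0;
  Ainf_stasheff : forall ds xs, homogeneous_seq ds xs -> (1 <= size xs)%N ->
    \sum_(0 <= r < size xs) \sum_(1 <= s < (size xs - r).+1)
      (-1) ^+ (r + s * (size xs - r - s) + s * sumn (take r ds))%N *:
        m (take r xs ++ m (take s (drop r xs)) :: drop (r + s) xs) = 0
}.
End AInfinity.

(* Main.v *)
(* Homotopy transfer. Let T be the total complex of the direct sum of free resolutions of
   the Delta_j. Its endomorphisms of bounded degree form a dg algebra E whose cohomology is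
   the Yoneda algebra A, and the projections of T onto the summands resolving the Delta_j are
   orthogonal idempotent cycles of E lifting the e_j. Since S is spanned by these
   idempotents, a generalized inverse of the differential of E can be averaged into a
   homogeneous S-bilinear contraction h of E onto A, with h h = 0 and with the idempotents in
   the image of the inclusion i : A -> E; the latter is possible because no nontrivial linear
   combination of them is a boundary. The recursion g(x) = i(x), g = - h (sum of g * g) and
   the higher products p (sum of g * g) then give the A-infinity structure; an argument e_j
   in g yields h(e_j h(...)) = e_j h(h(...)) = 0, and similarly for p, hence strict
   unitality. *)
From HB Require Import structures.
Require Import Defs.
From mathcomp Require Import all_boot all_order all_algebra all_field.
From mathcomp Require Import boolp classical_sets cardinality fsbigop.
From mathcomp Require Import zify.
Set Implicit Arguments.
Unset Strict Implicit.
Unset Printing Implicit Defensive.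
Import GRing.Theory.
Local Open Scope ring_scope.

(** * Linear algebra and gradings *)

(** Two resolutions of Δ occur. The classes of A live on the free resolution of Δ, where the e_j
    have no evident lifts to strictly orthogonal idempotent chain maps; the sum of the resolutions
    of the Δ_j has such lifts, so E is built on it. Chain maps [psi] and [phi] over the identity
    compare the two. The comparison is kept as a relation between cycles of E and elements of A: Ext
    groups are quotients and the Yoneda product is defined through chosen representatives, so
    linearity and independence of choices are obtained by showing that the relation is functional,
    onto and compatible with products. Signs shape the rest. Parities are linear operators, so that
    identities hold for all elements and not only for homogeneous ones. The transfer is done on the
    suspension, where all operations have degree 1 and the Stasheff identities become one equation;
    the signs of the m_n are restored at the end by twisting the arguments. The differential of E is
    normalized so that its cycles commute with the differential of T without sign, as the chain maps
    in the Yoneda product do. *)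

Section LinearRelations.
Variables (R : pzRingType) (V W : lmodType R).

Lemma linear_of_fun (f : V -> W) : linear f ->
  exists g : {linear V -> W}, forall x, g x = f x.
Proof.
move=> fL; pose g : {linear V -> W} := HB.pack f (GRing.isLinear.Build _ _ _ _ _ fL).
by exists g.
Qed.

(** The hypotheses make [P] the graph of a function, since the difference of two values at one point
    is related to 0. The maps between [E] and cohomology arise this way, from representatives that
    are not chosen linearly. *)
Lemma linear_of_rel (P : V -> W -> Prop) :
  (forall x, exists y, P x y) -> (forall y, P 0 y -> y = 0) ->
  (forall a x y x' y', P x y -> P x' y' -> P (a *: x + x') (a *: y + y')) ->
  exists g : {linear V -> W}, forall x, P x (g x).
Proof.
move=> Pex P0 Plin; have [f fP] := choice Pex.
have fL : linear f.
  move=> a x y; apply/eqP; rewrite -subr_eq0; apply/eqP/P0.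
  have := Plin (-1) _ _ _ _ (Plin a _ _ _ _ (fP x) (fP y)) (fP (a *: x + y)).
  by rewrite !scaleN1r addNr [X in P _ X -> _]addrC.
have [g gE] := linear_of_fun fL; exists g => x.
by rewrite gE; exact: fP.
Qed.

End LinearRelations.

(** * Complements and generalized inverses over a field *)

Section GeneralizedInverse.
Variable k : fieldType.

Local Open Scope classical_set_scope.

Lemma subspace_complement (V : lmodType k) (U : V -> Prop) :
  U 0 -> (forall a x y, U x -> U y -> U (a *: x + y)) ->
  exists W : V -> Prop,
    [/\ forall a x y, W x -> W y -> W (a *: x + y),
        forall x, U x -> W x -> x = 0 &
        forall x, exists u w, [/\ U u, W w & x = u + w]].
Proof.
move=> U0 UL.
have US a x : U x -> U (a *: x) by move=> Ux; rewrite -[_ *: _]addr0; apply: UL.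
pose P (W : set V) := (forall a x y, W x -> W y -> W (a *: x + y)) /\
  (forall x, U x -> W x -> x = 0).
have [F FP Ftot|A [[AL AU] Amax]] := @Zorn_bigcup V P.
  split=> [a x y [X FX Xx] [Y FY Yy]|x Ux [X FX Xx]]; last exact: (FP _ FX).2 Ux Xx.
  by case: (Ftot _ _ FX FY) => XY; [exists Y | exists X] => //;
    apply: (FP _ _).1 => //; exact: XY.
(* The empty set satisfies [P], as the union of the empty chain must. An [A] without 0 would be
   empty, and {0} would then contradict maximality. *)
have A0 : A 0.
  apply: contrapT => NA0; apply: (Amax (A `|` [set 0])).
    by split=> [|H]; [move=> x; left | apply: NA0; apply: H; right].
  have Ae x : ~ A x.
    by move=> Ax; apply: NA0; have := AL (-1) _ _ Ax Ax; rewrite scaleN1r addNr.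
  split=> [a x y [/Ae//|->] [/Ae//|->]|x _ [/Ae//|//]].
  by right; rewrite scaler0 addr0.
exists A; split=> // v; apply: contrapT => Nv.
pose B := [set x | exists c w, A w /\ x = w + c *: v].
apply: (Amax B).
  split=> [x Ax|BA]; first by exists 0, x; rewrite scale0r addr0.
  apply: Nv; exists 0, v; rewrite add0r; split=> //; apply: BA.
  by exists 1, 0; rewrite scale1r add0r.
split=> [a _ _ [c [w [Aw ->]]] [c' [w' [Aw' ->]]]|x Ux [c [w [Aw xE]]]].
  exists (a * c + c'), (a *: w + w'); split; first exact: AL.
  by rewrite scalerDl scalerDr scalerA addrACA.
have [c0|c0] := eqVneq c 0.
  by apply: AU => //; rewrite xE c0 scale0r addr0.
case: Nv; exists (c^-1 *: x), (- c^-1 *: w + 0); split; [exact: US|exact: AL|].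
by rewrite xE scalerDr scalerA mulVf // scale1r addr0 scaleNr addrAC addrN add0r.
Qed.

(** With [C] complementary to the kernel and [B] to the image, [g y] is the unique element of [C]
    whose image differs from [y] by an element of [B]. *)
Lemma linear_geninv (V W : lmodType k) (f : {linear V -> W}) :
  exists g : {linear W -> V}, forall x, f (g (f x)) = f x.
Proof.
have [||C [CL CU Cex]] := @subspace_complement V (fun x => f x = 0).
- exact: linear0.
- by move=> a x y fx fy; rewrite linearP fx fy scaler0 addr0.
have [||B [BL BU Bex]] := @subspace_complement W (fun y => exists x, f x = y).
- by exists 0; exact: linear0.
- by move=> a _ _ [x <-] [y <-]; exists (a *: x + y); exact: linearP.
have [|||g gP] := @linear_of_rel _ W V (fun y x => C x /\ B (y - f x)).
- move=> y; have [_ [w [[x <-] Bw ->]]] := Bex y.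
  have [u [c [fu Cc ->]]] := Cex x; exists c; split=> //.
  by rewrite linearD /= fu add0r addrC addKr.
- move=> x [Cx]; rewrite sub0r => Bx; apply: CU => //.
  by apply/eqP; rewrite -oppr_eq0; apply/eqP/BU => //; exists (- x); exact: linearN.
- move=> a y x y' x' [Cx Bx] [Cx' Bx']; split; first exact: CL.
  suff -> : a *: y + y' - f (a *: x + x') = a *: (y - f x) + (y' - f x') by exact: BL.
  by rewrite linearP scalerBr opprD addrACA.
exists g => x; apply/eqP; rewrite -subr_eq0 -oppr_eq0 opprB; apply/eqP/BU.
  by exists (x - g (f x)); exact: linearB.
by have [] := gP (f x).
Qed.

End GeneralizedInverse.

(** * Gradings given by orthogonal projections *)

Section Gradings.
Variables (R : pzRingType) (K : choiceType).

(** Projections are used instead of a decomposition into summands, so that direct sums and the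
    endomorphism algebra, whose homogeneous pieces are not separate types, are treated alike. *)
Record grading (V : lmodType R) := Grading {
  part :> K -> {linear V -> V};
  part_part : forall a b x, part a (part b x) = if a == b then part a x else 0;
  part_sum : forall x, exists s : seq K, x = \sum_(a <- s) part a x
}.

Variables (V W : lmodType R) (gr : grading V).

Lemma part_id a x : gr a (gr a x) = gr a x.
Proof. by rewrite part_part eqxx. Qed.

Lemma part_neq a b x : a != b -> gr a (gr b x) = 0.
Proof. by rewrite part_part => /negPf->. Qed.

Lemma part_support x : exists s : seq K,
  uniq s /\ forall a, a \notin s -> gr a x = 0.
Proof.
have [s xE] := part_sum gr x; exists (undup s); split; first exact: undup_uniq.
move=> a; rewrite mem_undup => as'; rewrite xE linear_sum big_seq big1 // => b bs.
by rewrite part_neq //; apply: contraNneq as' => ->.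
Qed.

Lemma eq_on_parts (f g : {linear V -> W}) :
  (forall a x, f (gr a x) = g (gr a x)) -> forall x, f x = g x.
Proof.
move=> fg x; have [s ->] := part_sum gr x.
by rewrite !linear_sum; apply: eq_bigr => a _.
Qed.

Lemma eq_on_homog (f g : {linear V -> W}) :
  (forall a x, gr a x = x -> f x = g x) -> forall x, f x = g x.
Proof. by move=> fg; apply: eq_on_parts => a x; exact/fg/part_id. Qed.

Lemma sum_support (F : K -> W) (s t : seq K) : uniq s -> uniq t ->
  (forall a, a \in s -> a \notin t -> F a = 0) ->
  (forall a, a \in t -> a \notin s -> F a = 0) ->
  \sum_(a <- s) F a = \sum_(a <- t) F a.
Proof.
move=> us ut s0 t0.
rewrite (bigID (mem t)) /= [X in _ + X]big_seq_cond [X in _ + X]big1 ?addr0; last first.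
  by move=> a /andP[]; exact: s0.
rewrite [RHS](bigID (mem s)) /= [X in _ = _ + X]big_seq_cond.
rewrite [X in _ = _ + X]big1 ?addr0; last first.
  by move=> a /andP[]; exact: t0.
rewrite -big_filter -[RHS]big_filter; apply/perm_big/uniq_perm; rewrite ?filter_uniq // => a.
by rewrite !mem_filter andbC.
Qed.

(** The value at [x] is a finite sum over any finite set containing the support of [x]; its
    independence of that set gives linearity. *)
Lemma glue_parts (c : K -> {linear V -> W}) :
  exists C : {linear V -> W}, forall a x, C (gr a x) = c a (gr a x).
Proof.
pose sup (s : seq K) x := uniq s /\ forall a, a \notin s -> gr a x = 0.
pose P x y := exists2 s, sup s x & y = \sum_(a <- s) c a (gr a x).
have [|||C CP] := @linear_of_rel _ V W P.
- by move=> x; have [s sP] := part_support x; exists (\sum_(a <- s) c a (gr a x)), s.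
- by move=> _ [s sP ->]; rewrite big1 // => a _; rewrite !linear0.
- move=> a x y x' y' [s [us s0] ->] [t [ut t0] ->].
  exists (undup (s ++ t)).
    split=> [|b]; first exact: undup_uniq.
    rewrite mem_undup mem_cat negb_or => /andP[bs bt].
    by rewrite linearP /= s0 ?t0 // scaler0 addr0.
  rewrite (@sum_support _ s (undup (s ++ t))) ?undup_uniq //; first last.
  - by move=> b _ bs; rewrite s0 // linear0.
  - by move=> b bs; rewrite mem_undup mem_cat bs.
  rewrite (@sum_support _ t (undup (s ++ t))) ?undup_uniq //; first last.
  - by move=> b _ bt; rewrite t0 // linear0.
  - by move=> b bt; rewrite mem_undup mem_cat bt orbT.
  by rewrite scaler_sumr -big_split; apply: eq_bigr => b _; rewrite !linearP.
exists C => a x; have [s [us s0] ->] := CP (gr a x).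
rewrite (@sum_support _ s [:: a]) //.
- by rewrite big_seq1 part_id.
- by move=> b _; rewrite inE => ba; rewrite part_neq ?linear0.
- by move=> b; rewrite inE => /eqP-> /s0; rewrite part_id => ->; rewrite linear0.
Qed.

End Gradings.

(** * Direct sums *)

Arguments dsum_proj : simpl never.
Arguments dsum_inj : simpl never.

Section DirectSums.
Variables (R : pzRingType) (I : choiceType).
Implicit Types V W : I -> lmodType R.

Lemma dsum_ext V (x y : dsum V) : (forall i, dsum_proj i x = dsum_proj i y) -> x = y.
Proof. by move=> xy; apply/val_inj/functional_extensionality_dep. Qed.

Lemma dsum_injK V i (v : V i) : dsum_proj i (dsum_inj v) = v.
Proof.
rewrite /dsum_proj /= /inj_fun; case: eqP => // e.
by rewrite (eq_axiomK e).
Qed.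

Lemma dsum_proj_inj_neq V i j (v : V i) : i != j -> dsum_proj j (dsum_inj v) = 0.
Proof. by rewrite /dsum_proj /= /inj_fun; case: eqP. Qed.

Lemma dsum_sum V (x : dsum V) : exists2 s : seq I, uniq s &
  x = \sum_(i <- s) dsum_inj (dsum_proj i x).
Proof.
have /asboolP/finite_seqP[s sE] := submod_valP x.
exists (undup s); first exact: undup_uniq.
apply: dsum_ext => j; rewrite linear_sum /=.
have [js|js] := boolP (j \in undup s).
  rewrite (bigD1_seq j) ?undup_uniq //= dsum_injK big1 ?addr0 // => i ij.
  exact: dsum_proj_inj_neq.
rewrite big_seq big1 => [|i is_]; last first.
  by rewrite dsum_proj_inj_neq //; apply: contraNneq js => <-.
apply/eqP; apply: contraNT js => xj; rewrite mem_undup.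
have : [set i | submod_val x i != 0]%classic j by [].
by rewrite sE.
Qed.

Definition dsum_part V i : {linear dsum V -> dsum V} :=
  @dsum_inj R I V i \o dsum_proj (V := V) i.

Lemma dsum_part_part V i j (x : dsum V) :
  dsum_part V i (dsum_part V j x) = if i == j then dsum_part V i x else 0.
Proof.
rewrite /dsum_part /=; case: eqVneq => [->|ij]; first by rewrite dsum_injK.
by rewrite dsum_proj_inj_neq ?linear0 // eq_sym.
Qed.

Lemma dsum_part_sum V (x : dsum V) : exists s : seq I, x = \sum_(i <- s) dsum_part V i x.
Proof. by have [s _ xE] := dsum_sum x; exists s. Qed.

Definition dsum_grading V : grading I (dsum V) :=
  Grading (@dsum_part_part V) (@dsum_part_sum V).

Lemma dsum_glue V (W : lmodType R) (c : forall i, {linear V i -> W}) :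
  exists C : {linear dsum V -> W}, forall i v, C (dsum_inj (i := i) v) = c i v.
Proof.
have [C CE] := glue_parts (dsum_grading V)
  (fun i => [the {linear _ -> _} of c i \o dsum_proj (V := V) i]).
exists C => i v; have := CE i (dsum_inj v).
by rewrite /= /dsum_part /= !dsum_injK.
Qed.

Lemma eq_on_inj V (W : lmodType R) (f g : {linear dsum V -> W}) :
  (forall i v, f (dsum_inj (i := i) v) = g (dsum_inj v)) -> forall x, f x = g x.
Proof. by move=> fg; apply: (@eq_on_parts _ _ _ _ (dsum_grading V)) => i x; exact: fg. Qed.

Section Map.
Variables (V W : I -> lmodType R) (f : forall i, {linear V i -> W i}).

Lemma dsum_map_exists : exists F : {linear dsum V -> dsum W},
  forall i v, F (dsum_inj (i := i) v) = dsum_inj (f i v).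
Proof. exact: dsum_glue (fun i => [the {linear _ -> _} of @dsum_inj R I W i \o f i]). Qed.

Definition dsum_map : {linear dsum V -> dsum W} := sval (cid dsum_map_exists).

Lemma dsum_map_inj i v : dsum_map (dsum_inj (i := i) v) = dsum_inj (f i v).
Proof. exact: (svalP (cid dsum_map_exists)). Qed.

Lemma dsum_map_proj i x : dsum_proj i (dsum_map x) = f i (dsum_proj i x).
Proof.
apply: (@eq_on_inj V _ (dsum_proj (V := W) i \o dsum_map) (f i \o dsum_proj (V := V) i)) => j v /=.
rewrite dsum_map_inj; have [ji|ji] := eqVneq j i; first by case: i / ji; rewrite !dsum_injK.
by rewrite !dsum_proj_inj_neq ?linear0.
Qed.

Lemma dsum_map_preim (x : dsum W) : (forall i, exists v, f i v = dsum_proj i x) ->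
  exists y, dsum_map y = x.
Proof.
move=> /(_ _)/cid; move=> H; pose y i := sval (H i).
have [s _ xE] := dsum_sum x; exists (\sum_(i <- s) dsum_inj (y i)).
rewrite linear_sum [RHS]xE; apply: eq_bigr => i _ /=.
by rewrite dsum_map_inj /y (svalP (H i)).
Qed.

End Map.

Lemma dsum_map_exact (U V W : I -> lmodType R)
    (f : forall i, {linear U i -> V i}) (g : forall i, {linear V i -> W i}) :
  (forall i v, g i v = 0 <-> exists u, f i u = v) ->
  forall x, dsum_map g x = 0 <-> exists y, dsum_map f y = x.
Proof.
move=> fg x; split=> [gx|[y <-]].
  by apply: dsum_map_preim => i; apply/fg; rewrite -dsum_map_proj gx linear0.
by apply: dsum_ext => i; rewrite !dsum_map_proj linear0; apply/fg; exists (dsum_proj i y).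
Qed.

End DirectSums.

Lemma dsum_projective (k : fieldType) (L : falgType k) (I : choiceType) (V : I -> lmodType L) :
  (forall i, projective (V i)) -> projective (dsum V).
Proof.
move=> Vproj M N g f gsurj.
have H i := cid (Vproj i _ _ g [the {linear _ -> _} of f \o @dsum_inj L I V i] gsurj).
have [C CE] := dsum_glue (fun i => sval (H i)).
exists C; apply: (@eq_on_inj _ _ _ _ (g \o C) f) => i v /=.
by rewrite CE (svalP (H i)).
Qed.

(** * Direct sums of projective resolutions *)

Section SumResolution.
Variables (k : fieldType) (L : falgType k) (I : choiceType) (M : I -> lmodType L).
Variable P : forall i, projective_resolution (M i).

Definition sum_res_obj n : lmodType L := dsum (fun i => P i n : lmodType L).
Definition sum_res_d n : {linear sum_res_obj n.+1 -> sum_res_obj n} :=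
  dsum_map (fun i => res_d (P i) n).
Definition sum_res_eps : {linear sum_res_obj 0 -> dsum M} := dsum_map (fun i => res_eps (P i)).

(** Transparent, because the idempotents defined later act on its terms as direct sums by
    conversion. *)
Definition sum_resolution : projective_resolution (dsum M).
Proof.
apply: (@ProjectiveResolution k L (dsum M) sum_res_obj sum_res_d sum_res_eps).
- by move=> n; apply: dsum_projective => i; exact: res_projective.
- by move=> x; apply: dsum_map_preim => i; exact: res_eps_surj.
- by apply: dsum_map_exact => i v; exact: res_exact0.
- by move=> n; apply: dsum_map_exact => i v; exact: res_exact.
Defined.

End SumResolution.

(** * The transferred structure *)

Section SplitSums.
Variable T : Type.

(* The sum of [Phi u v] over all decompositions [xs = u ++ v]. *)
Fixpoint ssum (W : nmodType) (Phi : seq T -> seq T -> W) (xs : seq T) : W :=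
  Phi [::] xs + (if xs is x :: xs' then ssum (fun u => Phi (x :: u)) xs' else 0).

Variable W : nmodType.
Implicit Types Phi Psi : seq T -> seq T -> W.

Lemma eq_ssum Phi Psi xs : (forall u v, u ++ v = xs -> Phi u v = Psi u v) ->
  ssum Phi xs = ssum Psi xs.
Proof.
elim: xs Phi Psi => [|x xs IH] Phi Psi PP /=; first by rewrite PP.
by rewrite PP //; congr (_ + _); apply: IH => u v uv; apply: PP; rewrite -uv.
Qed.

Lemma ssum0 Phi xs : (forall u v, u ++ v = xs -> Phi u v = 0) -> ssum Phi xs = 0.
Proof.
move=> /eq_ssum ->; elim: xs => [|x xs IH] /=; first by rewrite addr0.
by rewrite IH addr0.
Qed.

Lemma ssumD Phi Psi xs :
  ssum (fun u v => Phi u v + Psi u v) xs = ssum Phi xs + ssum Psi xs.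
Proof.
elim: xs Phi Psi => [|x xs IH] Phi Psi /=; first by rewrite !addr0.
by rewrite IH addrACA.
Qed.

(** Coassociativity of deconcatenation: both sides run over the cuts of [xs] into three consecutive
    pieces. *)
Lemma ssum_assoc (Phi : seq T -> seq T -> seq T -> W) xs :
  ssum (fun u v => ssum (fun a b => Phi a b v) u) xs =
  ssum (fun a w => ssum (Phi a) w) xs.
Proof.
elim: xs Phi => [|x xs IH] Phi //=.
by rewrite ssumD IH addr0 addrA.
Qed.

Lemma ssum_exchange (Phi : seq T -> seq T -> seq T -> seq T -> W) xs ys :
  ssum (fun w c => ssum (Phi w c) xs) ys =
  ssum (fun a b => ssum (fun w c => Phi w c a b) ys) xs.
Proof.
elim: xs Phi => [|x xs IH] Phi /=; last by rewrite ssumD IH.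
by rewrite addr0; apply: eq_ssum => w c _; rewrite addr0.
Qed.

(** A cut falls before or after the marked letter [y], which will be either the output of an inner
    operation or the argument that is varied. *)
Lemma ssum_cat Phi a y c :
  ssum Phi (a ++ y :: c) =
  ssum (fun a1 a2 => Phi a1 (a2 ++ y :: c)) a +
  ssum (fun c1 c2 => Phi (a ++ y :: c1) c2) c.
Proof. by elim: a Phi => [|x a IH] Phi /=; rewrite ?addr0 // IH addrA. Qed.

Lemma ssum_first Phi xs : (forall x u v, Phi (x :: u) v = 0) -> ssum Phi xs = Phi [::] xs.
Proof.
by case: xs => [|x xs] Phi0 /=; rewrite ?addr0 // ssum0 ?addr0 // => u v _.
Qed.

Lemma ssum_last Phi xs : (forall u x v, Phi u (x :: v) = 0) -> ssum Phi xs = Phi xs [::].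
Proof.
by elim: xs Phi => [|x xs IH] Phi Phi0 /=; rewrite ?addr0 // Phi0 add0r IH.
Qed.

Lemma ssumE Phi xs :
  ssum Phi xs = \sum_(0 <= i < (size xs).+1) Phi (take i xs) (drop i xs).
Proof.
elim: xs Phi => [|x xs IH] Phi /=; first by rewrite big_nat1 addr0.
by rewrite big_nat_recl //= IH.
Qed.

End SplitSums.

Lemma ssum_map T T' (W : nmodType) (f : T -> T') (Phi : seq T' -> seq T' -> W) xs :
  ssum Phi (map f xs) = ssum (fun u v => Phi (map f u) (map f v)) xs.
Proof. by elim: xs Phi => [|x xs IH] Phi //=; rewrite IH. Qed.

Lemma linear_ssum (R : pzRingType) T (W W' : lmodType R) (f : {linear W -> W'})
    (Phi : seq T -> seq T -> W) xs :
  f (ssum Phi xs) = ssum (fun u v => f (Phi u v)) xs.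
Proof.
by elim: xs Phi => [|x xs IH] Phi /=; rewrite linearD ?linear0 ?IH.
Qed.

Lemma ssumZ (R : pzRingType) T (W : lmodType R) a (Phi : seq T -> seq T -> W) xs :
  a *: ssum Phi xs = ssum (fun u v => a *: Phi u v) xs.
Proof. by elim: xs Phi => [|x xs IH] Phi /=; rewrite scalerDr ?scaler0 ?IH. Qed.

Lemma ssumN T (W : zmodType) (Phi : seq T -> seq T -> W) xs :
  - ssum Phi xs = ssum (fun u v => - Phi u v) xs.
Proof. by elim: xs Phi => [|x xs IH] Phi /=; rewrite opprD ?oppr0 ?IH. Qed.

(** * Transfer along a contraction, on the suspension *)

Section Transfer.
Variables (k : fieldType) (A E : lmodType k) (mul : E -> E -> E).
Variables (D sE h : {linear E -> E}) (sA : {linear A -> A}).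
Variables (i : {linear A -> E}) (p : {linear E -> A}).

Hypothesis mul_linl : forall z, linear (mul^~ z).
Hypothesis mul_linr : forall z, linear (mul z).
Hypothesis mulA : associative mul.
Hypothesis D_mul : forall x y, D (mul x y) = mul (D x) y + mul (sE x) (D y).
Hypothesis sE_invol : forall x, sE (sE x) = x.
Hypothesis sE_mul : forall x y, sE (mul x y) = mul (sE x) (sE y).
Hypothesis sE_D : forall x, sE (D x) = - D (sE x).
Hypothesis sE_h : forall x, sE (h x) = - h (sE x).
Hypothesis sE_i : forall a, sE (i a) = i (sA a).
Hypothesis sA_p : forall x, sA (p x) = p (sE x).
Hypothesis sA_invol : forall x, sA (sA x) = x.
Hypothesis D_i : forall a, D (i a) = 0.
Hypothesis p_D : forall x, p (D x) = 0.
Hypothesis p_i : forall a, p (i a) = a.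
Hypothesis homotopy : forall x, i (p x) = x - D (h x) - h (D x).

Lemma mulDl x y z : mul (x + y) z = mul x z + mul y z.
Proof. by have := mul_linl z 1 x y; rewrite !scale1r. Qed.
Lemma mulDr x y z : mul z (x + y) = mul z x + mul z y.
Proof. by have := mul_linr z 1 x y; rewrite !scale1r. Qed.
Lemma mul0x z : mul 0 z = 0.
Proof. by apply: (addrI (mul 0 z)); rewrite -mulDl !addr0. Qed.
Lemma mulx0 z : mul z 0 = 0.
Proof. by apply: (addrI (mul z 0)); rewrite -mulDr !addr0. Qed.
Lemma mulNx x z : mul (- x) z = - mul x z.
Proof. by apply/eqP; rewrite -addr_eq0 -mulDl addNr mul0x. Qed.
Lemma mulxN x z : mul z (- x) = - mul z x.
Proof. by apply/eqP; rewrite -addr_eq0 -mulDr addNr mulx0. Qed.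

(* The parity of the suspension, where an element of degree n has degree n - 1. *)
Definition susp_parity (V : lmodType k) (s : {linear V -> V}) : {linear V -> V} := \- s.
Local Notation tE := (susp_parity sE).
Local Notation tA := (susp_parity sA).

Lemma tE_invol x : tE (tE x) = x.
Proof. by rewrite /= linearN opprK sE_invol. Qed.
Lemma tE_mul x y : tE (mul x y) = - mul (tE x) (tE y).
Proof. by rewrite /= mulNx mulxN opprK sE_mul. Qed.

(* The components of the A-infinity morphism A -> E; [n] bounds the length of [xs]. *)
Fixpoint transfer_rec n (xs : seq A) : E :=
  if xs is [:: x] then i x else
  if n is n'.+1 then
    - h (ssum (fun u v => mul (tE (transfer_rec n' u)) (transfer_rec n' v)) xs)
  else 0.

Definition transfer_mor xs := transfer_rec (size xs) xs.
Local Notation g := transfer_mor.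

(** [mul (tE x) y] is the product of [E] carried to the suspension, where it becomes an operation of
    degree 1. *)
Definition cut u v := mul (tE (g u)) (g v).
Definition transfer_sum xs := ssum cut xs.
Local Notation lam := transfer_sum.

Lemma transfer_rec0 n : transfer_rec n [::] = 0.
Proof. by elim: n => //= n ->; rewrite mulx0 !addr0 linear0 oppr0. Qed.

Lemma transfer_recS n x y xs : transfer_rec n.+1 [:: x, y & xs] =
  - h (ssum (fun u v => mul (tE (transfer_rec n u)) (transfer_rec n v)) [:: x, y & xs]).
Proof. by []. Qed.

Lemma mul_tE0 x y : x = 0 -> mul (tE x) y = 0.
Proof. by move=> ->; rewrite linear0 mul0x. Qed.

(** Cuts with an empty piece contribute 0, because the value at the empty word is 0. Only strictly
    shorter words matter, so any sufficient fuel gives the same value. *)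
Lemma transfer_rec_fuel n m xs : (size xs <= n)%N -> (size xs <= m)%N ->
  transfer_rec n xs = transfer_rec m xs.
Proof.
elim: n m xs => [|n IH] [|m] [|x [|y xs]] //; rewrite ?transfer_rec0 // => xsn xsm.
rewrite !transfer_recS; congr (- h _); apply: eq_ssum => u v uv.
have szs : (size u + size v = (size xs).+2)%N by rewrite -size_cat uv.
case: v uv szs => [|z v] uv szs; first by rewrite !transfer_rec0 !mulx0.
case: u uv szs => [|w u] uv szs; first by rewrite !mul_tE0 ?transfer_rec0.
rewrite /= in szs xsn xsm.
by rewrite (IH m (w :: u)) ?(IH m (z :: v)) //=; lia.
Qed.

Lemma transfer_mor0 : g [::] = 0. Proof. by []. Qed.
Lemma transfer_mor1 x : g [:: x] = i x. Proof. by []. Qed.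

Lemma cut0r u : cut u [::] = 0. Proof. exact: mulx0. Qed.
Lemma cut0l v : cut [::] v = 0.
Proof. exact: mul_tE0. Qed.

Lemma transfer_sum1 x : lam [:: x] = 0.
Proof. by rewrite /lam /= cut0l cut0r !addr0. Qed.

Lemma transfer_sum0 : lam [::] = 0.
Proof. by rewrite /lam /= cut0l !addr0. Qed.

Lemma transfer_morE xs : size xs != 1 -> g xs = - h (lam xs).
Proof.
case: xs => [|x [|y xs]] // _; first by rewrite transfer_sum0 linear0 oppr0.
rewrite [LHS]transfer_recS; congr (- h _); apply: eq_ssum => u v uv.
have szs : (size u + size v = (size xs).+2)%N by rewrite -size_cat uv.
case: v uv szs => [|z v] uv szs; first by rewrite cut0r transfer_rec0 mulx0.
case: u uv szs => [|w u] uv szs; first by rewrite cut0l mul_tE0 ?transfer_rec0.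
rewrite /= in szs; rewrite /cut /transfer_mor.
by congr (mul (tE _) _); apply: transfer_rec_fuel => /=; rewrite -?/(size xs); lia.
Qed.

Lemma cut_split_ind (P : seq A -> Prop) :
  P [::] -> (forall x, P [:: x]) ->
  (forall xs, (1 < size xs)%N ->
     (forall u v, u ++ v = xs -> u <> [::] -> v <> [::] -> P u /\ P v) -> P xs) ->
  forall xs, P xs.
Proof.
move=> P0 P1 PS xs; have [n] := ubnP (size xs); elim: n xs => // n IH [|x [|y xs]] // xsn.
apply: PS => // u v uv u0 v0.
have szs : (size u + size v = (size xs).+2)%N by rewrite -size_cat uv.
have szu : (0 < size u)%N by case: u u0 {uv szs}.
have szv : (0 < size v)%N by case: v v0 {uv szs}.
by rewrite /= in xsn; split; apply: IH; lia.
Qed.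

Lemma tE_h x : tE (h x) = - h (tE x).
Proof. by rewrite /= sE_h [in RHS]linearN. Qed.

Lemma size_neq1 T (xs : seq T) : (1 < size xs)%N -> size xs != 1.
Proof. by case: xs => [|? []]. Qed.

(** The components [g] have degree 0 on the suspension: in the recursion the signs of [h] and of the
    suspended product, both odd, cancel. *)
Lemma susp_parity_mor xs : tE (g xs) = g (map tA xs).
Proof.
elim/cut_split_ind: xs => [|x|xs xs1 IH]; first exact: linear0.
  by rewrite transfer_mor1 [map _ _]/= transfer_mor1 linearN -sE_i.
rewrite !transfer_morE ?size_map ?size_neq1 // linearN tE_h.
congr (- _); rewrite -linearN; congr (h _).
rewrite /lam ssum_map linear_ssum ssumN; apply: eq_ssum => u v uv.
have [->|/eqP u0] := eqVneq u [::]; first by rewrite [map _ [::]]/= !cut0l !raddf0.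
have [->|/eqP v0] := eqVneq v [::]; first by rewrite [map _ [::]]/= !cut0r !raddf0.
have [IHu IHv] := IH u v uv u0 v0.
by rewrite /cut tE_mul opprK -IHu -IHv.
Qed.

Definition transfer_b xs := p (lam xs).
Local Notation b := transfer_b.

Lemma susp_parity_sum xs : tE (lam xs) = - lam (map tA xs).
Proof.
rewrite /lam ssum_map linear_ssum ssumN; apply: eq_ssum => u v uv.
by rewrite /cut tE_mul !susp_parity_mor.
Qed.

(* The coderivation induced by [b], followed by [F]. *)
Definition coder (W : nmodType) (F : seq A -> W) (xs : seq A) : W :=
  ssum (fun a y => ssum (fun w c => F (map tA a ++ b w :: c)) y) xs.

Lemma D_tE x : D (tE x) = - tE (D x).
Proof. by rewrite /= sE_D linearN opprK. Qed.

Lemma sE_tE x : sE (tE x) = - x.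
Proof. by rewrite /= linearN sE_invol. Qed.

Lemma D_cut u v : D (cut u v) = - mul (tE (D (g u))) (g v) - mul (g u) (D (g v)).
Proof. by rewrite /cut D_mul D_tE sE_tE !mulNx. Qed.

Lemma raddf_mull z xs (Phi : seq A -> seq A -> E) :
  mul z (ssum Phi xs) = ssum (fun u v => mul z (Phi u v)) xs.
Proof.
have [f fE] := linear_of_fun (mul_linr z).
by rewrite -fE linear_ssum; apply: eq_ssum => u v _; rewrite fE.
Qed.

Lemma raddf_mulr z xs (Phi : seq A -> seq A -> E) :
  mul (ssum Phi xs) z = ssum (fun u v => mul (Phi u v) z) xs.
Proof.
have [f fE] := linear_of_fun (mul_linl z).
by rewrite -fE linear_ssum; apply: eq_ssum => u v _; rewrite fE.
Qed.

(** For each cut into three pieces the two sums contribute the two bracketings of one product, with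
    opposite signs because the suspended product is odd. *)
Lemma cut_assoc xs :
  ssum (fun u v => mul (tE (lam u)) (g v)) xs +
  ssum (fun u v => mul (g u) (lam v)) xs = 0.
Proof.
rewrite [X in _ + X](_ : _ =
    ssum (fun u v => ssum (fun a b => mul (g u) (cut a b)) v) xs); last first.
  by apply: eq_ssum => u v _; rewrite raddf_mull.
rewrite -(ssum_assoc (fun u a b => mul (g u) (cut a b))) -ssumD; apply: ssum0 => u v _.
rewrite linear_ssum raddf_mulr -ssumD; apply: ssum0 => a c _.
by rewrite tE_mul tE_invol /cut mulNx mulA addNr.
Qed.

(** In a word with the letter [b w] inserted, the outer cut lies to its left or to its right. On the
    left, the [tE] of the cut cancels the [tA] on the letters of the first piece. *)
Lemma coder_sum xs :
  coder lam xs = ssum (fun u v => mul (g u) (coder g v)) xs +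
                 ssum (fun u v => mul (tE (coder g u)) (g v)) xs.
Proof.
transitivity (ssum (fun a y => ssum (fun w c =>
    ssum (fun a1 a2 => mul (g a1) (g (map tA a2 ++ b w :: c))) a +
    ssum (fun c1 c2 => mul (tE (g (map tA a ++ b w :: c1))) (g c2)) c) y) xs).
  apply: eq_ssum => a y _; apply: eq_ssum => w c _.
  rewrite /lam ssum_cat ssum_map; congr (_ + _); apply: eq_ssum => a1 a2 _.
  by rewrite /cut -susp_parity_mor tE_invol.
rewrite [LHS](eq_ssum (Psi := fun a y =>
   ssum (fun a1 a2 => ssum (fun w c => mul (g a1) (g (map tA a2 ++ b w :: c))) y) a +
   ssum (fun z c2 => ssum (fun w c1 => mul (tE (g (map tA a ++ b w :: c1))) (g c2)) z) y));
  last first.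
  move=> a y _; rewrite ssumD; congr (_ + _); last first.
    by rewrite (ssum_assoc (fun w c1 c2 => mul (tE (g (map tA a ++ b w :: c1))) (g c2))).
  exact: (ssum_exchange (fun w c a1 a2 => mul (g a1) (g (map tA a2 ++ b w :: c)))).
rewrite ssumD; congr (_ + _).
  rewrite (ssum_assoc (fun a1 a2 y => ssum (fun w c => mul (g a1) (g (map tA a2 ++ b w :: c))) y)).
  apply: eq_ssum => u v _; rewrite /coder raddf_mull; apply: eq_ssum => a y _.
  by rewrite raddf_mull.
rewrite -(ssum_assoc (fun a z c2 => ssum (fun w c1 => mul (tE (g (map tA a ++ b w :: c1))) (g c2)) z)).
apply: eq_ssum => u v _; rewrite /coder linear_ssum raddf_mulr; apply: eq_ssum => a y _.
by rewrite linear_ssum raddf_mulr.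
Qed.


(** The A-infinity morphism equation: [g] intertwines the coderivation of [b] with the bar
    differential of [E], made of [D] and the suspended product. *)
Definition coder_morphism_at xs := D (g xs) + lam xs = coder g xs.

Lemma transfer_b0 : b [::] = 0.
Proof. by rewrite /b transfer_sum0 linear0. Qed.

Lemma transfer_b1 x : b [:: x] = 0.
Proof. by rewrite /b transfer_sum1 linear0. Qed.

Lemma coder_mor0 : coder g [::] = 0.
Proof. by rewrite /coder /= !addr0 transfer_b0 transfer_mor1 linear0. Qed.

(** By the Leibniz rule and the morphism equation on the pieces, each factor [D (g u)] becomes
    [coder g u - lam u]. The terms with [lam] cancel by associativity, and the others add up to
    [coder lam xs]. *)
Lemma D_sum_rec xs :
  (forall u v, u ++ v = xs -> u <> [::] -> v <> [::] ->
     coder_morphism_at u /\ coder_morphism_at v) ->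
  D (lam xs) = - coder lam xs.
Proof.
move=> IH; have cE u : coder_morphism_at u -> D (g u) = coder g u - lam u.
  by move=> <-; rewrite addrK.
have -> : D (lam xs) = ssum (fun u v =>
    (mul (tE (lam u)) (g v) + mul (g u) (lam v)) -
    (mul (g u) (coder g v) + mul (tE (coder g u)) (g v))) xs.
  rewrite linear_ssum; apply: eq_ssum => u v uv.
  have [->|/eqP u0] := eqVneq u [::].
    by rewrite cut0l linear0 transfer_mor0 coder_mor0 transfer_sum0 !linear0 !mul0x !addr0 subr0.
  have [->|/eqP v0] := eqVneq v [::].
    by rewrite cut0r linear0 transfer_mor0 coder_mor0 transfer_sum0 !mulx0 !addr0 subr0.
  have [IHu IHv] := IH u v uv u0 v0.
  rewrite D_cut (cE _ IHu) (cE _ IHv) linearB mulDl mulDr mulxN.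
  rewrite (mulNx (tE (lam u))) !opprB addrACA opprD.
  by congr (_ + _); exact: addrC.
by rewrite ssumD -ssumN !ssumD cut_assoc sub0r -coder_sum.
Qed.

Definition linear_part (xs : seq A) : E := if xs is [:: x] then i x else 0.

Lemma transfer_mor_rec xs : g xs = linear_part xs - h (lam xs).
Proof.
case: xs => [|x [|y xs]]; first by rewrite transfer_sum0 linear0 subr0.
  by rewrite transfer_sum1 linear0 subr0.
by rewrite transfer_morE // sub0r.
Qed.

Lemma coder_linear_part xs : coder linear_part xs = i (b xs).
Proof.
rewrite /coder ssum_first => [|x u v]; last by apply: ssum0 => w c _; case: u.
by rewrite ssum_last.
Qed.

Lemma coder_mor xs : coder g xs = i (b xs) - h (coder lam xs).
Proof.
rewrite -coder_linear_part /coder linear_ssum ssumN -ssumD; apply: eq_ssum => u v _.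
rewrite linear_ssum ssumN -ssumD; apply: eq_ssum => w c _.
exact: transfer_mor_rec.
Qed.

(** Since [g] is [- h] of [lam] and [b] is [p] of [lam], the homotopy identity at [lam xs] reduces
    the equation to the value of [D (lam xs)], which needs only shorter words. *)
Lemma coder_morphism xs : coder_morphism_at xs.
Proof.
elim/cut_split_ind: xs => [|x|xs xs1 IH]; rewrite /coder_morphism_at.
- by rewrite coder_mor0 transfer_sum0 transfer_mor0 linear0 addr0.
- rewrite coder_mor -[coder _ _]opprK -D_sum_rec => [|[|y [|? ?]] [|z v] //].
  by rewrite transfer_b1 transfer_sum1 !(linear0, oppr0, addr0) transfer_mor1 D_i.
rewrite transfer_morE ?size_neq1 // linearN coder_mor /b homotopy D_sum_rec //.
by rewrite [h (- _)]linearN opprK addrK addrC.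
Qed.

Lemma D_sum xs : D (lam xs) = - coder lam xs.
Proof. by apply: D_sum_rec => u v _ _ _; split; exact: coder_morphism. Qed.

(** This is [p] applied to [coder lam xs], a boundary by [D_sum], and [p] kills boundaries. *)
Lemma transfer_stasheff xs : coder b xs = 0.
Proof.
have -> : coder b xs = p (coder lam xs).
  rewrite /coder linear_ssum; apply: eq_ssum => u v _.
  by rewrite linear_ssum.
by rewrite -[coder _ _]opprK -D_sum linearN p_D oppr0.
Qed.

Definition multilinear (W : lmodType k) (F : seq A -> W) := forall u v a x y,
  F (u ++ (a *: x + y) :: v) = a *: F (u ++ x :: v) + F (u ++ y :: v).

(** A cut with nonempty pieces leaves the varied letter in a strictly shorter piece. The same
    pattern, [lam] from [g] on shorter words and then [g] from [lam], returns for degrees and for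
    linearity over S. *)
Lemma transfer_multilinear_rec n :
  (forall u v a x y, (size u + size v < n)%N ->
     g (u ++ (a *: x + y) :: v) = a *: g (u ++ x :: v) + g (u ++ y :: v)) ->
  forall u v a x y, (size u + size v = n)%N ->
     lam (u ++ (a *: x + y) :: v) = a *: lam (u ++ x :: v) + lam (u ++ y :: v).
Proof.
move=> IH u v a x y uvn; rewrite /lam !ssum_cat scalerDr addrACA !ssumZ -!ssumD.
congr (_ + _); apply: eq_ssum => u' v' uv.
  have [->|/eqP u0] := eqVneq u' [::]; first by rewrite !cut0l scaler0 addr0.
  rewrite /cut IH ?mul_linr // -uvn -uv size_cat.
  by case: u' u0 {uv} => //= *; lia.
have [->|/eqP v0] := eqVneq v' [::]; first by rewrite !cut0r scaler0 addr0.
rewrite /cut IH ?linearP ?mul_linl // -uvn -uv size_cat.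
by case: v' v0 {uv} => //= *; lia.
Qed.

Lemma transfer_mor_multilinear : multilinear g.
Proof.
move=> u v a x y; have [n] := ubnP (size u + size v)%N.
elim: n u v a x y => // n IH u v a x y uvn.
rewrite !transfer_mor_rec (@transfer_multilinear_rec (size u + size v)) //; last first.
  by move=> u' v' a' x' y' lt; apply: IH; lia.
rewrite [h (_ + _)]linearP opprD scalerBr [RHS]addrACA; congr (_ + _).
  case: u {uvn} => [|? [|? ?]] /=; rewrite ?scaler0 ?addr0 //.
  by case: v => [|? ?] /=; rewrite ?linearP ?scaler0 ?addr0.
Qed.

Lemma transfer_sum_multilinear : multilinear lam.
Proof.
move=> u v a x y; apply: (@transfer_multilinear_rec _ _ u v a x y erefl) => *.
exact: transfer_mor_multilinear.
Qed.

Lemma transfer_b_multilinear : multilinear b.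
Proof. by move=> u v a x y; rewrite /b transfer_sum_multilinear linearP. Qed.

Lemma multilinear0 (W : lmodType k) (F : seq A -> W) u v :
  multilinear F -> F (u ++ 0 :: v) = 0.
Proof.
by move=> /(_ u v (-1) 0 0); rewrite scaler0 addr0 scaleN1r addNr.
Qed.

Lemma multilinearZ (W : lmodType k) (F : seq A -> W) u v a x :
  multilinear F -> F (u ++ (a *: x) :: v) = a *: F (u ++ x :: v).
Proof.
by move=> FL; have := FL u v a x 0; rewrite addr0 multilinear0 // addr0.
Qed.

(* Passes between the products of A and the operations [b] on its suspension. *)
Fixpoint twist q (xs : seq A) : seq A :=
  if xs is x :: xs' then iter (q + size xs') sA x :: twist q xs' else [::].

(** The twist gives a letter of degree d with l letters to its right the sign (-1)^(l d), which
    undoes the suspension. The outer minus makes m_2 the product, as [tE] is minus the parity. *)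
Definition transfer_m xs := - b (twist 0 xs).
Local Notation m := transfer_m.

Lemma size_twist q xs : size (twist q xs) = size xs.
Proof. by elim: xs => //= x xs ->. Qed.

Lemma twistS q xs : twist q.+1 xs = map sA (twist q xs).
Proof. by elim: xs => //= x xs ->. Qed.

Lemma twist_cat q u v : twist q (u ++ v) = twist (q + size v) u ++ twist q v.
Proof.
elim: u => //= x u ->; congr (iter _ sA x :: _).
by rewrite size_cat; lia.
Qed.

Lemma ssum_twist (W : nmodType) (Phi : seq A -> seq A -> W) q xs :
  ssum Phi (twist q xs) =
  ssum (fun u v => Phi (twist (q + size v) u) (twist q v)) xs.
Proof.
elim: xs Phi => [|x xs IH] Phi //=; rewrite IH; congr (_ + _).
apply: eq_ssum => u v <-; congr (Phi (iter _ sA x :: _) _).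
by rewrite size_cat; lia.
Qed.

Lemma iter_sAZ n a z : iter n sA (a *: z) = a *: iter n sA z.
Proof. by elim: n => // n IH; rewrite !iterS IH linearZ. Qed.

Lemma b_susp_parity pre u post :
  b (pre ++ map tA u ++ post) = (-1) ^+ size u *: b (pre ++ map sA u ++ post).
Proof.
elim: u pre => [|x u IH] pre /=; first by rewrite scale1r.
rewrite -cat_rcons IH cat_rcons -[- sA x]scaleN1r multilinearZ; last exact: transfer_b_multilinear.
by rewrite scalerA exprSr.
Qed.

Lemma sA_b xs : sA (b xs) = (-1) ^+ size xs *: b (map sA xs).
Proof.
have := b_susp_parity [::] xs [::]; rewrite /= !cats0 => <-.
by rewrite /b sA_p -[sE _]opprK -[- sE _]/(tE _) susp_parity_sum opprK.
Qed.

Lemma iter_sA_b n xs : iter n sA (b (twist 0 xs)) = (-1) ^+ (size xs * n) *: b (twist n xs).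
Proof.
elim: n => [|n IH]; first by rewrite muln0 scale1r.
by rewrite iterS IH linearZ /= sA_b size_twist scalerA -exprD twistS mulnSr.
Qed.

Variables (dA : nat -> A -> Prop) (dE : int -> E -> Prop).
Hypothesis sA_deg : forall n a, dA n a -> sA a = (-1) ^+ n *: a.

Lemma iter_sA_deg n d a : dA d a -> iter n sA a = (-1) ^+ (n * d) *: a.
Proof.
move=> da; elim: n => [|n IH]; first by rewrite scale1r.
by rewrite iterS IH linearZ /= (sA_deg da) scalerA -exprD mulSnr.
Qed.

Lemma homogeneous_cons ds x xs : homogeneous_seq dA ds (x :: xs) ->
  exists d ds', [/\ ds = d :: ds', dA d x & homogeneous_seq dA ds' xs].
Proof.
case: ds => [|d ds] [//= [szd] hd]; exists d, ds; split=> //; first exact: (hd 0).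
by split=> // j; exact: (hd j.+1).
Qed.

Lemma homogeneous_cat ds u v : homogeneous_seq dA ds (u ++ v) ->
  exists d1 d2, [/\ ds = d1 ++ d2, homogeneous_seq dA d1 u & homogeneous_seq dA d2 v].
Proof.
elim: u ds => [|x u IH] ds; first by exists [::], ds.
move=> /homogeneous_cons[d [ds' [-> dx /IH[d1 [d2 [-> [s1 h1] h2]]]]]].
exists (d :: d1), d2; split=> //; split=> [|[|j]] //=; first by rewrite s1.
exact: h1.
Qed.

Lemma twist_shift ds u s q pre post : homogeneous_seq dA ds u ->
  b (pre ++ twist (s + q) u ++ post) = (-1) ^+ (s * sumn ds) *: b (pre ++ twist q u ++ post).
Proof.
elim: u ds pre => [|x u IH] ds pre.
  by case: ds => [|? ?] [] //= _ _; rewrite muln0 scale1r.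
move=> /homogeneous_cons[d [ds' [-> dx /IH IHu]]] /=.
rewrite -cat_rcons IHu cat_rcons -addnA iterD.
rewrite [iter s _ _](_ : _ = (-1) ^+ (s * d) *: iter (q + size u) sA x); last first.
  by rewrite -iterD addnC iterD (iter_sA_deg s dx) iter_sAZ.
rewrite multilinearZ; last exact: transfer_b_multilinear.
by rewrite scalerA -exprD -mulnDr addnC.
Qed.

(** The three summands of the exponent have separate origins: [tA] against [sA] on [u]; the parity
    of the inner output, iterated once for each letter of [c]; and the difference [size w] between
    the twists of [u] in the two words. The minus signs of the two operations cancel. *)
Lemma transfer_m_term ds u w c : homogeneous_seq dA ds u ->
  (-1) ^+ (size u + size w * size c + size w * sumn ds)%N *: m (u ++ m w :: c) =
  b (map tA (twist (size w + size c) u) ++ b (twist (size c) w) :: twist 0 c).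
Proof.
move=> hu; have bL := transfer_b_multilinear.
rewrite (b_susp_parity [::]) /= size_twist -twistS -addnS (twist_shift _ _ [::] _ hu) /=.
rewrite /m twist_cat /= !add0n [iter _ _ (- _)](_ : _ =
  - ((-1) ^+ (size w * size c)) *: b (twist (size c) w)); last first.
  by rewrite -[- b _]scaleN1r iter_sAZ iter_sA_b scalerA mulN1r.
rewrite multilinearZ // scaleNr opprK !scalerA -!exprD.
congr (_ *: _); rewrite -signr_odd -[RHS]signr_odd; congr (_ ^+ nat_of_bool _).
by rewrite !oddD !oddM; case: (odd (size u)); case: (odd (size w)); case: (odd _); case: (odd _).
Qed.

Lemma transfer_m_stasheff ds xs : homogeneous_seq dA ds xs ->
  \sum_(0 <= r < size xs) \sum_(1 <= s < (size xs - r).+1)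
      (-1) ^+ (r + s * (size xs - r - s) + s * sumn (take r ds))%N *:
        m (take r xs ++ m (take s (drop r xs)) :: drop (r + s) xs) = 0.
Proof.
move=> hx; have bL := transfer_b_multilinear.
transitivity (coder b (twist 0 xs)); last exact: transfer_stasheff.
(* The sum over cuts also has the terms r = [size xs] and, further down, s = 0, absent from the
   Stasheff sum. Both contain [b [::]], which is 0. *)
rewrite /coder ssum_twist ssumE big_nat_recr //= take_size drop_size /=.
rewrite transfer_b0 multilinear0 // !addr0.
apply: eq_big_nat => r /andP[_ rlt].
rewrite ssum_twist ssumE size_drop [RHS]big_ltn // take0 drop0 /= transfer_b0 multilinear0 // add0r.
apply: eq_big_nat => s /andP[s0]; rewrite ltnS => sle.
have [d1 [d2 [dsE h1 _]]] : exists d1 d2, [/\ ds = d1 ++ d2, homogeneous_seq dA d1 (take r xs)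
    & homogeneous_seq dA d2 (drop r xs)].
  by apply: homogeneous_cat; rewrite cat_take_drop.
have szr : size (take r xs) = r by rewrite size_takel // ltnW.
have szs : size (take s (drop r xs)) = s by rewrite size_takel // size_drop.
have := transfer_m_term (take s (drop r xs)) (drop (r + s) xs) h1.
rewrite szr szs !size_drop !subnDA dsE take_size_cat; last by case: h1 => ->.
move=> ->; rewrite drop_drop [(s + r)%N]addnC.
by rewrite subnKC.
Qed.

(** * Degrees of the transferred operations *)

Hypothesis dE0 : forall n, dE n 0.
Hypothesis dE_lin : forall n a x y, dE n x -> dE n y -> dE n (a *: x + y).
Hypothesis dE_mul : forall n q x y, dE n x -> dE q y -> dE (n + q) (mul x y).
Hypothesis dE_sE : forall n x, dE n x -> dE n (sE x).
Hypothesis dE_h : forall n x, dE n x -> dE (n - 1) (h x).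
Hypothesis dE_i : forall n a, dA n a -> dE n%:Z (i a).
Hypothesis dA_p : forall n x, dE n%:Z x -> dA n (p x).
Hypothesis p_neg : forall n x, dE (Negz n) x -> p x = 0.
Hypothesis dA_sA : forall n a, dA n a -> dA n (sA a).
Hypothesis dA_opp : forall n a, dA n a -> dA n (- a).

Lemma dE_opp n x : dE n x -> dE n (- x).
Proof. by move=> dx; rewrite -scaleN1r -[_ *: _]addr0; exact: dE_lin. Qed.

Lemma dE_ssum n (Phi : seq A -> seq A -> E) xs :
  (forall u v, u ++ v = xs -> dE n (Phi u v)) -> dE n (ssum Phi xs).
Proof.
elim: xs Phi => [|x xs IH] Phi dPhi /=; first by rewrite addr0; exact: dPhi.
rewrite -[Phi _ _]scale1r; apply: dE_lin; first exact: dPhi.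
by apply: IH => u v uv; apply: dPhi; rewrite -uv.
Qed.

Lemma dE_transfer_sum_rec xs :
  (forall u v ds, u ++ v = xs -> u <> [::] -> v <> [::] ->
    (homogeneous_seq dA ds u -> dE ((sumn ds)%:Z + 1 - (size u)%:Z) (g u)) /\
    (homogeneous_seq dA ds v -> dE ((sumn ds)%:Z + 1 - (size v)%:Z) (g v))) ->
  forall ds, homogeneous_seq dA ds xs -> dE ((sumn ds)%:Z + 2 - (size xs)%:Z) (lam xs).
Proof.
move=> IH ds hds; apply: dE_ssum => u v uv.
have [->|/eqP u0] := eqVneq u [::]; first by rewrite cut0l.
have [->|/eqP v0] := eqVneq v [::]; first by rewrite cut0r.
rewrite -uv in hds; have [d1 [d2 [-> h1 h2]]] := homogeneous_cat hds.
have [/(_ h1) du _] := IH u v d1 uv u0 v0.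
have [_ /(_ h2) dv] := IH u v d2 uv u0 v0.
rewrite -uv size_cat sumn_cat.
rewrite [X in dE X _](_ : _ = ((sumn d1)%:Z + 1 - (size u)%:Z) +
  ((sumn d2)%:Z + 1 - (size v)%:Z)); last by lia.
by apply: dE_mul => //; apply/dE_opp/dE_sE.
Qed.

Lemma dE_transfer_mor xs ds :
  homogeneous_seq dA ds xs -> dE ((sumn ds)%:Z + 1 - (size xs)%:Z) (g xs).
Proof.
elim/cut_split_ind: xs ds => [|x|xs xs1 IH] ds hds; first exact: dE0.
  have [d [ds' [-> dx]]] := homogeneous_cons hds.
  case: ds' {hds} => [_|? ? []//]; rewrite transfer_mor1 /= addn0 addrK.
  exact: dE_i.
rewrite transfer_morE ?size_neq1 //; apply: dE_opp.
rewrite [X in dE X _](_ : _ = (sumn ds)%:Z + 2 - (size xs)%:Z - 1); last by lia.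
apply: dE_h; apply: dE_transfer_sum_rec => // u v ds' uv u0 v0.
by have [IHu IHv] := IH u v uv u0 v0; split; [exact: IHu | exact: IHv].
Qed.

Lemma homogeneous_twist q ds xs :
  homogeneous_seq dA ds xs -> homogeneous_seq dA ds (twist q xs).
Proof.
case=> szd hd; split; first by rewrite size_twist.
elim: xs ds szd hd => [|x xs IH] [|d ds] //= [szd] hd [|j] /= jlt.
  have := hd 0 isT => /= dx.
  by elim: (q + size xs)%N => //= n; exact: dA_sA.
by apply: IH => // j' ?; exact: (hd j'.+1).
Qed.

Lemma transfer_m_degree ds xs : homogeneous_seq dA ds xs -> (1 <= size xs)%N ->
  if (size xs <= sumn ds + 2)%N then dA (sumn ds + 2 - size xs)%N (m xs) else m xs = 0.
Proof.
move=> hds _; have dlam : dE ((sumn ds)%:Z + 2 - (size xs)%:Z) (lam (twist 0 xs)).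
  rewrite -(size_twist 0); apply: dE_transfer_sum_rec; last exact: homogeneous_twist.
  by move=> *; split; exact: dE_transfer_mor.
case: leqP => [le|lt].
  apply/dA_opp/dA_p; rewrite [Posz _](_ : _ = (sumn ds)%:Z + 2 - (size xs)%:Z) //.
  by lia.
(* [Negz n] is -(n + 1), hence the predecessor. *)
rewrite /m /b (p_neg (n := (size xs - (sumn ds + 2)).-1)) ?oppr0 //.
rewrite [Negz _](_ : _ = (sumn ds)%:Z + 2 - (size xs)%:Z) // NegzE.
by lia.
Qed.

(** * Linearity over S *)

Variables (S : Type) (la : S -> A -> A) (ra : A -> S -> A) (sh : S -> E).
Hypothesis i_la : forall s a, i (la s a) = mul (sh s) (i a).
Hypothesis i_ra : forall s a, i (ra a s) = mul (i a) (sh s).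
Hypothesis p_la : forall s x, p (mul (sh s) x) = la s (p x).
Hypothesis p_ra : forall s x, p (mul x (sh s)) = ra (p x) s.
Hypothesis h_la : forall s x, h (mul (sh s) x) = mul (sh s) (h x).
Hypothesis h_ra : forall s x, h (mul x (sh s)) = mul (h x) (sh s).
Hypothesis sE_sh : forall s, sE (sh s) = sh s.

Lemma i_inj : injective i.
Proof. by move=> a a' /(congr1 p); rewrite !p_i. Qed.

(** Checked in [E], where [sh s] is even; [i] is injective because [p] retracts it. *)
Lemma sA_la s a : sA (la s a) = la s (sA a).
Proof. by apply: i_inj; rewrite -sE_i !i_la sE_mul sE_sh sE_i. Qed.

Lemma sA_ra s a : sA (ra a s) = ra (sA a) s.
Proof. by apply: i_inj; rewrite -sE_i !i_ra sE_mul sE_sh sE_i. Qed.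

Lemma la_opp s a : la s (- a) = - la s a.
Proof. by apply: i_inj; rewrite i_la !linearN i_la mulxN. Qed.

Lemma ra_opp s a : ra (- a) s = - ra a s.
Proof. by apply: i_inj; rewrite i_ra !linearN i_ra mulNx. Qed.

Lemma tE_mul_sh x s : tE (mul x (sh s)) = mul (tE x) (sh s).
Proof. by rewrite /= sE_mul sE_sh mulNx. Qed.

Lemma mul_sh_tE x s : tE (mul (sh s) x) = mul (sh s) (tE x).
Proof. by rewrite /= sE_mul sE_sh mulxN. Qed.

Lemma transfer_left_rec s x v :
  (forall v1 v2, v1 ++ v2 = v -> v2 <> [::] -> g (la s x :: v1) = mul (sh s) (g (x :: v1))) ->
  lam (la s x :: v) = mul (sh s) (lam (x :: v)).
Proof.
move=> IH; rewrite /lam /= !cut0l !add0r raddf_mull; apply: eq_ssum => v1 v2 uv.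
have [->|/eqP v0] := eqVneq v2 [::]; first by rewrite !cut0r mulx0.
by rewrite /cut (IH _ _ uv v0) mul_sh_tE mulA.
Qed.

Lemma transfer_mor_left s x v : g (la s x :: v) = mul (sh s) (g (x :: v)).
Proof.
have [n] := ubnP (size v); elim: n v => // n IH v vn.
rewrite !transfer_mor_rec (@transfer_left_rec s x v); last first.
  move=> v1 v2 uv v0; apply: IH; rewrite -uv size_cat in vn.
  by case: v2 v0 vn {uv} => //= *; lia.
rewrite mulDr mulxN h_la; congr (_ - _).
by case: v {vn} => [|? ?] /=; rewrite ?i_la ?mulx0.
Qed.

Lemma transfer_sum_left s x v : lam (la s x :: v) = mul (sh s) (lam (x :: v)).
Proof. by apply: transfer_left_rec => *; exact: transfer_mor_left. Qed.

Lemma transfer_right_rec s u x :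
  (forall u1 u2, u1 ++ u2 = u -> u1 <> [::] ->
     g (u2 ++ [:: ra x s]) = mul (g (u2 ++ [:: x])) (sh s)) ->
  lam (u ++ [:: ra x s]) = mul (lam (u ++ [:: x])) (sh s).
Proof.
move=> IH; rewrite /lam !ssum_cat /= !cut0r !addr0 raddf_mulr; apply: eq_ssum => u1 u2 uv.
have [->|/eqP u0] := eqVneq u1 [::]; first by rewrite !cut0l mul0x.
by rewrite /cut (IH _ _ uv u0) mulA.
Qed.

Lemma transfer_mor_right s u x : g (u ++ [:: ra x s]) = mul (g (u ++ [:: x])) (sh s).
Proof.
have [n] := ubnP (size u); elim: n u => // n IH u un.
rewrite !transfer_mor_rec (@transfer_right_rec s u x); last first.
  move=> u1 u2 uv u0; apply: IH; rewrite -uv size_cat in un.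
  by case: u1 u0 un {uv} => //= *; lia.
rewrite mulDl mulNx h_ra; congr (_ - _).
by case: u {un} => [|? [|? ?]] /=; rewrite ?i_ra ?mul0x.
Qed.

Lemma transfer_sum_right s u x : lam (u ++ [:: ra x s]) = mul (lam (u ++ [:: x])) (sh s).
Proof. by apply: transfer_right_rec => *; exact: transfer_mor_right. Qed.

(** Cuts away from the two letters involve shorter words. At the cut between them the claim is
    associativity of [mul] with [sh s] in the middle. *)
Lemma transfer_balanced_rec s u x y v :
  (forall u1 u2, u1 ++ u2 = u -> u1 <> [::] ->
     g (u2 ++ ra x s :: y :: v) = g (u2 ++ x :: la s y :: v)) ->
  (forall v1 v2, v1 ++ v2 = v -> v2 <> [::] ->
     g (u ++ ra x s :: y :: v1) = g (u ++ x :: la s y :: v1)) ->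
  lam (u ++ ra x s :: y :: v) = lam (u ++ x :: la s y :: v).
Proof.
move=> IHu IHv; rewrite /lam !ssum_cat /=; congr (_ + (_ + _)).
- apply: eq_ssum => u1 u2 uv.
  have [->|/eqP u0] := eqVneq u1 [::]; first by rewrite !cut0l.
  by rewrite /cut (IHu _ _ uv u0).
- by rewrite /cut transfer_mor_right transfer_mor_left tE_mul_sh mulA.
- apply: eq_ssum => v1 v2 uv.
  have [->|/eqP v0] := eqVneq v2 [::]; first by rewrite !cut0r.
  by rewrite /cut (IHv _ _ uv v0).
Qed.

Lemma transfer_mor_balanced s u x y v :
  g (u ++ ra x s :: y :: v) = g (u ++ x :: la s y :: v).
Proof.
have [n] := ubnP (size u + size v)%N; elim: n u v => // n IH u v uvn.
rewrite !transfer_mor_rec transfer_balanced_rec; last 2 first.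
- move=> u1 u2 uv u0; apply: IH; rewrite -uv size_cat in uvn.
  by case: u1 u0 uvn {uv} => //= *; lia.
- move=> v1 v2 uv v0; apply: IH; rewrite -uv size_cat in uvn.
  by case: v2 v0 uvn {uv} => //= *; lia.
by congr (_ - _); case: u {uvn} => [|? [|? ?]].
Qed.

Lemma transfer_sum_balanced s u x y v :
  lam (u ++ ra x s :: y :: v) = lam (u ++ x :: la s y :: v).
Proof. by apply: transfer_balanced_rec => *; exact: transfer_mor_balanced. Qed.

Lemma iter_sA_la n s a : iter n sA (la s a) = la s (iter n sA a).
Proof. by elim: n => //= n ->; rewrite sA_la. Qed.

Lemma iter_sA_ra n s a : iter n sA (ra a s) = ra (iter n sA a) s.
Proof. by elim: n => //= n ->; rewrite sA_ra. Qed.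

Lemma transfer_m_linear : multilinear m.
Proof.
move=> u v a x y; rewrite /m !twist_cat /=.
have -> n : iter n sA (a *: x + y) = a *: iter n sA x + iter n sA y.
  by elim: n => //= n ->; rewrite linearP.
by rewrite transfer_b_multilinear opprD scalerN.
Qed.

Lemma transfer_m_balanced u v x s y :
  m (u ++ ra x s :: y :: v) = m (u ++ x :: la s y :: v).
Proof. by rewrite /m !twist_cat /= iter_sA_la iter_sA_ra sA_ra /b transfer_sum_balanced. Qed.

Lemma transfer_m_left s x v : m (la s x :: v) = la s (m (x :: v)).
Proof. by rewrite /m /= iter_sA_la /b transfer_sum_left p_la la_opp. Qed.

Lemma transfer_m_right u x s : m (rcons u (ra x s)) = ra (m (rcons u x)) s.
Proof.
by rewrite -!cats1 /m !twist_cat /= /b transfer_sum_right p_ra ra_opp.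
Qed.

Lemma transfer_A_infinity : A_infinity_structure dA la ra m.
Proof.
split.
- exact: transfer_m_linear.
- exact: transfer_m_balanced.
- exact: transfer_m_left.
- exact: transfer_m_right.
- exact: transfer_m_degree.
- by move=> ds xs hds _; exact: transfer_m_stasheff.
Qed.

Lemma transfer_m1 x : m [:: x] = 0.
Proof. by rewrite /m transfer_b1 oppr0. Qed.

Lemma transfer_m2 x y : m [:: x; y] = p (mul (i x) (i y)).
Proof.
rewrite /m /= /b /lam /= cut0l cut0r !addr0 add0r /cut !transfer_mor1.
by rewrite -sE_i -linearN -mulNx /= linearN sE_invol opprK.
Qed.

(** * Strict unitality *)

Hypothesis h_h : forall x, h (h x) = 0.
Hypothesis h_i : forall a, h (i a) = 0.
Hypothesis p_h : forall x, p (h x) = 0.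

Definition strict_unit u := exists s, i u = sh s.

(** A piece of length at least 2 containing [e] vanishes by assumption. If the piece is [e] alone,
    [sh s] comes out of [h] and [p], and the other factor is, up to sign, some [i y] or a value of
    [h]. [h] kills both kinds but [p] only the second, so [p] needs a third letter: m_2 with a unit
    survives. *)
Lemma unit_cut u v e : strict_unit e -> e \in u ++ v -> u <> [::] -> v <> [::] ->
  (e \in u -> (1 < size u)%N -> g u = 0) -> (e \in v -> (1 < size v)%N -> g v = 0) ->
  h (cut u v) = 0 /\ ((2 < size u + size v)%N -> p (cut u v) = 0).
Proof.
move=> [s es]; rewrite mem_cat => /orP[eu|ev] u0 v0 IHu IHv.
  have [u1|] := leqP (size u) 1; last first.
    by move=> /(IHu eu) gu; rewrite /cut gu mul_tE0 // !linear0.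
  case: u u1 u0 eu {IHu} => [|x [|? ?]] // _ _; rewrite inE => /eqP<-.
  rewrite /cut transfer_mor1 es /= sE_sh mulNx !linearN h_la p_la.
  have [v1|v1] := leqP (size v) 1.
    case: v v0 v1 {IHv} => [|y [|? ?]] // _ _.
    by rewrite transfer_mor1 h_i mulx0 oppr0; split.
  rewrite (transfer_morE (size_neq1 v1)) !linearN h_h p_h !oppr0 mulx0 oppr0.
  by split=> // _; rewrite -[0](linear0 p) -p_la mulx0 linear0 oppr0.
have [v1|] := leqP (size v) 1; last first.
  by move=> /(IHv ev) gv; rewrite /cut gv mulx0 !linear0.
case: v v1 v0 ev {IHv} => [|y [|? ?]] // _ _; rewrite inE => /eqP<-.
rewrite /cut transfer_mor1 es h_ra p_ra susp_parity_mor.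
have [u1|u1] := leqP (size u) 1.
  case: u u0 u1 {IHu} => [|x [|? ?]] // _ _.
  by rewrite [map _ _]/= transfer_mor1 h_i mul0x; split.
rewrite transfer_morE ?size_map ?size_neq1 // !linearN h_h p_h !oppr0 mul0x.
by split=> // _; rewrite -[0](linear0 p) -p_ra mul0x linear0.
Qed.

Lemma transfer_mor_unit e xs : strict_unit e -> e \in xs -> (1 < size xs)%N -> g xs = 0.
Proof.
move=> ue; elim/cut_split_ind: xs => [|x|xs xs1 IH] // exs _.
rewrite transfer_morE ?size_neq1 // /lam linear_ssum ssum0 ?oppr0 // => u v uv.
have [->|/eqP u0] := eqVneq u [::]; first by rewrite cut0l linear0.
have [->|/eqP v0] := eqVneq v [::]; first by rewrite cut0r linear0.
have [IHu IHv] := IH u v uv u0 v0.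
by have [] := @unit_cut u v e ue _ u0 v0 IHu IHv; rewrite ?uv.
Qed.

Lemma transfer_m_unit e xs : strict_unit e -> e \in xs -> (2 < size xs)%N -> m xs = 0.
Proof.
move=> ue exs szx.
(* The twist only applies [sA] some number of times; as [sE] fixes [sh s], the twisted entry is
   still a strict unit. *)
have [e' ue' e'xs] : exists2 e', strict_unit e' & e' \in twist 0 xs.
  elim: xs exs {szx} => //= x xs IH; rewrite inE => /orP[/eqP<-|/IH[e' ue' e'xs]].
    exists (iter (0 + size xs) sA e); rewrite ?mem_head //.
    have [s es] := ue; exists s; elim: (_ + _)%N => //= n IHn.
    by rewrite -sE_i IHn sE_sh.
  by exists e'; rewrite // inE e'xs orbT.
rewrite /m /b /lam linear_ssum ssum0 ?oppr0 // => u v uv.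
have [->|/eqP u0] := eqVneq u [::]; first by rewrite cut0l linear0.
have [->|/eqP v0] := eqVneq v [::]; first by rewrite cut0r linear0.
have [|||_] := @unit_cut u v e' ue' _ u0 v0; rewrite ?uv //.
- exact: transfer_mor_unit.
- exact: transfer_mor_unit.
by apply; rewrite -size_cat uv size_twist.
Qed.

End Transfer.

(** * Minimal models of dg algebras *)

Section MinimalModel.
Variables (k : fieldType) (A E : lmodType k) (mul : E -> E -> E) (D : {linear E -> E}).
Variables (q : grading int E) (qA : grading nat A).
Variables (I : finType) (idem : I -> E) (eA : I -> A) (mulAA : A -> A -> A).
(* [rep c a]: the cycle [c] represents the cohomology class [a]. *)
Variable rep : E -> A -> Prop.

Hypothesis mul_linl : forall z, linear (mul^~ z).
Hypothesis mul_linr : forall z, linear (mul z).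
Hypothesis mulA : associative mul.
Hypothesis D_D : forall x, D (D x) = 0.
Hypothesis D_part : forall n x, D (q n x) = q (n + 1) (D x).
Hypothesis mul_part : forall n n' x y, q n x = x -> q n' y = y ->
  q (n + n') (mul x y) = mul x y.
Hypothesis D_mul_part : forall n x y, q n x = x ->
  D (mul x y) = mul (D x) y + (-1) ^ n *: mul x (D y).
Hypothesis idem_mul : forall j l, mul (idem j) (idem l) = if j == l then idem j else 0.
Hypothesis idem_suml : forall x, mul (\sum_j idem j) x = x.
Hypothesis idem_sumr : forall x, mul x (\sum_j idem j) = x.
Hypothesis D_idem : forall j, D (idem j) = 0.
Hypothesis idem_part : forall j, q 0 (idem j) = idem j.

Hypothesis rep_lin : forall t c a c' a', rep c a -> rep c' a' ->
  rep (t *: c + c') (t *: a + a').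
Hypothesis rep_cycle : forall c a, rep c a -> D c = 0.
Hypothesis rep_ex : forall c, D c = 0 -> exists a, rep c a.
Hypothesis rep_surj : forall a, exists c, rep c a.
Hypothesis rep_boundary : forall c, rep (D c) 0.
Hypothesis rep_ker : forall c, rep c 0 -> exists c', c = D c'.
Hypothesis rep0 : forall a, rep 0 a -> a = 0.
Hypothesis rep_mul : forall c a c' a', rep c a -> rep c' a' ->
  rep (mul c c') (mulAA a a').
Hypothesis rep_part : forall n c a, rep c a -> rep (q n%:Z c) (qA n a).
Hypothesis rep_neg : forall n c a, rep c a -> rep (q (Negz n) c) 0.
Hypothesis rep_idem : forall j, rep (idem j) (eA j).
Hypothesis eA_neq0 : forall j, eA j != 0.

Lemma dg_mul_l z : exists f : {linear E -> E}, forall x, f x = mul z x.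
Proof. exact: linear_of_fun (mul_linr z). Qed.
Lemma dg_mul_r z : exists f : {linear E -> E}, forall x, f x = mul x z.
Proof. exact: linear_of_fun (mul_linl z). Qed.

Lemma dg_mulx0 z : mul z 0 = 0.
Proof. by have [f fE] := dg_mul_l z; rewrite -fE linear0. Qed.
Lemma dg_mul0x z : mul 0 z = 0.
Proof. by have [f fE] := dg_mul_r z; rewrite -fE linear0. Qed.
Lemma dg_mulZl t x z : mul (t *: x) z = t *: mul x z.
Proof. by have [f fE] := dg_mul_r z; rewrite -!fE linearZ. Qed.
Lemma dg_mulZr t x z : mul z (t *: x) = t *: mul z x.
Proof. by have [f fE] := dg_mul_l z; rewrite -!fE linearZ. Qed.
Lemma dg_mulBl x y z : mul (x - y) z = mul x z - mul y z.
Proof. by have [f fE] := dg_mul_r z; rewrite -!fE linearB. Qed.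
Lemma dg_mulBr x y z : mul z (x - y) = mul z x - mul z y.
Proof. by have [f fE] := dg_mul_l z; rewrite -!fE linearB. Qed.
Lemma dg_mul_suml (J : finType) (F : J -> E) z : mul (\sum_j F j) z = \sum_j mul (F j) z.
Proof.
by have [f fE] := dg_mul_r z; rewrite -!fE linear_sum; apply: eq_bigr => j _; rewrite fE.
Qed.
Lemma dg_mul_sumr (J : finType) (F : J -> E) z : mul z (\sum_j F j) = \sum_j mul z (F j).
Proof.
by have [f fE] := dg_mul_l z; rewrite -!fE linear_sum; apply: eq_bigr => j _; rewrite fE.
Qed.

Lemma repB c a c' a' : rep c a -> rep c' a' -> rep (c - c') (a - a').
Proof. by move=> r r'; have := rep_lin (-1) r' r; rewrite !scaleN1r ![- _ + _]addrC. Qed.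

Lemma rep_functional c a a' : rep c a -> rep c a' -> a = a'.
Proof.
move=> r r'; apply/eqP; rewrite -subr_eq0; apply/eqP/rep0.
by rewrite -(subrr c); exact: repB.
Qed.

Lemma rep00 : rep 0 0.
Proof. by rewrite -{1}(linear0 D); exact: rep_boundary. Qed.

Lemma repZ t c a : rep c a -> rep (t *: c) (t *: a).
Proof. by move=> r; have := rep_lin t r rep00; rewrite !addr0. Qed.

Lemma D_idem_mul j x : D (mul (idem j) x) = mul (idem j) (D x).
Proof. by rewrite (D_mul_part _ (idem_part j)) D_idem dg_mul0x add0r expr0z scale1r. Qed.

Lemma D_mul_idem j x : D (mul x (idem j)) = mul (D x) (idem j).
Proof.
have [f fE] := dg_mul_r (idem j); rewrite -!fE.
apply: (@eq_on_parts _ _ _ _ q (D \o f) (f \o D)) => n y /=.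
by rewrite !fE (D_mul_part _ (part_id q n y)) D_idem dg_mulx0 scaler0 addr0.
Qed.

(** Multiplication by [idem j] isolates one term as a boundary, so [s j *: eA j] is 0, while [eA j]
    is not. *)
Lemma idem_independent (s : I -> k) c : \sum_j s j *: idem j = D c -> forall j, s j = 0.
Proof.
move=> sE j; have : rep (s j *: idem j) 0.
  have -> : s j *: idem j = D (mul (idem j) c).
    rewrite D_idem_mul -sE dg_mul_sumr (bigD1 j) //= dg_mulZr idem_mul eqxx.
    by rewrite big1 ?addr0 // => l; rewrite eq_sym dg_mulZr idem_mul => /negPf->; rewrite scaler0.
  exact: rep_boundary.
move=> /(rep_functional (repZ (s j) (rep_idem j)))/eqP.
by rewrite scaler_eq0 (negPf (eA_neq0 j)) orbF => /eqP.
Qed.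

(* A generalized inverse of [x + s |-> D x + \sum_j s j *: idem j] on the sum of E and k^I:
   independence of the idempotents modulo boundaries gives both properties. *)
Lemma homotopy0 : exists g : {linear E -> E},
  (forall x, D (g (D x)) = D x) /\ forall j, D (g (idem j)) = 0.
Proof.
pose F (u : E * {ffun I -> k^o}) : E := D u.1 + \sum_j (u.2 j : k) *: idem j.
have FL : linear F.
  move=> a u v; rewrite /F linearP scalerDr addrACA scaler_sumr -big_split.
  by congr (_ + _); apply: eq_bigr => j _; rewrite !ffunE scalerDl scalerA.
have [f fE] := linear_of_fun FL; have [g gP] := linear_geninv f.
have [g0 g0E] := linear_of_fun (f := fun x => (g x).1) (fun a x y => congr1 fst (linearP g a x y)).
exists g0; split=> [x|j]; rewrite g0E.
  have fx : f (x, 0) = D x.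
    by rewrite fE /F /= big1 ?addr0 // => l _; rewrite ffunE scale0r.
  have := gP (x, 0); rewrite fx fE /F => gE; rewrite -[RHS]gE big1 ?addr0 // => l _.
  rewrite (@idem_independent (fun j => (g (D x)).2 j) (x - (g (D x)).1)) ?scale0r //.
  by rewrite linearB; apply: (canRL (addrK _)); rewrite addrC.
pose dl : {ffun I -> k^o} := [ffun l => (l == j)%:R].
have fj : f (0, dl) = idem j.
  rewrite fE /F /= linear0 add0r (bigD1 j) //= ffunE eqxx scale1r big1 ?addr0 // => l.
  by rewrite ffunE => /negPf->; rewrite scale0r.
have := gP (0, dl); rewrite fj fE /F => gE.
pose s l : k := (dl l : k) - (g (idem j)).2 l.
have sE : \sum_l s l *: idem l = D (g (idem j)).1.
  under eq_bigr do rewrite scalerBl.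
  rewrite sumrB; move: fj; rewrite fE /F /= linear0 add0r => ->.
  by rewrite -[X in X - _]gE addrK.
by rewrite -sE big1 // => l _; rewrite (idem_independent sE) scale0r.
Qed.

Definition degree_pred (h : {linear E -> E}) := forall n x, q n x = x -> q (n - 1) (h x) = h x.

Lemma degree_pred_part h n x : degree_pred h -> h (q n x) = q (n - 1) (h x).
Proof.
move=> hd; apply: (@eq_on_parts _ _ _ _ q (h \o q n) (q (n - 1) \o h)) => m y /=.
rewrite part_part -[h (q m y)](hd m) ?part_id // part_part.
rewrite (inj_eq (addIr _)); case: eqP => [->|_]; last exact: linear0.
by rewrite hd ?part_id.
Qed.

(** Keeping only the component of degree -1 preserves both identities, because [D] is homogeneous of
    degree 1 and the idempotents have degree 0. *)
Lemma homotopy1 : exists g : {linear E -> E},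
  [/\ forall x, D (g (D x)) = D x, forall j, D (g (idem j)) = 0 & degree_pred g].
Proof.
have [g0 [g0D g0e]] := homotopy0.
have [g gE] := glue_parts q (fun n => [the {linear E -> E} of q (n - 1) \o g0]).
have Dq n x : D (q (n - 1) x) = q n (D x) by rewrite D_part subrK.
exists g; split.
- apply: (@eq_on_parts _ _ _ _ q (D \o g \o D) D) => n x /=.
  by rewrite D_part gE /= Dq -[q _ (D x)]D_part g0D D_part part_id.
- by move=> j; rewrite -idem_part gE /= Dq idem_part g0e linear0.
- by move=> n x <-; rewrite gE /= part_id.
Qed.

(** The Peirce components, which decompose [E] as an S-S-bimodule. *)
Definition corner j l x := mul (mul (idem j) x) (idem l).

Lemma corner_linear j l : linear (corner j l).
Proof.
move=> a x y; rewrite /corner.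
by have := mul_linr (idem j) a x y => ->; have := mul_linl (idem l) a => ->.
Qed.

Lemma sum_corner x : \sum_j \sum_l corner j l x = x.
Proof.
under eq_bigr do rewrite -dg_mul_sumr idem_sumr.
by rewrite -dg_mul_suml idem_suml.
Qed.

Lemma corner_idem_l j l j' x : corner j l (mul (idem j') x) = if j == j' then corner j l x else 0.
Proof.
by rewrite /corner mulA idem_mul; case: eqP => // _; rewrite !dg_mul0x.
Qed.

Lemma corner_idem_r j l l' x : corner j l (mul x (idem l')) = if l' == l then corner j l x else 0.
Proof.
by rewrite /corner mulA -mulA idem_mul; case: eqP => [->|_] //; rewrite dg_mulx0.
Qed.

Lemma D_corner j l x : D (corner j l x) = corner j l (D x).
Proof. by rewrite /corner D_mul_idem D_idem_mul. Qed.

Lemma corner_corner j l j' l' x :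
  corner j l (corner j' l' x) = if (j == j') && (l' == l) then corner j l x else 0.
Proof.
rewrite {2}/corner corner_idem_r corner_idem_l.
by case: eqP; case: eqP.
Qed.

Lemma corner_part j l n x : q n x = x -> q n (corner j l x) = corner j l x.
Proof.
move=> nx; have := mul_part (mul_part (idem_part j) nx) (idem_part l).
by rewrite add0r addr0.
Qed.

(** Compressing [g0] to each corner and summing gives a bilinear map since the corners are
    orthogonal. The identities survive because [D] commutes with corners and [idem j] lies in the
    corner of indices j, j. *)
Lemma homotopy2 : exists g : {linear E -> E},
  [/\ forall x, D (g (D x)) = D x, forall j, D (g (idem j)) = 0, degree_pred g,
      forall j x, g (mul (idem j) x) = mul (idem j) (g x) &
      forall j x, g (mul x (idem j)) = mul (g x) (idem j)].
Proof.
have [g0 [g0D g0e g0d]] := homotopy1.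
have cl j l := linear_of_fun (corner_linear j l).
have gL : linear (fun x => \sum_j \sum_l corner j l (g0 (corner j l x))).
  move=> a x y; rewrite scaler_sumr -big_split; apply: eq_bigr => j _ /=.
  rewrite scaler_sumr -big_split; apply: eq_bigr => l _ /=.
  by have [f fE] := cl j l; rewrite -!fE !linearP.
have [g gE] := linear_of_fun gL.
exists g; split=> [x|j|n x nx|j x|j x]; rewrite !gE.
- rewrite -[RHS]sum_corner linear_sum; apply: eq_bigr => j _.
  rewrite linear_sum; apply: eq_bigr => l _ /=.
  by rewrite D_corner -(D_corner j l x) g0D !D_corner corner_corner !eqxx.
- rewrite linear_sum big1 // => j' _; rewrite linear_sum big1 // => l _ /=.
  rewrite D_corner /corner idem_mul.
  have [->|_] := eqVneq j' j; last by rewrite !dg_mul0x !linear0 dg_mulx0 dg_mul0x.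
  rewrite idem_mul; case: eqP => [<-|_]; first by rewrite g0e dg_mulx0 dg_mul0x.
  by rewrite !linear0 dg_mulx0 dg_mul0x.
- rewrite linear_sum; apply: eq_bigr => j _; rewrite linear_sum; apply: eq_bigr => l _ /=.
  by apply/corner_part/g0d/corner_part.
- rewrite dg_mul_sumr; apply: eq_bigr => j' _; rewrite dg_mul_sumr; apply: eq_bigr => l _.
  rewrite corner_idem_l /corner !mulA idem_mul.
  case: eqVneq => [->|ne] //.
  by rewrite linear0 dg_mulx0 !dg_mul0x.
- rewrite dg_mul_suml; apply: eq_bigr => j' _; rewrite dg_mul_suml; apply: eq_bigr => l _.
  rewrite corner_idem_r /corner -[RHS]mulA idem_mul.
  case: eqVneq => [_|_] //.
  by rewrite linear0 !dg_mulx0 dg_mul0x.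
Qed.

(* [h = g D g (1 - g D)] for the bilinear [g] of [homotopy2]. *)
Lemma strict_homotopy : exists h : {linear E -> E},
  [/\ forall x, D (h (D x)) = D x, forall x, h (h x) = 0, forall x, h (D (h x)) = h x,
      forall j, D (h (idem j)) = 0 & degree_pred h] /\
  (forall j x, h (mul (idem j) x) = mul (idem j) (h x)) /\
  (forall j x, h (mul x (idem j)) = mul (h x) (idem j)).
Proof.
have [g [gD ge gd gl gr]] := homotopy2.
have hL : linear (fun x => g (D (g (x - g (D x))))).
  move=> a x y; rewrite [X in g (D (g X))](_ : _ = a *: (x - g (D x)) + (y - g (D y))).
    by rewrite !linearP.
  by rewrite [D _]linearP [g _]linearP opprD addrACA scalerBr.
have [h hE] := linear_of_fun hL; exists h.
have hD x : D (h (D x)) = D x by rewrite hE D_D linear0 subr0 gD gD.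
(* This is (1 - g D) g D g = 0, the reason for h h = 0. *)
have g0 x : g (D (g x)) - g (D (g (D (g x)))) = 0 by rewrite gD subrr.
split; last split.
- split=> // [x|x|j|n x nx].
  + by rewrite hE (hE x) g0 !linear0.
  + by rewrite (hE (D _)) D_D linear0 subr0 gD (hE x) gD.
  + by rewrite hE gD D_idem linear0 subr0 ge.
  + rewrite hE; have Dn y n' : q n' y = y -> q (n' + 1) (D y) = D y.
      by move=> {2}<-; rewrite D_part.
    have zn : q n (x - g (D x)) = x - g (D x).
      by rewrite linearB nx; have := gd _ _ (Dn _ _ nx); rewrite addrK => ->.
    by have := gd _ _ (Dn _ _ (gd _ _ zn)); rewrite subrK.
- by move=> j x; rewrite !hE D_idem_mul !gl -dg_mulBr gl D_idem_mul gl.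
- by move=> j x; rewrite !hE D_mul_idem !gr -dg_mulBl gr D_mul_idem gr.
Qed.

Lemma sign_parity (V : lmodType k) (K : choiceType) (gr : grading K V) (e : K -> int) :
  exists s : {linear V -> V}, forall a x, gr a x = x -> s x = (-1 : k) ^ (e a) *: x.
Proof.
have sL a : linear (fun x : V => (-1 : k) ^ (e a) *: x).
  by move=> t x y; rewrite scalerDr !scalerA [_ * t]mulrC.
have [c cE] := choice (fun a => linear_of_fun (sL a)).
have [s sE] := glue_parts gr c.
by exists s => a x <-; rewrite sE cE.
Qed.

(** For the homotopy of [strict_homotopy], the projection onto the cycles killed by [h], of which
    each cohomology class contains exactly one. *)
Definition coho_proj (h : {linear E -> E}) x := x - D (h x) - h (D x).

Lemma minimal_model : exists m : seq A -> A,
  [/\ A_infinity_structure (fun n a => qA n a = a)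
        (fun (s : {ffun I -> k}) x => mulAA (\sum_j s j *: eA j) x)
        (fun x (s : {ffun I -> k}) => mulAA x (\sum_j s j *: eA j)) m,
      forall x, m [:: x] = 0,
      forall x y, m [:: x; y] = mulAA x y &
      forall z, (3 <= size z)%N -> (exists j, eA j \in z) -> m z = 0].
Proof.
have [h [[DhD hh hDh Dhe hd] [hl hr]]] := strict_homotopy.
pose Pi := coho_proj h.
have D_Pi x : D (Pi x) = 0 by rewrite /Pi /coho_proj !linearB D_D DhD subr0 subrr.
have Pi_D x : Pi (D x) = 0 by rewrite /Pi /coho_proj D_D linear0 subr0 DhD subrr.
have Pi_h x : Pi (h x) = 0 by rewrite /Pi /coho_proj hh linear0 subr0 hDh subrr.
have DhPi x : D (h (Pi x)) = 0.
  by rewrite /Pi /coho_proj !linearB hh hDh linear0 subr0 subrr.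
have Pi_cycle x : D x = 0 -> Pi x = x - D (h x).
  by move=> Dx; rewrite /Pi /coho_proj Dx linear0 subr0.
have Pi_lin a x y : Pi (a *: x + y) = a *: Pi x + Pi y.
  rewrite /Pi /coho_proj [h (a *: x + y)]linearP [D (a *: x + y)]linearP.
  rewrite [D (_ + _)]linearP [h (_ + _)]linearP.
  by rewrite !opprD !scalerBr [RHS]addrACA [X in _ = X + _]addrACA.
have rep_Pi x a : rep x a -> rep (Pi x) a.
  by move=> r; rewrite (Pi_cycle _ (rep_cycle r)) -[a]subr0; apply: repB.
have [p pP] : exists p : {linear E -> A}, forall x, rep (Pi x) (p x).
  apply: (@linear_of_rel _ E A (fun x a => rep (Pi x) a)) => [x|a|a x b x' b'].
  - exact: rep_ex.
  - by rewrite -{1}(linear0 D) Pi_D => /rep0.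
  - by rewrite Pi_lin; exact: rep_lin.
(* A boundary [c] equals [D (h c)]. So [i a] can be defined as the only representative with
   [D (h c) = 0], and [Dhe] then gives [i (eA j) = idem j]. *)
have ker0 c : rep c 0 -> D (h c) = 0 -> c = 0.
  by move=> /rep_ker[c' ->]; rewrite DhD.
have [i iP] : exists i : {linear A -> E}, forall a, rep (i a) a /\ D (h (i a)) = 0.
  apply: (@linear_of_rel _ A E (fun a c => rep c a /\ D (h c) = 0)) =>
    [a|c [r Dh]|a x c x' c' [r Dh] [r' Dh']].
  - by have [c /rep_Pi r] := rep_surj a; exists (Pi c).
  - exact: ker0.
  - by split; [exact: rep_lin | rewrite !linearP Dh Dh' scaler0 addr0].
have i_uniq c a : rep c a -> D (h c) = 0 -> i a = c.
  move=> r Dh; have [r' Dh'] := iP a; apply/eqP; rewrite -subr_eq0; apply/eqP/ker0.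
    by rewrite -(subrr a); exact: repB.
  by rewrite !linearB Dh Dh' subrr.
have p_uniq x a : rep (Pi x) a -> p x = a by exact: rep_functional (pP x).
have D_i a : D (i a) = 0 by have [/rep_cycle] := iP a.
have p_rep x a : rep x a -> p x = a by move=> /rep_Pi/p_uniq.
have p_D x : p (D x) = 0 by apply: p_uniq; rewrite Pi_D; exact: rep00.
have p_h x : p (h x) = 0 by apply: p_uniq; rewrite Pi_h; exact: rep00.
have p_i a : p (i a) = a by apply: p_rep; have [] := iP a.
have h_i a : h (i a) = 0 by have [_ e] := iP a; rewrite -hDh e linear0.
have homot x : i (p x) = x - D (h x) - h (D x) by apply: i_uniq; [exact: pP | exact: DhPi].
have [sE sEP] := sign_parity q id.
have [sA sAP] := sign_parity qA Posz.
have sgnD m n : (-1 : k) ^ (m + n) = (-1) ^ m * (-1) ^ n.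
  by rewrite expfzDr // oppr_eq0 oner_eq0.
have sgn2 n : (-1 : k) ^ n * (-1) ^ n = 1.
  by rewrite -expfzMl mulrNN mulr1 exp1rz.
have h_part n x : h (q n x) = q (n - 1) (h x) by exact: degree_pred_part.
have Pi_part n x : q n (Pi x) = Pi (q n x).
  by rewrite /Pi /coho_proj h_part !D_part subrK h_part addrK !linearB.
have i_deg n a : qA n a = a -> q n%:Z (i a) = i a.
  move=> na; apply/esym/i_uniq.
    by rewrite -{2}na; apply: rep_part; have [] := iP a.
  by rewrite h_part D_part subrK; have [_ ->] := iP a; rewrite linear0.
have p_deg n x : q n%:Z x = x -> qA n (p x) = p x.
  move=> nx; apply/esym/p_uniq; rewrite -{1}nx -Pi_part.
  exact/rep_part/pP.
have p_neg n x : q (Negz n) x = x -> p x = 0.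
  by move=> nx; apply/p_uniq; rewrite -{1}nx -Pi_part; exact/rep_neg/pP.
have sE_part n x : q n (sE x) = sE (q n x).
  apply: (@eq_on_parts _ _ _ _ q (q n \o sE) (sE \o q n)) => m y /=.
  rewrite (sEP m (q m y)) ?part_id // linearZ /= part_part.
  by case: eqP => [->|_]; [rewrite (sEP m) ?part_id | rewrite scaler0 linear0].
have sE_deg n x : q n x = x -> q n (sE x) = sE x by rewrite sE_part => ->.
have sE_invol x : sE (sE x) = x.
  apply: (@eq_on_homog _ _ _ _ q (sE \o sE) idfun) => n y ny /=.
  by rewrite (sEP n y ny) linearZ /= (sEP n y ny) scalerA sgn2 scale1r.
have sA_invol x : sA (sA x) = x.
  apply: (@eq_on_homog _ _ _ _ qA (sA \o sA) idfun) => n y ny /=.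
  by rewrite (sAP n y ny) linearZ /= (sAP n y ny) scalerA sgn2 scale1r.
have sgn1 n : (-1 : k) ^ (n + 1) = - (-1) ^ n by rewrite sgnD expr1z mulrN1.
have sgnN1 n : (-1 : k) ^ (n - 1) = - (-1) ^ n.
  by have := sgn1 (n - 1); rewrite subrK => ->; rewrite opprK.
have sE_mul x y : sE (mul x y) = mul (sE x) (sE y).
  have [f fE] := dg_mul_r y; have [f' f'E] := dg_mul_r (sE y).
  rewrite -fE -f'E; apply: (@eq_on_homog _ _ _ _ q (sE \o f) (f' \o sE)) => n {}x nx /=.
  rewrite fE f'E; have [u uE] := dg_mul_l x; have [v vE] := dg_mul_l (sE x).
  rewrite -uE -vE; apply: (@eq_on_homog _ _ _ _ q (sE \o u) (v \o sE)) => n' z nz /=.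
  rewrite uE vE (sEP (n + n')) ?mul_part // (sEP n x nx) (sEP n' z nz).
  by rewrite dg_mulZl dg_mulZr scalerA sgnD.
have sE_D x : sE (D x) = - D (sE x).
  rewrite -linearN; apply: (@eq_on_homog _ _ _ _ q (sE \o D) (D \o -%R \o sE)) => n {}x nx /=.
  rewrite (sEP (n + 1)) -?D_part ?nx // (sEP n x nx) sgn1 scaleNr.
  by rewrite [D (- _)]linearN [D (_ *: _)]linearZ.
have sE_h x : sE (h x) = - h (sE x).
  rewrite -linearN; apply: (@eq_on_homog _ _ _ _ q (sE \o h) (h \o -%R \o sE)) => n {}x nx /=.
  rewrite (sEP (n - 1)) -?h_part ?nx // (sEP n x nx) sgnN1 scaleNr.
  by rewrite [h (- _)]linearN [h (_ *: _)]linearZ.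
have sE_i a : sE (i a) = i (sA a).
  apply: (@eq_on_homog _ _ _ _ qA (sE \o i) (i \o sA)) => n x nx /=.
  by rewrite (sAP n x nx) (sEP n) ?i_deg // linearZ.
have sA_p x : sA (p x) = p (sE x).
  apply: (@eq_on_homog _ _ _ _ q (sA \o p) (p \o sE)) => -[] n {}x nx /=.
    by rewrite (sAP n) ?p_deg // (sEP n x nx) linearZ.
  by rewrite (sEP (Negz n) x nx) linearZ /= !(p_neg n x nx) linear0 scaler0.
pose sh (s : {ffun I -> k}) := \sum_j s j *: idem j.
pose Sa (s : {ffun I -> k}) := \sum_j s j *: eA j.
have rep_sh s : rep (sh s) (Sa s).
  rewrite /sh /Sa; elim/big_ind2: _ => [|c a c' a' r r'|j _]; first exact: rep00.
    by have := rep_lin 1 r r'; rewrite !scale1r.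
  exact/repZ/rep_idem.
have idem_lin_l (f : {linear E -> E}) s x : (forall j x, f (mul (idem j) x) = mul (idem j) (f x)) ->
    f (mul (sh s) x) = mul (sh s) (f x).
  move=> fl; rewrite /sh !dg_mul_suml linear_sum; apply: eq_bigr => j _.
  by rewrite !dg_mulZl linearZ /= fl.
have idem_lin_r (f : {linear E -> E}) s x : (forall j x, f (mul x (idem j)) = mul (f x) (idem j)) ->
    f (mul x (sh s)) = mul (f x) (sh s).
  move=> fr; rewrite /sh !dg_mul_sumr linear_sum; apply: eq_bigr => j _.
  by rewrite !dg_mulZr linearZ /= fr.
have h_la s x : h (mul (sh s) x) = mul (sh s) (h x) by exact: idem_lin_l.
have h_ra s x : h (mul x (sh s)) = mul (h x) (sh s) by exact: idem_lin_r.
have D_la s x : D (mul (sh s) x) = mul (sh s) (D x) by apply: idem_lin_l; exact: D_idem_mul.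
have D_ra s x : D (mul x (sh s)) = mul (D x) (sh s) by apply: idem_lin_r; exact: D_mul_idem.
have Pi_la s x : Pi (mul (sh s) x) = mul (sh s) (Pi x).
  by rewrite /Pi /coho_proj h_la !D_la h_la -!dg_mulBr.
have Pi_ra s x : Pi (mul x (sh s)) = mul (Pi x) (sh s).
  by rewrite /Pi /coho_proj h_ra !D_ra h_ra -!dg_mulBl.
have i_la s a : i (mulAA (Sa s) a) = mul (sh s) (i a).
  apply: i_uniq; first by apply: rep_mul => //; have [] := iP a.
  by rewrite h_la h_i dg_mulx0 linear0.
have i_ra s a : i (mulAA a (Sa s)) = mul (i a) (sh s).
  apply: i_uniq; first by apply: rep_mul => //; have [] := iP a.
  by rewrite h_ra h_i dg_mul0x linear0.
have p_la s x : p (mul (sh s) x) = mulAA (Sa s) (p x).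
  by apply: p_uniq; rewrite Pi_la; apply: rep_mul.
have p_ra s x : p (mul x (sh s)) = mulAA (p x) (Sa s).
  by apply: p_uniq; rewrite Pi_ra; apply: rep_mul.
have sE_sh s : sE (sh s) = sh s.
  rewrite /sh linear_sum; apply: eq_bigr => j _.
  by rewrite linearZ /= (sEP 0) ?idem_part // expr0z scale1r.
have D_mul x y : D (mul x y) = mul (D x) y + mul (sE x) (D y).
  have [f fE] := dg_mul_r y; have [f' f'E] := dg_mul_r (D y).
  rewrite -!fE -f'E.
  apply: (@eq_on_homog _ _ _ _ q (D \o f) ((f \o D) \+ (f' \o sE))) => n {}x nx /=.
  by rewrite !fE f'E (D_mul_part _ nx) (sEP n x nx) dg_mulZl.
have unit_eA j : strict_unit i sh (eA j).
  exists [ffun l => (l == j)%:R]; rewrite (i_uniq (idem j)) //.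
  rewrite /sh (bigD1 j) //= ffunE eqxx scale1r big1 ?addr0 // => l.
  by rewrite ffunE => /negPf->; rewrite scale0r.
exists (transfer_m mul sE h sA i p); split.
- apply: (transfer_A_infinity mul_linl mul_linr mulA D_mul sE_invol sE_mul sE_D sE_h
    sE_i sA_p D_i p_D p_i homot (dE := fun n x => q n x = x) _ _ _ _ _ _ _ _ _ _ _
    i_la i_ra p_la p_ra h_la h_ra sE_sh) => //.
  + by move=> n; rewrite linear0.
  + by move=> n a x y nx ny; rewrite linearP nx ny.
  + by move=> n a na; rewrite (sAP n a na) linearZ /= na.
  + by move=> n a na; rewrite linearN na.
- by move=> x; exact: transfer_m1.
- move=> x y; rewrite transfer_m2 //; apply: p_rep.
  by apply: rep_mul; have [] := iP x; have [] := iP y.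
- move=> z z3 [j jz]; exact: (transfer_m_unit mul_linl mul_linr sE_mul sE_h
    sE_i (la := fun s x => mulAA (Sa s) x) (ra := fun x s => mulAA x (Sa s))
    p_la p_ra h_la h_ra sE_sh hh h_i p_h (unit_eA j) jz z3).
Qed.

End MinimalModel.

(** * Total complexes of projective resolutions *)

Section PartFacts.
Variables (R : pzRingType) (K : choiceType) (V : lmodType R) (gr : grading K V).

Lemma eq_parts x y : (forall b, gr b x = gr b y) -> x = y.
Proof.
move=> xy; apply/eqP; rewrite -subr_eq0; have [s ->] := part_sum gr (x - y).
by rewrite big1 // => b _; rewrite linearB /= xy subrr.
Qed.

Lemma part_only b y : (forall b', b' != b -> gr b' y = 0) -> gr b y = y.
Proof.
move=> y0; apply: eq_parts => b'; rewrite part_part.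
by case: eqVneq => [->|/y0].
Qed.

Lemma part_all0 y : (forall b, gr b y = 0) -> y = 0.
Proof. by move=> y0; apply: eq_parts => b; rewrite y0 linear0. Qed.

End PartFacts.

Section TotalResolutions.
Variables (k : fieldType) (L : falgType k).

(* A projective resolution of [M], as a single graded module with differential. *)
Record total_resolution (M : lmodType L) := TotalResolution {
  tot :> lmodType L;
  tgr : grading nat tot;
  td : {linear tot -> tot};
  teps : {linear tot -> M};
  tot_projective : projective tot;
  td_part : forall n x, td (tgr n.+1 x) = tgr n (td x);
  td_part0 : forall x, td (tgr 0 x) = 0;
  teps_part : forall n x, teps (tgr n.+1 x) = 0;
  td_td : forall x, td (td x) = 0;
  teps_td : forall x, teps (td x) = 0;
  tot_exact : forall x, td x = 0 -> teps x = 0 -> exists y, td y = x;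
  teps_surj : forall x, exists y, teps y = x
}.

(** Degree [n] lowers the resolution degree by [n], the cohomological convention for Ext; homotopies
    have degree -1. *)
Definition hdeg (M M' : lmodType L) (T : total_resolution M) (T' : total_resolution M')
    (n : int) (c : T -> T') :=
  forall a b x, a%:Z != b%:Z + n -> tgr T' b (c (tgr T a x)) = 0.

(** * Lifting homogeneous maps between resolutions *)

Section Lift.
Variables (M M' : lmodType L) (T : total_resolution M) (T' : total_resolution M').

Lemma hdeg_part n (c : T -> T') a b x : hdeg n c -> a%:Z = b%:Z + n ->
  tgr T' b (c (tgr T a x)) = c (tgr T a x).
Proof.
move=> cn ab; apply: part_only => b' b'b; apply: cn; rewrite ab.
by rewrite (inj_eq (addIr _)) eqz_nat eq_sym.
Qed.

Lemma hdeg_neg n (c : T -> T') a x : hdeg n c -> a%:Z < n -> c (tgr T a x) = 0.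
Proof.
move=> cn an; apply: (@part_all0 _ _ _ (tgr T')) => b; apply: cn.
by apply/eqP => ab; move: an; rewrite ab; lia.
Qed.

Variables (n : int) (r : {linear T -> T'}) (u : {linear T -> M'}).
Hypothesis r_deg : hdeg n r.
Hypothesis r_d : forall x, td T' (r x) = r (td T x).
Hypothesis r_eps : forall x, teps T' (r x) = u (td T x).
Hypothesis u_deg : forall a x, a%:Z != n - 1 -> u (tgr T a x) = 0.

(** The obstruction to the next component vanishes: [tgr T' b (r x) - s (td T x)] has to be a
    boundary in [T']. *)
Definition lift_inv b (s : {linear T -> T'}) :=
  (forall x, tgr T' b (s x) = s x) /\
  forall x, td T' (tgr T' b (r x) - s (td T x)) = 0 /\
            teps T' (tgr T' b (r x) - s (td T x)) = 0.

Lemma teps_part0 (N : lmodType L) (S : total_resolution N) x : teps S (tgr S 0 x) = teps S x.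
Proof.
apply: (@eq_on_parts _ _ _ _ (tgr S) (teps S \o tgr S 0) (teps S)) => -[|a] y /=.
  by rewrite part_id.
by rewrite part_neq // linear0 teps_part.
Qed.

Lemma lift_base : exists s, lift_inv 0 s /\ forall x, teps T' (s x) = u x.
Proof.
have [s0 s0E] := @tot_projective _ T _ _ (teps T') u (@teps_surj _ T').
exists (tgr T' 0 \o s0); split=> [|x] /=; last by rewrite teps_part0 s0E.
split=> x /=; first by rewrite part_id.
by rewrite -linearB td_part0 teps_part0 linearB r_eps s0E subrr.
Qed.

Lemma lift_step b s : lift_inv b s ->
  exists s', lift_inv b.+1 s' /\ forall x, td T' (s' x) = tgr T' b (r x) - s (td T x).
Proof.
move=> [sb sc].
have [|s0 s0E] := @projective_lift _ _ _ _ _ (td T')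
    ((tgr T' b \o r) \- (s \o td T)) (@tot_projective _ T).
  by move=> x; have [/tot_exact H /H] := sc x.
have s1E x : td T' (tgr T' b.+1 (s0 x)) = tgr T' b (r x) - s (td T x).
  by rewrite td_part s0E /= linearB /= sb part_id.
exists (tgr T' b.+1 \o s0); split=> // ; split=> x /=; first by rewrite part_id.
rewrite -linearB teps_part; split=> //.
by rewrite td_part !linearB /= r_d -td_part s1E td_td linear0 subr0 subrr.
Qed.

Lemma lift_seq : exists s : nat -> {linear T -> T'},
  [/\ forall b x, tgr T' b (s b x) = s b x,
      forall b x, td T' (s b.+1 x) = tgr T' b (r x) - s b (td T x) &
      forall x, teps T' (s 0 x) = u x].
Proof.
pose F b (s : {s | lift_inv b s}) := cid (lift_step (svalP s)).
have [s0 [s0i s0u]] := lift_base.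
pose S := nat_rect (fun b => {s | lift_inv b s}) (exist _ s0 s0i)
  (fun b s => exist (lift_inv b.+1) (sval (F b s)) (svalP (F b s)).1).
exists (fun b => sval (S b)); split=> // b x.
  by have [H _] := svalP (S b).
by have [_ H] := svalP (F b (S b)).
Qed.

(** The single lifting result behind the comparison. For [r] zero it yields chain maps over a
    cocycle, for [r] a difference of chain maps a homotopy, and for [r] a cycle with trivial class a
    primitive. *)
Lemma lift_hom : exists s : {linear T -> T'},
  [/\ hdeg (n - 1) s, forall x, teps T' (s x) = u x &
      forall x, td T' (s x) + s (td T x) = r x].
Proof.
have [s [s_part s_d s_eps]] := lift_seq.
(* A map of degree n - 1 sends part a to part a - n + 1, and is 0 where that index is negative. *)
have [S SE] := glue_parts (tgr T) (fun a =>
  match a%:Z - n + 1 with Posz b => s b | Negz _ => [the {linear T -> T'} of \0] end).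
have Sx a b x : a%:Z + 1 = b%:Z + n -> S (tgr T a x) = s b (tgr T a x).
  by move=> ab; rewrite SE (_ : a%:Z - n + 1 = b) //; lia.
have S0 a x : a%:Z + 1 < n -> S (tgr T a x) = 0.
  move=> an; rewrite SE; case E : (a%:Z - n + 1) => [b|b] //.
  by exfalso; move: an E; lia.
have cases a : (exists b : nat, a%:Z + 1 = b%:Z + n) \/ a%:Z + 1 < n.
  case E : (a%:Z + 1 - n) => [b|b]; [left; exists b | right]; move: E; lia.
exists S; split=> [a b x ab|x|x].
- have [[b' ab']|/S0->] := cases a; last exact: linear0.
  rewrite (Sx _ _ _ ab') -s_part part_neq //; apply: contraNneq ab => ->.
  by apply/eqP; move: ab'; lia.
- apply: (@eq_on_parts _ _ _ _ (tgr T) (teps T' \o S) u) => a y /=.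
  have [[b ab]|an] := cases a; last first.
    rewrite S0 // linear0 u_deg //; apply: contraTneq an; lia.
  rewrite (Sx _ _ _ ab); case: b ab => [|b] ab; first exact: s_eps.
  rewrite -s_part teps_part u_deg //; apply/eqP; move: ab; lia.
- apply: (@eq_on_parts _ _ _ _ (tgr T) ((td T' \o S) \+ (S \o td T)) r) => a y /=.
  have Sd0 : a%:Z < n -> S (td T (tgr T a y)) = 0.
    case: a {cases} => [|a] an; first by rewrite td_part0 linear0.
    by rewrite td_part S0 //; move: an; lia.
  have Sd b : a%:Z = b%:Z + n -> S (td T (tgr T a y)) = s b (td T (tgr T a y)).
    case: a {Sd0 cases} => [|a] an; first by rewrite td_part0 !linear0.
    by rewrite td_part (Sx _ b) //; move: an; lia.
  have [[[|b] ab]|an] := cases a.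
  + rewrite (Sx _ _ _ ab) -s_part td_part0 Sd0; last by move: ab; lia.
    by rewrite (hdeg_neg _ r_deg) ?addr0 //; move: ab; lia.
  + have ab' : a%:Z = b%:Z + n by move: ab; lia.
    by rewrite (Sx _ _ _ ab) s_d (Sd _ ab') subrK (hdeg_part _ r_deg).
  + rewrite S0 // linear0 Sd0; last by move: an; lia.
    by rewrite (hdeg_neg _ r_deg) ?addr0 //; move: an; lia.
Qed.

End Lift.

Section Homogeneous.
Variables (M M' M'' : lmodType L).

Lemma hdeg_comp (T : total_resolution M) (T' : total_resolution M')
    (T'' : total_resolution M'') n n' (c : {linear T' -> T''}) (c' : {linear T -> T'}) :
  hdeg n c -> hdeg n' c' -> hdeg (n + n') (c \o c').
Proof.
move=> cn cn' a b x ab /=; have [s ->] := part_sum (tgr T') (c' (tgr T a x)).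
rewrite !linear_sum big1_seq // => m _ /=.
have [ma|ma] := eqVneq a%:Z (m%:Z + n'); last by rewrite cn' // !linear0.
by apply: cn; apply: contraNneq ab => mb; rewrite ma mb addrA.
Qed.

Lemma hdegB (T : total_resolution M) (T' : total_resolution M') n (c c' : {linear T -> T'}) :
  hdeg n c -> hdeg n c' -> hdeg n (c \- c').
Proof. by move=> cn cn' a b x ab /=; rewrite linearB /= cn // cn' // subrr. Qed.

Lemma hdeg_id (T : total_resolution M) : hdeg 0 (@idfun T).
Proof. by move=> a b x; rewrite addr0 eqz_nat /= => ab; rewrite part_neq // eq_sym. Qed.

Variable T : total_resolution M.

(* Composing with [tsign] turns maps that anticommute with the differential into maps
   that commute with it. *)
Lemma tsign_exists : exists s : {linear T -> T},
  forall a x, s (tgr T a x) = if odd a then - tgr T a x else tgr T a x.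
Proof.
have [s sE] := glue_parts (tgr T) (fun a =>
  if odd a then [the {linear T -> T} of \- idfun] else [the {linear T -> T} of idfun]).
by exists s => a x; rewrite sE; case: odd.
Qed.

Definition tsign : {linear T -> T} := sval (cid tsign_exists).

Lemma tsign_part a x : tsign (tgr T a x) = if odd a then - tgr T a x else tgr T a x.
Proof. exact: (svalP (cid tsign_exists)). Qed.

Lemma tsign_invol x : tsign (tsign x) = x.
Proof.
apply: (@eq_on_parts _ _ _ _ (tgr T) (tsign \o tsign) idfun) => a y /=.
by rewrite tsign_part; case: ifP => oa; rewrite ?linearN /= tsign_part oa ?opprK.
Qed.

Lemma tsign_d x : tsign (td T x) = - td T (tsign x).
Proof.
apply: (@eq_on_parts _ _ _ _ (tgr T) (tsign \o td T) (\- (td T \o tsign))) => -[|a] y /=.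
  by rewrite tsign_part td_part0 linear0 oppr0.
rewrite td_part !tsign_part /=; case: odd; rewrite /= ?linearN td_part ?opprK //.
Qed.

Lemma teps_tsign x : teps T (tsign x) = teps T x.
Proof.
apply: (@eq_on_parts _ _ _ _ (tgr T) (teps T \o tsign) (teps T)) => -[|a] y /=.
  by rewrite tsign_part.
by rewrite tsign_part; case: odd; rewrite /= ?linearN teps_part ?oppr0.
Qed.

Lemma hdeg_tsign : hdeg (T := T) (T' := T) 0 tsign.
Proof.
move=> a b x; rewrite addr0 eqz_nat eq_sym => ab; rewrite tsign_part.
by case: odd; rewrite ?linearN /= part_neq ?oppr0.
Qed.

End Homogeneous.

(** Lifting with [r] zero, regarded as of degree n + 1, gives a map of degree n that anticommutes
    with the differentials; [tsign] makes it commute. *)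
Lemma chain_map_exists (M M' : lmodType L) (T : total_resolution M) (T' : total_resolution M')
    (n : int) (u : {linear T -> M'}) :
  (forall a x, a%:Z != n -> u (tgr T a x) = 0) -> (forall x, u (td T x) = 0) ->
  exists c : {linear T -> T'},
    [/\ hdeg n c, forall x, teps T' (c x) = u x & forall x, td T' (c x) = c (td T x)].
Proof.
move=> un ud.
have [||||s [s_deg s_eps s_d]] := @lift_hom _ _ T T' (n + 1) [the {linear T -> T'} of \0] u.
- by move=> a b x _; exact: linear0.
- by move=> x; exact: linear0.
- by move=> x; rewrite ud; exact: linear0.
- by move=> a x; rewrite addrK; exact: un.
exists (@tsign _ T' \o s); split=> [|x|x] /=.
- have := hdeg_comp (@hdeg_tsign _ T') s_deg; by rewrite add0r addrK.
- by rewrite teps_tsign s_eps.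
- have e : td T' (s x) = - s (td T x) by apply/eqP; rewrite -addr_eq0 s_d.
  by rewrite -[LHS]opprK -tsign_d e linearN opprK.
Qed.

(** * The total complex of a projective resolution *)

Section Total.
Variables (M : lmodType L) (P : projective_resolution M).

Definition total_obj : lmodType L := dsum (P : nat -> lmodType L).

Lemma total_d_exists : exists D : {linear total_obj -> total_obj},
  (forall v, D (dsum_inj (i := 0) v) = 0) /\
  forall n v, D (dsum_inj (i := n.+1) v) = dsum_inj (i := n) (res_d P n v).
Proof.
have [D DE] := dsum_glue (V := P : nat -> lmodType L) (fun n =>
  match n return {linear P n -> total_obj} with
  | 0 => [the {linear P 0 -> total_obj} of \0]
  | m.+1 => [the {linear P m.+1 -> total_obj} of @dsum_inj L nat P m \o res_d P m]
  end).
by exists D; split=> [v|n v]; rewrite DE.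
Qed.

Definition total_d := sval (cid total_d_exists).

Lemma total_d0 v : total_d (dsum_inj (i := 0) v) = 0.
Proof. exact: (svalP (cid total_d_exists)).1. Qed.

Lemma total_dS n v : total_d (dsum_inj (i := n.+1) v) = dsum_inj (i := n) (res_d P n v).
Proof. exact: (svalP (cid total_d_exists)).2. Qed.

Lemma total_d_proj n x : dsum_proj n (total_d x) = res_d P n (dsum_proj n.+1 x).
Proof.
apply: (@eq_on_inj _ _ _ _ (dsum_proj (V := P : nat -> lmodType L) n \o total_d)
   (res_d P n \o dsum_proj (V := P : nat -> lmodType L) n.+1)) => -[|m] v /=.
  by rewrite total_d0 dsum_proj_inj_neq // !linear0.
rewrite total_dS; have [mn|mn] := eqVneq m n; first by case: n / mn; rewrite !dsum_injK.
by rewrite !dsum_proj_inj_neq ?linear0 // eqSS.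
Qed.

Definition total_eps : {linear total_obj -> M} :=
  res_eps P \o dsum_proj (V := P : nat -> lmodType L) 0.

Definition total_complex : total_resolution M.
Proof.
apply: (@TotalResolution M total_obj (dsum_grading _) total_d total_eps).
- by apply: dsum_projective => n; exact: res_projective.
- by move=> n x; rewrite /= /dsum_part /= total_dS total_d_proj.
- by move=> x; rewrite /= /dsum_part /= total_d0.
- by move=> n x; rewrite /= /dsum_part /= dsum_proj_inj_neq ?linear0.
- move=> x; apply: dsum_ext => n; rewrite !total_d_proj linear0.
  by apply/res_exact; exists (dsum_proj n.+2 x).
- by move=> x; rewrite /= total_d_proj; apply/res_exact0; exists (dsum_proj 1 x).
- move=> x dx ex.
  have H n : exists y, res_d P n y = dsum_proj n x.
    case: n => [|n]; first exact/res_exact0.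
    by apply/res_exact; rewrite -total_d_proj dx linear0.
  have y n := cid (H n); have [s _ xE] := dsum_sum x.
  exists (\sum_(n <- s) dsum_inj (i := n.+1) (sval (y n))).
  rewrite linear_sum [RHS]xE; apply: eq_bigr => n _ /=.
  by rewrite total_dS (svalP (y n)).
- by move=> x; have [y yE] := res_eps_surj P x; exists (dsum_inj (i := 0) y); rewrite /= dsum_injK.
Defined.

End Total.

End TotalResolutions.

(** * Classes in Ext *)

Section ExtClasses.
Local Open Scope quotient_scope.
Variables (k : fieldType) (L : falgType k) (M N : lmodType L).
Variable P : projective_resolution M.
Local Notation TP := (total_complex P).

(** Stated for plain functions, so that composites can be compared pointwise without being packed as
    cocycles. *)
Definition class_of n (f : P n -> N) (z : Ext_res P N n) : Prop :=
  exists g : cocycle P N n, quo_class _ g = z /\ forall x, submod_val g x = f x.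

Lemma quo_class_eq0 (R : pzRingType) (V : lmodType R) (S : submodule V) (v : V) :
  quo_class S v = 0 <-> S v.
Proof.
have E : (quo_class S v == 0) = S v.
  have -> : (0 : quomod S) = \pi_(quomod S) 0 by rewrite raddf0.
  rewrite /quo_class -Quotient.idealrBE subr0 //.
by rewrite -E; split=> [->|/eqP].
Qed.

Lemma quo_class_linear (R : pzRingType) (V : lmodType R) (S : submodule V) :
  linear (quo_class S).
Proof.
move=> a u v; rewrite /quo_class raddfD; congr (_ + _).
by apply/esym; exact: pi_scale.
Qed.

Variable n : nat.
Implicit Types (f : P n -> N) (z : Ext_res P N n).

Lemma eq_class_of f f' z : (forall x, f x = f' x) -> class_of f z -> class_of f' z.
Proof. by move=> ff' [g [gz gf]]; exists g; split=> // x; rewrite gf. Qed.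

Lemma class_of_lin (t : k) f f' z z' : class_of f z -> class_of f' z' ->
  class_of (fun x => t%:A *: f x + f' x) (t *: z + z').
Proof.
move=> [g [<- gf]] [g' [<- gf']]; exists (t *: g + g'); split.
  exact: quo_class_linear.
by move=> x; rewrite -gf -gf'.
Qed.

Lemma class_of_add0 f f' z : class_of f z -> class_of f' 0 ->
  class_of (fun x => f x + f' x) z.
Proof.
move=> fz fz'; have := class_of_lin 1 fz fz'.
rewrite [1 *: z]scale1r [z + 0]addr0; apply: eq_class_of => x.
by rewrite !scale1r.
Qed.

Lemma class_of_functional f z z' : class_of f z -> class_of f z' -> z = z'.
Proof.
move=> [g [<- gf]] [g' [<- gf']]; congr (quo_class _ _); apply: val_inj.
by apply: Hom_eq => x; rewrite [LHS]gf [RHS]gf'.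
Qed.

Lemma class_of_ex (f : {linear P n -> N}) : (forall x, f (res_d P n x) = 0) ->
  exists z, class_of f z.
Proof.
move=> fd; have cf : Submodule (@cocycle_closed k L M P N n) (f : Defs.Hom _ _) by exact/asboolP.
by exists (quo_class _ (Submod cf)), (Submod cf).
Qed.

Lemma class_of_surj z : exists2 f : {linear P n -> N},
  class_of f z & forall x, f (res_d P n x) = 0.
Proof.
exists (submod_val (quo_repr z : cocycle P N n)).
  by exists (quo_repr z); split=> //; exact: reprK.
by move/asboolP: (submod_valP (quo_repr z : cocycle P N n)).
Qed.

Lemma class_of00 : class_of (fun=> 0) (0 : Ext_res P N n).
Proof. by exists 0; split=> //; rewrite /quo_class raddf0. Qed.

(** A primitive on degree n - 1 is extended by 0 to the total complex; in degree 0, where only 0 is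
    a coboundary, [v] is 0. *)
Lemma class_of0_inv f : class_of f 0 -> exists v : {linear TP -> N},
  (forall a x, a%:Z != n%:Z - 1 -> v (tgr TP a x) = 0) /\
  forall x, f x = v (td TP (dsum_inj x)).
Proof.
move=> [g [/quo_class_eq0/asboolP g0 gf]].
case: n f g g0 gf => [|m] f g /= g0 gf.
  exists [the {linear TP -> N} of \0]; split=> // x.
  by rewrite -gf (g0 : submod_val g = 0).
have [h hE] := g0.
pose pr : {linear TP -> P m} := @dsum_proj L nat (P : nat -> lmodType L) m.
pose v : {linear TP -> N} := (h : {linear P m -> N}) \o pr.
exists v; rewrite /v /pr; split=> [a x am|x] /=.
  rewrite /dsum_part /= dsum_proj_inj_neq ?linear0 //.
  by apply: contraNneq am => ->; apply/eqP; lia.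
by rewrite total_dS dsum_injK -hE gf.
Qed.

Lemma class_of0 (v : {linear TP -> N}) f : (forall x, f x = v (td TP (dsum_inj x))) ->
  class_of f 0.
Proof.
move=> fE.
have fL : linear f by move=> a x y; rewrite !fE !linearP.
have [f' f'E] := linear_of_fun fL.
have cf : Submodule (@cocycle_closed k L M P N n) (f' : Defs.Hom _ _).
  apply/asboolP => x; have := td_td (t := TP) (dsum_inj (i := n.+1) x).
  by rewrite f'E fE /= total_dS => ->; exact: linear0.
exists (Submod cf); split=> //; apply/quo_class_eq0/asboolP.
case: n f fE fL f' f'E cf => [|m] f fE fL f' f'E cf /=.
  by apply: Hom_eq => x; rewrite f'E fE /= total_d0 linear0.
exists (v \o @dsum_inj L nat (P : nat -> lmodType L) m) => x /=.
by rewrite f'E fE /= total_dS.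
Qed.

End ExtClasses.

(** * The endomorphism dg algebra of a total complex *)

Section TotalChainLift.
Variables (k : fieldType) (L : falgType k) (M N : lmodType L).
Variables (P : projective_resolution M) (Q : projective_resolution N).
Variables (q : nat) (g : cocycle P N q).
Local Notation PV := (P : nat -> lmodType L).
Local Notation QV := (Q : nat -> lmodType L).

Lemma total_chain_lift : exists G : {linear total_complex P -> total_complex Q},
  [/\ hdeg q G, forall x, td (total_complex Q) (G x) = G (td (total_complex P) x) &
      forall b x, G (dsum_inj (V := PV) (i := (b + q)%N) x) =
                  dsum_inj (V := QV) (chain_lift Q g b x)].
Proof.
(* Projecting to degree b + q inside the direct sum avoids a transport along a = b + q: only the
   matching term survives, and none does if a < q. *)
have cL a : linear (fun v : P a => \sum_(b < a.+1)
    dsum_inj (V := QV) (chain_lift Q g b (dsum_proj (b + q)%N (dsum_inj (V := PV) v)))).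
  move=> t u v; rewrite scaler_sumr -big_split; apply: eq_bigr => b _ /=.
  by rewrite !linearP.
pose c a := sval (cid (linear_of_fun (cL a))).
have cE a : c a =1 _ := svalP (cid (linear_of_fun (cL a))).
have [G GE] := dsum_glue c.
have Gq b x : G (dsum_inj (V := PV) (i := (b + q)%N) x) = dsum_inj (V := QV) (chain_lift Q g b x).
  have bb : (b < (b + q).+1)%N by rewrite ltnS leq_addr.
  rewrite GE cE (bigD1 (Ordinal bb)) //= dsum_injK big1 ?addr0 // => b' b'b.
  rewrite dsum_proj_inj_neq ?linear0 // eqn_add2r.
  by apply: contraNneq b'b => bE; apply/eqP/val_inj.
have G0 a (x : P a) : (a < q)%N -> G (dsum_inj (V := PV) x) = 0.
  move=> aq; rewrite GE cE big1 // => b _; rewrite dsum_proj_inj_neq ?linear0 //.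
  by apply: contraTneq aq => ->; rewrite -leqNgt leq_addl.
have cases a : (exists b, a = b + q)%N \/ (a < q)%N.
  by case: (leqP q a) => qa; [left; exists (a - q)%N; rewrite subnK | right].
exists G; split=> // [a b x|x].
  rewrite /= /dsum_part /=; have [[b' ab']|aq _] := cases a; last by rewrite G0 ?linear0.
  move=> bb; subst a.
  rewrite Gq dsum_proj_inj_neq ?linear0 //.
  by apply: contraNneq bb => ->; rewrite PoszD.
have Gd0 a (v : P a) : (a <= q)%N -> G (td (total_complex P) (dsum_inj (V := PV) v)) = 0.
  by case: a v => [|a] v aq /=; rewrite ?total_d0 ?linear0 // total_dS G0.
apply: (@eq_on_inj _ _ _ _ (td (total_complex Q) \o G) (G \o td (total_complex P))) => a v /=.
have [[b ab]|aq] := cases a; last by rewrite G0 // linear0 Gd0 // ltnW.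
case: b ab => [|b] ab; subst a; rewrite Gq; last by rewrite !total_dS Gq chain_lift_d.
by rewrite total_d0 Gd0.
Qed.

End TotalChainLift.

Section EndAlgebra.
Variables (k : fieldType) (L : falgType k) (M : lmodType L) (T : total_resolution M).

(* The endomorphisms of [T] that are finite sums of homogeneous ones. *)
Definition bounded (c : Defs.Hom T T) : bool :=
  `[< exists N : nat, forall a b x, (a + N < b)%N || (b + N < a)%N ->
        tgr T b (c (tgr T a x)) = 0 >].

Fact bounded_closed : GRing.submod_closed bounded.
Proof.
split=> [|t c c' /asboolP[N cN] /asboolP[N' c'N]]; apply/asboolP.
  by exists 0 => a b x _; exact: linear0.
exists (N + N')%N => a b x ab.
rewrite -[(_ + _ : Defs.Hom _ _) _]/(t%:A *: c _ + c' _) linearP /= cN; last by move: ab; lia.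
by rewrite c'N ?scaler0 ?addr0 //; move: ab; lia.
Qed.

Definition endo : lmodType k := submod (Submodule bounded_closed).
Implicit Types c : endo.
Definition endo_fun c : {linear T -> T} := submod_val c.

Lemma endoD t c c' x : endo_fun (t *: c + c') x = t%:A *: endo_fun c x + endo_fun c' x.
Proof. by []. Qed.

Lemma endo_ext c c' : (forall x, endo_fun c x = endo_fun c' x) -> c = c'.
Proof. by move=> cc'; apply/val_inj/Hom_eq. Qed.

Lemma endo_coef c c' :
  (forall a b x, tgr T b (endo_fun c (tgr T a x)) = tgr T b (endo_fun c' (tgr T a x))) -> c = c'.
Proof.
move=> cc'; apply: endo_ext; apply: (@eq_on_parts _ _ _ _ (tgr T)) => a x.
by apply: (@eq_parts _ _ _ (tgr T)) => b; exact: cc'.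
Qed.

Lemma endoP c : exists N : nat, forall a b x, (a + N < b)%N || (b + N < a)%N ->
  tgr T b (endo_fun c (tgr T a x)) = 0.
Proof. exact/asboolP/(submod_valP c). Qed.

Lemma hdeg_bounded n (f : {linear T -> T}) : hdeg n f -> bounded f.
Proof.
move=> fn; apply/asboolP; exists `|n|%N => a b x ab; apply: fn.
by apply/eqP; move: ab; lia.
Qed.

Lemma bounded_comp (f g : {linear T -> T}) : bounded f -> bounded g -> bounded (f \o g).
Proof.
move=> /asboolP[N fN] /asboolP[N' gN']; apply/asboolP.
exists (N + N')%N => a b x ab /=; have [s ->] := part_sum (tgr T) (g (tgr T a x)).
rewrite !linear_sum big1 // => m _ /=.
have [ma|ma] := boolP ((a + N' < m)%N || (m + N' < a)%N); first by rewrite gN' // !linear0.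
by apply: fN; move: ab ma; lia.
Qed.

Definition endo_mul c c' : endo :=
  Submod (bounded_comp (submod_valP c) (submod_valP c') : Submodule bounded_closed _).

Lemma endo_mulE c c' x : endo_fun (endo_mul c c') x = endo_fun c (endo_fun c' x).
Proof. by []. Qed.

Lemma bounded_td : bounded (td T).
Proof.
apply: (@hdeg_bounded 1) => -[|a] b x ab; first by rewrite td_part0 linear0.
by rewrite td_part part_neq //; apply: contraNneq ab => ->; apply/eqP; lia.
Qed.

Lemma bounded_D c : bounded (@tsign _ _ _ T \o ((td T \o endo_fun c) \- (endo_fun c \o td T))).
Proof.
apply: bounded_comp; first exact: hdeg_bounded (@hdeg_tsign _ _ _ T).
have [_ H] := bounded_closed.
have b1 := bounded_comp bounded_td (submod_valP c).
have b2 := bounded_comp (submod_valP c) bounded_td.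
have := H (-1) _ _ b2 b1; congr (is_true (bounded _)).
apply: Hom_eq => x.
by rewrite -[LHS]/((-1)%:A *: _ + _) scaleN1r scaleN1r addrC.
Qed.

(** [tsign] replaces the sign of the graded commutator. It anticommutes with [td], so the square is
    0, and moving it past a homogeneous map produces the Leibniz sign. *)
Definition endo_d c : endo := Submod (bounded_D c : Submodule bounded_closed _).

Lemma endo_dE c x : endo_fun (endo_d c) x =
  tsign T (td T (endo_fun c x) - endo_fun c (td T x)).
Proof. by []. Qed.

Fact endo_d_linear : linear endo_d.
Proof.
move=> t c c'; apply: endo_ext => x; rewrite endoD !endo_dE !endoD.
rewrite -linearP; congr (tsign _ _).
by rewrite linearP scalerBr opprD addrACA.
Qed.

Definition endo_D : {linear endo -> endo} :=
  HB.pack endo_d (GRing.isLinear.Build _ _ _ _ _ endo_d_linear).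

Lemma endo_mul_linl z : linear (endo_mul^~ z).
Proof. by move=> t c c'; apply: endo_ext. Qed.

Lemma endo_mul_linr z : linear (endo_mul z).
Proof.
move=> t c c'; apply: endo_ext => x; rewrite endoD !endo_mulE endoD.
exact: linearP.
Qed.

Lemma endo_mulA : associative endo_mul.
Proof. by move=> c c' c''; apply: endo_ext. Qed.

Lemma endo_DD c : endo_D (endo_D c) = 0.
Proof.
apply: endo_ext => x; rewrite !endo_dE td_td [endo_fun c 0]linear0 subr0.
have dt y : td T (tsign T y) = - tsign T (td T y) by rewrite tsign_d opprK.
by rewrite dt [td T (_ - _)]linearB td_td sub0r linearN opprK subrr linear0.
Qed.

Lemma endo0 x : endo_fun 0 x = 0. Proof. by []. Qed.

Lemma endo_sum (J : Type) (s : seq J) (F : J -> endo) x :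
  endo_fun (\sum_(j <- s) F j) x = \sum_(j <- s) endo_fun (F j) x.
Proof. by elim/big_rec2: _ => // j y c _ <-. Qed.

Definition int_part (z : int) : {linear T -> T} :=
  match z with Posz b => tgr T b | Negz _ => [the {linear T -> T} of \0] end.

Lemma tgr_int_part b z y : tgr T b (int_part z y) = if z == b then tgr T b y else 0.
Proof.
case: z => z /=; last exact: linear0.
by rewrite part_part eqz_nat eq_sym.
Qed.

Lemma endo_part_exists n c : exists c' : endo, forall a b x,
  tgr T b (endo_fun c' (tgr T a x)) =
  if a%:Z == b%:Z + n then tgr T b (endo_fun c (tgr T a x)) else 0.
Proof.
have [f fE] := glue_parts (tgr T) (fun a =>
  [the {linear T -> T} of int_part (a%:Z - n) \o endo_fun c]).
have fc a b x : tgr T b (f (tgr T a x)) =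
    if a%:Z == b%:Z + n then tgr T b (endo_fun c (tgr T a x)) else 0.
  by rewrite fE /= tgr_int_part subr_eq.
have fb : Submodule bounded_closed f.
  by apply: (@hdeg_bounded n) => a b x /negPf ab; rewrite fc ab.
by exists (Submod fb).
Qed.

Definition endo_part_fun n c : endo := sval (cid (endo_part_exists n c)).

Lemma endo_part_funE n c a b x :
  tgr T b (endo_fun (endo_part_fun n c) (tgr T a x)) =
  if a%:Z == b%:Z + n then tgr T b (endo_fun c (tgr T a x)) else 0.
Proof. exact: (svalP (cid (endo_part_exists n c))). Qed.

Fact endo_part_linear n : linear (endo_part_fun n).
Proof.
move=> t c c'; apply: endo_coef => a b x.
rewrite endoD [RHS]linearP !endo_part_funE endoD [tgr T b _]linearP.
by case: ifP => //; rewrite scaler0 addr0.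
Qed.

Definition endo_part n : {linear endo -> endo} :=
  HB.pack (endo_part_fun n) (GRing.isLinear.Build _ _ _ _ _ (endo_part_linear n)).

Lemma endo_partE n c a b x :
  tgr T b (endo_fun (endo_part n c) (tgr T a x)) =
  if a%:Z == b%:Z + n then tgr T b (endo_fun c (tgr T a x)) else 0.
Proof. exact: endo_part_funE. Qed.

Lemma endo_part_part n n' c :
  endo_part n (endo_part n' c) = if n == n' then endo_part n c else 0.
Proof.
apply: endo_coef => a b x; rewrite !endo_partE.
case: eqVneq => [ab|ab]; last by case: ifP => _; rewrite ?endo_partE ?(negPf ab) // endo0 linear0.
rewrite ab (inj_eq (addrI _)); case: eqVneq => [_|_]; last by rewrite endo0 linear0.
by rewrite endo_partE ab eqxx.
Qed.

Lemma endo_part_sum c : exists s : seq int, c = \sum_(n <- s) endo_part n c.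
Proof.
have [N cN] := endoP c.
(* The degrees from -N to N are 2N + 1 in number. *)
have [N2 N2E] : exists N2, N2 = (N + N).+1 by exists (N + N).+1.
exists [seq i%:Z - N%:Z | i <- iota 0 N2].
apply: endo_coef => a b x; rewrite endo_sum linear_sum big_map /=.
have [ab|ab] := boolP ((a + N < b) || (b + N < a))%N.
  rewrite (cN _ _ _ ab) big1 // => i _; rewrite endo_part_funE (cN _ _ _ ab).
  by case: ifP.
rewrite (bigD1_seq (a + N - b)%N) ?iota_uniq //=; last by rewrite mem_iota N2E; move: ab; lia.
rewrite endo_part_funE ifT; last by apply/eqP; move: ab; lia.
rewrite big1 ?addr0 // => i ib; rewrite endo_part_funE ifF //.
by apply: contraNF ib => /eqP iE; apply/eqP; move: ab iE; lia.
Qed.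

Definition endo_grading : grading int endo := Grading endo_part_part endo_part_sum.

Lemma endo_grading_hdeg n c : endo_grading n c = c <-> hdeg n (endo_fun c).
Proof.
split=> [<- a b x /negPf ab|cn]; first by rewrite [LHS]endo_partE ab.
by apply: endo_coef => a b x; rewrite endo_partE; case: ifP => // /negbT /cn.
Qed.

Lemma tgr_tsign b y : tgr T b (tsign T y) = tsign T (tgr T b y).
Proof.
apply: (@eq_on_parts _ _ _ _ (tgr T) (tgr T b \o tsign T) (tsign T \o tgr T b)) => a x /=.
rewrite tsign_part part_part; case: eqVneq => [->|ba].
  by rewrite tsign_part; case: odd; rewrite ?[tgr T a (- _)]linearN /= part_id.
by rewrite linear0; case: odd; rewrite ?[tgr T b (- _)]linearN /= part_neq ?oppr0.
Qed.

Lemma endo_D_coef c a b x : tgr T b (endo_fun (endo_D c) (tgr T a x)) =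
  tsign T (td T (tgr T b.+1 (endo_fun c (tgr T a x))) -
           tgr T b (endo_fun c (td T (tgr T a x)))).
Proof. by rewrite endo_dE tgr_tsign linearB td_part. Qed.

Lemma endo_D_part n c : endo_D (endo_grading n c) = endo_grading (n + 1) (endo_D c).
Proof.
apply: endo_coef => a b x; rewrite [RHS]endo_partE !endo_D_coef endo_partE.
have -> : (a%:Z == b.+1%:Z + n) = (a%:Z == b%:Z + (n + 1)) by apply/eqP/eqP; lia.
case: a => [|a].
  by rewrite td_part0 ![endo_fun _ 0]linear0 linear0 !subr0; case: ifP => // _; rewrite !linear0.
rewrite td_part [tgr T b (endo_fun _ _)]endo_partE.
have -> : (a%:Z == b%:Z + n) = (a.+1%:Z == b%:Z + (n + 1)) by apply/eqP/eqP; lia.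
by case: ifP => // _; rewrite linear0 subrr linear0.
Qed.

Lemma endo_mul_part n n' c c' : endo_grading n c = c -> endo_grading n' c' = c' ->
  endo_grading (n + n') (endo_mul c c') = endo_mul c c'.
Proof.
move=> /endo_grading_hdeg cn /endo_grading_hdeg cn'; apply/endo_grading_hdeg.
exact: hdeg_comp.
Qed.

Lemma tsign_scale a x : tsign T (tgr T a x) = ((-1) ^+ a : k)%:A *: tgr T a x.
Proof.
rewrite tsign_part -signr_odd; case: odd; last by rewrite !scale1r.
by rewrite expr1 !scaleN1r.
Qed.

Lemma tsign_hdeg n (f : {linear T -> T}) x : hdeg n f ->
  tsign T (f x) = ((-1) ^ n : k)%:A *: f (tsign T x).
Proof.
move=> fn; have sL : linear (fun y : T => ((-1) ^ n : k)%:A *: y).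
  by move=> t u v; rewrite scalerDr !scalerA mulr_algl mulr_algr.
have [s sE] := linear_of_fun sL; rewrite -sE.
apply: (@eq_on_parts _ _ _ _ (tgr T) (tsign T \o f) (s \o f \o tsign T)) => a y /=.
rewrite sE tsign_scale [f (_ *: _)]linearZ /=.
case E : (a%:Z - n) => [b|b]; last first.
  by rewrite (hdeg_neg _ fn) ?linear0 ?scaler0 //; move: E; lia.
have ab : a%:Z = b%:Z + n by rewrite -E subrK.
rewrite -(hdeg_part _ fn ab) tsign_scale scalerA mulr_algl scalerA.
congr (_%:A *: _); rewrite -[(-1) ^+ a]/((-1) ^ a%:Z) ab.
rewrite !expfzDr ?oppr_eq0 ?oner_eq0 // mulrCA -expfzMl mulrNN mulr1 exp1rz mulr1.
by [].
Qed.

Lemma endo_D_mul n c c' : endo_grading n c = c ->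
  endo_D (endo_mul c c') = endo_mul (endo_D c) c' + (-1) ^ n *: endo_mul c (endo_D c').
Proof.
move=> /endo_grading_hdeg cn; apply: endo_ext => x.
rewrite addrC endoD endo_dE !endo_mulE !endo_dE -(tsign_hdeg _ cn) addrC -linearD.
by congr (tsign _ _); rewrite [endo_fun c (_ - _)]linearB [X in _ = X + _]addrC addrACA subrr addr0.
Qed.

End EndAlgebra.

(** * Cocycles of endomorphisms and the Yoneda product *)

Section Comparison.
Variables (k : fieldType) (L : falgType k) (M : lmodType L).
Variables (P : projective_resolution M) (T : total_resolution M).
Local Notation TP := (total_complex P).
Local Notation PV := (P : nat -> lmodType L).
Local Notation inj n := (@dsum_inj L nat PV n).

Variables (psi : {linear TP -> T}) (phi : {linear T -> TP}).
Hypothesis psi_deg : hdeg 0 psi.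
Hypothesis psi_eps : forall x, teps T (psi x) = teps TP x.
Hypothesis psi_d : forall x, td T (psi x) = psi (td TP x).
Hypothesis phi_deg : hdeg 0 phi.
Hypothesis phi_eps : forall x, teps TP (phi x) = teps T x.
Hypothesis phi_d : forall x, td TP (phi x) = phi (td T x).

Lemma comparison_homotopy (S : total_resolution M) (f : {linear S -> S}) :
  hdeg 0 f -> (forall x, teps S (f x) = teps S x) ->
  (forall x, td S (f x) = f (td S x)) ->
  exists s : {linear S -> S}, hdeg (- 1) s /\
    forall x, f x = x + (td S (s x) + s (td S x)).
Proof.
move=> f0 fe fd.
have [||||s [s_deg s_eps s_d]] := @lift_hom _ _ _ _ S S 0 (f \- idfun) [the {linear S -> M} of \0].
- by move=> a b x ab; rewrite /= linearB /= f0 // (@hdeg_id _ _ _ S a b x ab) subr0.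
- by move=> x; rewrite /= linearB /= fd.
- by move=> x; rewrite /= linearB /= fe subrr.
- by [].
by exists s; split=> // x; rewrite s_d /= addrC subrK.
Qed.

Lemma inj_part n x : tgr TP n (inj n x) = inj n x.
Proof. by rewrite /= /dsum_part /= dsum_injK. Qed.

Lemma psi_inj n x : tgr T n (psi (inj n x)) = psi (inj n x).
Proof. by rewrite -{1}inj_part (hdeg_part _ psi_deg) ?inj_part ?addr0. Qed.

Definition coho : lmodType k := dsum (fun n => Ext_res P M n).
Definition coho_comp n (a : coho) : Ext_res P M n := dsum_proj n a.
Definition coho_ext n (z : Ext_res P M n) : coho := dsum_inj (V := fun n => Ext_res P M n) z.
Local Notation A := coho.

Lemma coho_comp_lin n t a a' : coho_comp n (t *: a + a') = t *: coho_comp n a + coho_comp n a'.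
Proof. exact: (linearP (dsum_proj (V := fun n => Ext_res P M n) n)). Qed.
Lemma coho_comp0 n : coho_comp n 0 = 0.
Proof. exact: (linear0 (dsum_proj (V := fun n => Ext_res P M n) n)). Qed.
Lemma coho_comp_sum n (J : Type) (s : seq J) (F : J -> A) :
  coho_comp n (\sum_(j <- s) F j) = \sum_(j <- s) coho_comp n (F j).
Proof. exact: (linear_sum (dsum_proj (V := fun n => Ext_res P M n) n)). Qed.
Lemma coho_comp_ext n (z : Ext_res P M n) : coho_comp n (coho_ext z) = z.
Proof. exact: dsum_injK. Qed.
Lemma coho_comp_ext_neq n m (z : Ext_res P M n) : n != m -> coho_comp m (coho_ext z) = 0.
Proof. exact: dsum_proj_inj_neq. Qed.
Lemma coho_eq a a' : (forall n, coho_comp n a = coho_comp n a') -> a = a'.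
Proof. exact: dsum_ext. Qed.
Lemma coho_sum a : exists2 s : seq nat, uniq s & a = \sum_(n <- s) coho_ext (coho_comp n a).
Proof. exact: dsum_sum. Qed.

Definition coho_part n (a : A) : A := coho_ext (coho_comp n a).

(** Classes are computed on [P] while endomorphisms act on [T], hence the detour through [psi]. *)
Definition cochain (c : endo T) n (x : P n) : M := teps T (endo_fun c (psi (inj n x))).

Definition represents (c : endo T) (a : A) : Prop :=
  endo_D T c = 0 /\ forall n, class_of (cochain c (n := n)) (coho_comp n a).

Lemma endo_D0 c : endo_D T c = 0 <-> forall x, td T (endo_fun c x) = endo_fun c (td T x).
Proof.
split=> [Dc x|dc]; last by apply: endo_ext => x; rewrite endo_dE dc subrr linear0.
have := congr1 (fun c' => tsign T (endo_fun c' x)) Dc.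
by rewrite endo_dE tsign_invol endo0 linear0 => /eqP; rewrite subr_eq0 => /eqP.
Qed.

Lemma cochain_part z c n (x : P n) :
  cochain (endo_grading T z c) x = if n%:Z == z then cochain c x else 0.
Proof.
rewrite /cochain -teps_part0 -psi_inj endo_partE add0r.
by case: ifP; rewrite ?teps_part0 // linear0.
Qed.

Lemma class_zero n (f : P n -> M) : (forall x, f x = 0) -> class_of f (0 : Ext_res P M n).
Proof. by move=> f0; apply: eq_class_of (class_of00 _ _ _) => x; rewrite f0. Qed.

Lemma represents_lin (t : k) c a c' a' : represents c a -> represents c' a' ->
  represents (t *: c + c') (t *: a + a').
Proof.
move=> [Dc ca] [Dc' ca']; split=> [|n]; first by rewrite linearP Dc Dc' scaler0 addr0.
rewrite coho_comp_lin; apply: (eq_class_of _ (class_of_lin t (ca n) (ca' n))) => x.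
by rewrite /cochain endoD linearP.
Qed.

Lemma represents00 : represents 0 0.
Proof.
split=> [|n]; first exact: linear0.
rewrite coho_comp0; apply: class_zero => x.
by rewrite /cochain endo0 linear0.
Qed.

Lemma representsD c a c' a' : represents c a -> represents c' a' ->
  represents (c + c') (a + a').
Proof. by move=> ca ca'; have := represents_lin 1 ca ca'; rewrite !scale1r. Qed.

Lemma represents_sum (J : Type) (s : seq J) (F : J -> endo T) (G : J -> A) :
  (forall j, represents (F j) (G j)) -> represents (\sum_(j <- s) F j) (\sum_(j <- s) G j).
Proof.
move=> FG; elim/big_rec2: _ => [|j a c _ ca]; first exact: represents00.
by have := represents_lin 1 (FG j) ca; rewrite !scale1r.
Qed.

Lemma represents_zero a : represents 0 a -> a = 0.
Proof.
move=> [_ a0]; apply: coho_eq => n; rewrite coho_comp0.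
apply: class_of_functional (a0 n) _; apply: class_zero => x.
by rewrite /cochain endo0 linear0.
Qed.

Lemma represents_part n c a : represents c a ->
  represents (endo_grading T n%:Z c) (coho_part n a).
Proof.
move=> [Dc ca]; split=> [|m]; first by rewrite endo_D_part Dc linear0.
have [mn|mn] := eqVneq m n.
  case: n / mn; rewrite /coho_part coho_comp_ext.
  by apply: (eq_class_of _ (ca m)) => x; rewrite cochain_part eqxx.
rewrite /coho_part coho_comp_ext_neq 1?eq_sym //.
by apply: class_zero => x; rewrite cochain_part eqz_nat (negPf mn).
Qed.

Lemma represents_neg n c a : represents c a -> represents (endo_grading T (Negz n) c) 0.
Proof.
move=> [Dc ca]; split=> [|m]; first by rewrite endo_D_part Dc linear0.
by rewrite coho_comp0; apply: class_zero => x; rewrite cochain_part.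
Qed.

Lemma cochain_linear c n : linear (@cochain c n).
Proof. by move=> t x y; rewrite /cochain !linearP. Qed.

(** Boundedness of [c] leaves finitely many nonzero components, as an element of the direct sum
    requires. *)
Lemma represents_ex c : endo_D T c = 0 -> exists a, represents c a.
Proof.
move=> Dc; have /endo_D0 dc := Dc.
have H n : exists z, class_of (@cochain c n) z.
  have [f fE] := linear_of_fun (@cochain_linear c n).
  have [|z fz] := @class_of_ex _ _ _ M P n f.
    move=> x; rewrite fE /cochain -[inj n _]/(_) -total_dS -[total_d P _]/(td TP _).
    by rewrite -psi_d -dc teps_td.
  by exists z; exact: (eq_class_of _ fz).
pose z n := sval (cid (H n)); have zP n := svalP (cid (H n)).
have [N cN] := endoP c.
have z0 n : (N < n)%N -> z n = 0.
  move=> Nn; apply: class_of_functional (zP n) _; apply: class_zero => x.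
  by rewrite /cochain -teps_part0 -psi_inj cN ?linear0 // Nn orbT.
exists (\sum_(n < N.+1) coho_ext (z n)); split=> // m.
rewrite coho_comp_sum; have [mN|mN] := ltnP m N.+1.
  rewrite (bigD1 (Ordinal mN)) //= coho_comp_ext big1 ?addr0; first exact: zP.
  by move=> i im; apply: coho_comp_ext_neq; apply: contraNneq im => im; apply/eqP/val_inj.
rewrite big1 => [|i _]; first by rewrite -(z0 m) //; exact: zP.
by apply: coho_comp_ext_neq; rewrite neq_ltn (leq_trans (ltn_ord i)).
Qed.

(** A cocycle f on P_n is moved to [T] by [phi] and lifted to a chain map. Returning by [psi]
    replaces f by its composite with [phi \o psi], which differs from f by a coboundary because
    [phi \o psi] is homotopic to the identity. *)
Lemma represents_surj a : exists c, represents c a.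
Proof.
have H n : exists c, represents c (coho_ext (coho_comp n a)).
  have [f fz fd] := class_of_surj (coho_comp n a).
  pose pr : {linear TP -> P n} := @dsum_proj L nat PV n.
  pose u : {linear T -> M} := f \o pr \o phi.
  have u_deg m x : m%:Z != n%:Z -> u (tgr T m x) = 0.
    move=> mn; rewrite /u /= -(hdeg_part _ phi_deg (b := m)) ?addr0 //.
    by rewrite /= /dsum_part /pr /= dsum_proj_inj_neq ?linear0.
  have u_d x : u (td T x) = 0 by rewrite /u /= -phi_d /pr /= total_d_proj fd.
  have [c [c_deg c_eps c_d]] := chain_map_exists T u_deg u_d.
  have cb : Submodule (@bounded_closed _ _ _ T) c by exact: hdeg_bounded c_deg.
  exists (Submod cb); split=> [|m]; first by apply/endo_D0 => x; rewrite /endo_fun /= c_d.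
  have cE x : @cochain (Submod cb) m x = u (psi (inj m x)) by exact: c_eps.
  have [mn|mn] := eqVneq m n; last first.
    rewrite coho_comp_ext_neq 1?eq_sym //; apply: class_zero => x.
    by rewrite cE -psi_inj u_deg // eqz_nat.
  subst m; rewrite coho_comp_ext.
  have [|||t [t_deg tE]] := @comparison_homotopy TP (phi \o psi).
  - by have := hdeg_comp phi_deg psi_deg.
  - by move=> x; exact: etrans (phi_eps _) (psi_eps _).
  - by move=> x; exact: etrans (phi_d _) (congr1 phi (psi_d _)).
  have H0 : class_of (fun x : P n => f (pr (t (td TP (inj n x))))) (0 : Ext_res P M n).
    exact: (@class_of0 _ _ _ _ _ _ (f \o pr \o t)).
  have prI x : pr (inj n x) = x by exact: dsum_injK.
  have prd y : f (pr (td TP y)) = 0 by rewrite [pr _]total_d_proj fd.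
  apply: (eq_class_of _ (class_of_add0 fz H0)) => x; rewrite cE.
  rewrite [RHS](congr1 (fun y => f (pr y)) (tE (inj n x))).
  have prD y z : f (pr (y + z)) = f (pr y) + f (pr z) by rewrite [pr _]linearD linearD.
  by rewrite !prD prI prd add0r.
pose c n := sval (cid (H n)); have [s _ aE] := coho_sum a.
exists (\sum_(n <- s) c n); rewrite [X in represents _ X]aE.
by apply: represents_sum => n; exact: svalP (cid (H n)).
Qed.

Lemma v_td_neq (m : nat) (v : {linear TP -> M}) :
  (forall a x, a%:Z != m%:Z - 1 -> v (tgr TP a x) = 0) ->
  forall a (x : P a), a != m -> v (td TP (inj a x)) = 0.
Proof.
move=> v_deg [|a] x am; first by rewrite /= total_d0 linear0.
rewrite /= total_dS -inj_part v_deg //.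
by apply: contraNneq am => aE; apply/eqP; move: aE; lia.
Qed.

Lemma represents_boundary c : represents (endo_D T c) 0.
Proof.
split=> [|n]; first exact: endo_DD.
rewrite coho_comp0; apply: (@class_of0 _ _ _ _ _ _ (\- (teps T \o endo_fun c \o psi))) => x.
rewrite /cochain endo_dE teps_tsign linearB teps_td sub0r psi_d.
by [].
Qed.

Lemma cochain_neq z c n (x : P n) : endo_grading T z c = c -> n%:Z != z -> cochain c x = 0.
Proof. by move=> <- /negPf nz; rewrite cochain_part nz. Qed.

(** In each degree, triviality of the class makes the augmentation of [c] factor through the
    differential, first on [TP] and then on [T]; [lift_hom] extends this factorization to a
    primitive. *)
Lemma represents_ker c : represents c 0 -> exists c', c = endo_D T c'.
Proof.
move=> [Dc c0].
suff H z : exists c', endo_grading T z c = endo_D T c'.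
  have [s ->] := part_sum (endo_grading T) c.
  exists (\sum_(z <- s) sval (cid (H z))); rewrite linear_sum; apply: eq_bigr => z _.
  exact: svalP (cid (H z)).
set cz := endo_grading T z c.
have cz_part : endo_grading T z cz = cz by exact: part_id.
have /endo_grading_hdeg r_deg := cz_part.
have /endo_D0 r_d : endo_D T cz = 0 by rewrite /cz endo_D_part Dc linear0.
pose w : {linear T -> M} := teps T \o endo_fun cz.
have w_deg a x : a%:Z != z -> w (tgr T a x) = 0.
  by move=> az; rewrite /w /= -teps_part0 r_deg ?linear0 // add0r.
have w_d x : w (td T x) = 0 by rewrite /w /= -r_d teps_td.
have [u [u_deg uE]] : exists u : {linear T -> M},
    (forall a x, a%:Z != z - 1 -> u (tgr T a x) = 0) /\
    forall x, teps T (endo_fun cz x) = u (td T x).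
  case: z @cz cz_part r_deg r_d @w w_deg w_d => m cz cz_part r_deg r_d w w_deg w_d; last first.
    exists [the {linear T -> M} of \0]; split=> // x.
    apply: (@eq_on_parts _ _ _ _ (tgr T) w [the {linear T -> M} of \0]) => a y.
    by rewrite w_deg.
  have [v [v_deg vE]] : exists v : {linear TP -> M},
      (forall a x, a%:Z != m%:Z - 1 -> v (tgr TP a x) = 0) /\
      forall x : P m, cochain c x = v (td TP (inj m x)).
    by apply: class_of0_inv; have := c0 m; rewrite coho_comp0.
  have wpsi y : w (psi y) = v (td TP y).
    apply: (@eq_on_inj _ _ _ _ (w \o psi) (v \o td TP)) => a x.
    rewrite [LHS](_ : _ = cochain cz x) // [RHS](_ : _ = v (td TP (inj a x))) //.
    have [am|am] := eqVneq a m; last by rewrite (v_td_neq v_deg) // (cochain_neq _ cz_part).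
    by subst a; rewrite cochain_part eqxx vE.
  have [|||t [t_deg tE]] := @comparison_homotopy T (psi \o phi).
  - by have := hdeg_comp psi_deg phi_deg.
  - by move=> x; exact: etrans (psi_eps _) (phi_eps _).
  - by move=> x; exact: etrans (psi_d _) (congr1 psi (phi_d _)).
  (* With d the differential, psi phi = 1 + d t + t d and w d = 0 give w + w t d = w psi phi = v phi
     d. *)
  exists ((v \o phi) \- (w \o t)); split=> [a x am|x].
    have wt : w (t (tgr T a x)) = 0.
      rewrite -(hdeg_part _ t_deg (b := a.+1)); last by lia.
      by rewrite w_deg //; apply: contraNneq am => am; apply/eqP; move: am; lia.
    have vp : v (phi (tgr T a x)) = 0.
      by rewrite -(hdeg_part _ phi_deg (b := a)) ?addr0 // v_deg.
    by rewrite [LHS](congr2 (fun y z => y - z) vp wt) subrr.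
  have wE : w x + w (t (td T x)) = v (phi (td T x)).
    rewrite -phi_d -wpsi [RHS](congr1 w (tE x)) [w (_ + _)]linearD.
    by rewrite [w (td T _ + _)]linearD w_d add0r.
  by apply: etrans (_ : v (phi (td T x)) - w (t (td T x)) = _) => //; rewrite -wE addrK.
have [s [s_deg _ sE]] := lift_hom r_deg r_d uE u_deg.
(* [tsign] and the minus turn [endo_d] of this map into d s + s d. *)
pose c' : {linear T -> T} := \- (@tsign _ _ _ T \o s).
have cb : Submodule (@bounded_closed _ _ _ T) c'.
  apply: (@hdeg_bounded _ _ _ _ (z - 1)) => a b x ab.
  by rewrite /c' /= linearN /= tgr_tsign s_deg // linear0 oppr0.
exists (Submod cb); apply: endo_ext => x; rewrite endo_dE.
have c'E y : endo_fun (Submod cb) y = - tsign T (s y) by [].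
rewrite !c'E opprK [td T (- _)]linearN -tsign_d -linearD tsign_invol.
by rewrite sE.
Qed.

Lemma represents_idem (e : endo T) (f : {linear M -> M}) z :
  endo_grading T 0 e = e -> (forall x, td T (endo_fun e x) = endo_fun e (td T x)) ->
  (forall x, teps T (endo_fun e x) = f (teps T x)) ->
  class_of (fun x : P 0 => f (res_eps P x)) z ->
  represents e (coho_ext z).
Proof.
move=> e0 ed ef fz; split=> [|n]; first exact/endo_D0.
have [n0|n0] := eqVneq n 0; last first.
  by rewrite coho_comp_ext_neq 1?eq_sym //; apply: class_zero => x; rewrite (cochain_neq _ e0).
subst n; rewrite coho_comp_ext; apply: (eq_class_of _ fz) => x.
rewrite /cochain ef psi_eps; congr (f _).
by rewrite [RHS](_ : _ = res_eps P (dsum_proj 0 (inj 0 x))) // dsum_injK.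
Qed.

(** * Composition of cycles represents the Yoneda product *)

Variable Y : forall p q, Ext_res P M p -> Ext_res P M q -> Ext_res P M (p + q).
Hypothesis Y_spec : forall p q (z : Ext_res P M p) (z' : Ext_res P M q),
  exists (f : cocycle P M p) (g : cocycle P M q),
    [/\ quo_class _ f = z, quo_class _ g = z' &
        class_of (fun x => submod_val f (chain_lift P g p x)) (Y z z')].

Lemma class_difference n (f : P n -> M) (g : cocycle P M n) z :
  class_of f z -> quo_class _ g = z -> exists v : {linear TP -> M},
  (forall a x, a%:Z != n%:Z - 1 -> v (tgr TP a x) = 0) /\
  forall x, f x = submod_val g x + v (td TP (inj n x)).
Proof.
move=> fz gz; have gz' : class_of (fun x => submod_val g x) z by exists g.
have := class_of_lin (-1) gz' fz; rewrite [-1 *: z]scaleN1r [- z + z]addNr.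
move=> /class_of0_inv[v [v_deg vE]]; exists v; split=> // x.
by rewrite -vE !scaleN1r addrA addrN add0r.
Qed.

(** After augmentation, c' psi and psi G differ by the coboundary of [v2], so their difference is d
    s + s d with [s] over [v2]. Under the augmentation of [c] the term d s dies, s d gives a
    coboundary, and psi G gives f after the chain lift, up to the coboundary from [v1]. *)
Lemma cochain_mul p q c c' (z : Ext_res P M p) (z' : Ext_res P M q) :
  endo_grading T p%:Z c = c -> endo_grading T q%:Z c' = c' ->
  endo_D T c = 0 -> endo_D T c' = 0 ->
  class_of (cochain c (n := p)) z -> class_of (cochain c' (n := q)) z' ->
  class_of (cochain (endo_mul c c') (n := (p + q)%N)) (Y z z').
Proof.
move=> cp c'q /endo_D0 cd /endo_D0 c'd cz c'z'.
have [f [g [fz gz' Yfg]]] := Y_spec z z'.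
have [v1 [_ v1E]] := class_difference cz fz.
have [v2 [v2_deg v2E]] := class_difference c'z' gz'.
have [G [G_deg G_d GE]] := total_chain_lift P g.
pose r : {linear TP -> T} := (endo_fun c' \o psi) \- (psi \o G).
have r_deg : hdeg q%:Z r.
  apply: hdegB.
    by have := hdeg_comp ((endo_grading_hdeg _ _).1 c'q) psi_deg; rewrite addr0.
  by have := hdeg_comp psi_deg G_deg; rewrite add0r.
have rE x : r x = endo_fun c' (psi x) - psi (G x) by [].
have r_d x : td T (r x) = r (td TP x).
  by rewrite !rE linearB c'd !psi_d G_d.
have r_eps x : teps T (r x) = v2 (td TP x).
  apply: (@eq_on_inj _ _ _ _ (teps T \o r) (v2 \o td TP)) => a y.
  apply: etrans (_ : cochain c' y - teps TP (G (inj a y)) = v2 (td TP (inj a y))).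
    by rewrite /cochain -psi_eps -linearB.
  have [aq|aq] := eqVneq a q; last first.
    rewrite (v_td_neq v2_deg) // (cochain_neq _ c'q) // sub0r.
    by rewrite -inj_part -teps_part0 G_deg ?linear0 ?oppr0.
  subst a; rewrite v2E; have -> : teps TP (G (inj q y)) = submod_val g y.
    rewrite (GE 0 y) -(chain_lift_eps P g y).
    by rewrite [LHS](_ : _ = res_eps P (dsum_proj 0 (inj 0 (chain_lift P g 0 y)))) // dsum_injK.
  by rewrite addrC addKr.
have [s [_ _ sE]] := lift_hom r_deg r_d r_eps v2_deg.
pose u : {linear TP -> M} := (v1 \o G) \+ (teps T \o endo_fun c \o s).
have H0 : class_of (fun x : P (p + q)%N => u (td TP (inj (p + q)%N x)))
    (0 : Ext_res P M (p + q)%N) by exact: (@class_of0 _ _ _ _ _ _ u).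
apply: (eq_class_of _ (class_of_add0 Yfg H0)) => x; apply: esym.
have -> : cochain (endo_mul c c') x =
    teps T (endo_fun c (endo_fun c' (psi (inj (p + q)%N x)))) by [].
have -> : endo_fun c' (psi (inj (p + q)%N x)) = psi (G (inj (p + q)%N x)) +
    (td T (s (inj (p + q)%N x)) + s (td TP (inj (p + q)%N x))).
  by rewrite sE rE addrC subrK.
rewrite [endo_fun c (_ + _)]linearD [endo_fun c (_ + _)]linearD -cd [teps T (_ + _)]linearD.
rewrite [teps T (_ + _)]linearD teps_td add0r GE.
rewrite -[teps T (endo_fun c (psi _))]/(cochain c _) v1E -addrA; congr (_ + _).
by rewrite -GE G_d.
Qed.

Lemma endo_mul0 (c : endo T) : endo_mul c 0 = 0.
Proof. by apply: endo_ext => x; rewrite endo_mulE !endo0 linear0. Qed.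

Lemma endo_mulDr (c x y : endo T) : endo_mul c (x + y) = endo_mul c x + endo_mul c y.
Proof. by have := endo_mul_linr c 1 x y; rewrite !scale1r. Qed.

Lemma endo_mul_suml (c : endo T) (J : Type) (s : seq J) (F : J -> endo T) :
  endo_mul (\sum_(j <- s) F j) c = \sum_(j <- s) endo_mul (F j) c.
Proof. by apply: endo_ext => x; rewrite endo_mulE !endo_sum. Qed.

Lemma endo_mul_sumr (c : endo T) (J : Type) (s : seq J) (F : J -> endo T) :
  endo_mul c (\sum_(j <- s) F j) = \sum_(j <- s) endo_mul c (F j).
Proof. by apply: endo_ext => x; rewrite endo_mulE !endo_sum linear_sum. Qed.

Lemma endo_D_mul_cycle (c e : endo T) : endo_D T c = 0 ->
  endo_D T (endo_mul e c) = endo_mul (endo_D T e) c.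
Proof.
move=> Dc; have [f fE] := linear_of_fun (endo_mul_linl c); rewrite -!fE.
apply: (@eq_on_homog _ _ _ _ (endo_grading T) (endo_D T \o f) (f \o endo_D T)) => n x nx.
apply: etrans (_ : endo_D T (endo_mul x c) = _); first by rewrite -fE.
by rewrite (endo_D_mul _ nx) Dc endo_mul0 scaler0 addr0 -fE.
Qed.

Lemma represents_mul_homogeneous p q c c' (z : Ext_res P M p) (z' : Ext_res P M q) :
  endo_grading T p%:Z c = c -> endo_grading T q%:Z c' = c' ->
  represents c (coho_ext z) -> represents c' (coho_ext z') ->
  represents (endo_mul c c') (coho_ext (Y z z')).
Proof.
move=> cp c'q [Dc cz] [Dc' c'z']; split=> [|n].
  rewrite endo_D_mul_cycle // Dc.
  by apply: endo_ext => x; rewrite endo_mulE !endo0.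
have [npq|npq] := eqVneq n (p + q)%N; last first.
  rewrite coho_comp_ext_neq 1?eq_sym //; apply: class_zero => x.
  rewrite (cochain_neq _ (endo_mul_part cp c'q)) //.
subst n; rewrite coho_comp_ext; apply: cochain_mul => //.
  by rewrite -(coho_comp_ext z).
by rewrite -(coho_comp_ext z').
Qed.

Lemma homogeneous_lift p (z : Ext_res P M p) : exists2 c,
  endo_grading T p%:Z c = c & represents c (coho_ext z).
Proof.
have [c /(represents_part p)] := represents_surj (coho_ext z).
by rewrite /coho_part coho_comp_ext; exists (endo_grading T p c); first exact: part_id.
Qed.

Lemma coho_ext0 p : coho_ext (0 : Ext_res P M p) = 0.
Proof.
apply: coho_eq => n; rewrite coho_comp0.
by have [pn|] := eqVneq p n; [subst n; rewrite coho_comp_ext | exact: coho_comp_ext_neq].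
Qed.

(** The endomorphism 0 represents 0, so the product is represented by 0. This makes the sums in
    [coho_mul] finitely supported. *)
Lemma Y0l p q (z' : Ext_res P M q) : Y (0 : Ext_res P M p) z' = 0.
Proof.
have [c' c'q c'z'] := homogeneous_lift z'.
have r0 : represents 0 (coho_ext (0 : Ext_res P M p)) by rewrite coho_ext0; exact: represents00.
have := represents_mul_homogeneous (linear0 (endo_grading T p)) c'q r0 c'z'.
have -> : endo_mul 0 c' = 0 by apply: endo_ext => x; rewrite endo_mulE !endo0.
by move=> /represents_zero/(congr1 (coho_comp (p + q)%N)); rewrite coho_comp_ext coho_comp0.
Qed.

Lemma Y0r p q (z : Ext_res P M p) : Y z (0 : Ext_res P M q) = 0.
Proof.
have [c cp cz] := homogeneous_lift z.
have r0 : represents 0 (coho_ext (0 : Ext_res P M q)) by rewrite coho_ext0; exact: represents00.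
have := represents_mul_homogeneous cp (linear0 (endo_grading T q)) cz r0.
rewrite endo_mul0.
by move=> /represents_zero/(congr1 (coho_comp (p + q)%N)); rewrite coho_comp_ext coho_comp0.
Qed.

Definition coho_mul (a a' : A) : A :=
  \sum_(p \in [set: nat]) \sum_(q \in [set: nat]) coho_ext (Y (coho_comp p a) (coho_comp q a')).

Lemma fsum_seq (F : nat -> A) (s : seq nat) : uniq s ->
  (forall i, i \notin s -> F i = 0) -> \sum_(i \in [set: nat]) F i = \sum_(i <- s) F i.
Proof.
move=> us F0; rewrite (fsbigE s) //; first by apply: eq_bigl => i; rewrite in_setT.
by move=> i _; exact: F0.
Qed.

Lemma coho_mul_seq a a' (s s' : seq nat) : uniq s -> uniq s' ->
  (forall i, i \notin s -> coho_comp i a = 0) -> (forall i, i \notin s' -> coho_comp i a' = 0) ->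
  coho_mul a a' = \sum_(p <- s) \sum_(q <- s') coho_ext (Y (coho_comp p a) (coho_comp q a')).
Proof.
move=> us us' a0 a'0; rewrite /coho_mul (fsum_seq us) => [|p ps].
  apply: eq_bigr => p _; rewrite (fsum_seq us') // => q qs.
  by rewrite a'0 // Y0r coho_ext0.
by rewrite (fsum_seq us') ?big1 // => q *; rewrite a0 // Y0l coho_ext0.
Qed.

Lemma coho_support a : exists s : seq nat,
  [/\ uniq s, forall i, i \notin s -> coho_comp i a = 0 &
      a = \sum_(n <- s) coho_ext (coho_comp n a)].
Proof.
have [s us aE] := coho_sum a; exists s; split=> // i is_.
rewrite aE coho_comp_sum big_seq big1 // => n ns; apply: coho_comp_ext_neq.
by apply: contraNneq is_ => <-.
Qed.

Lemma representsB c c' a : represents c a -> represents c' a ->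
  exists e, c = c' + endo_D T e.
Proof.
move=> ca c'a; have := represents_lin (-1) c'a ca.
rewrite !scaleN1r [- a + a]addNr => /represents_ker[e eE]; exists e.
by rewrite -eE addrA addrN add0r.
Qed.

(** Each cycle is the sum of its parts over the support of its class plus a boundary, which absorbs
    all other parts, those of negative degree included. Multiplied out, only products of homogeneous
    parts and boundaries remain. *)
Lemma represents_mul c a c' a' : represents c a -> represents c' a' ->
  represents (endo_mul c c') (coho_mul a a').
Proof.
move=> ca c'a'; have [s [us s0 aE]] := coho_support a.
have [s' [us' s'0 a'E]] := coho_support a'.
have parts b x t : represents b x -> x = \sum_(n <- t) coho_ext (coho_comp n x) ->
    represents (\sum_(n <- t) endo_grading T n%:Z b) x.
  move=> bx xE; rewrite [X in represents _ X]xE.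
  by apply: represents_sum => n; exact: represents_part.
have [e eE] := representsB ca (parts _ _ _ ca aE).
have [e' e'E] := representsB c'a' (parts _ _ _ c'a' a'E).
have Dc' := c'a'.1.
have -> : endo_mul c c' = \sum_(p <- s) \sum_(q <- s')
      endo_mul (endo_grading T p%:Z c) (endo_grading T q%:Z c') +
    ((\sum_(p <- s) endo_mul (endo_grading T p%:Z c) (endo_D T e')) +
    endo_D T (endo_mul e c')).
  rewrite endo_D_mul_cycle // {1}eE.
  have -> x y : endo_mul (x + y) c' = endo_mul x c' + endo_mul y c' by exact: endo_ext.
  rewrite addrA; congr (_ + _).
  rewrite endo_mul_suml -big_split; apply: eq_bigr => p _ /=.
  rewrite -endo_mul_sumr -endo_mulDr; congr (endo_mul _ _); exact: e'E.
rewrite (coho_mul_seq us us' s0 s'0).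
have H p q : represents (endo_mul (endo_grading T p%:Z c) (endo_grading T q%:Z c'))
    (coho_ext (Y (coho_comp p a) (coho_comp q a'))).
  by apply: represents_mul_homogeneous; rewrite ?part_id //; exact: represents_part.
have X0 (X : A) : X = X + (0 + 0) by rewrite !addr0.
rewrite [X in represents _ X]X0.
apply: representsD; first by do 2!apply: represents_sum => ?.
apply: representsD; last exact: represents_boundary.
(* A homogeneous cycle times [D e'] is, up to the Leibniz sign, the boundary of its product with
   [e']. *)
have B p : represents (endo_mul (endo_grading T p%:Z c) (endo_D T e')) 0.
  have Dcp : endo_D T (endo_grading T p%:Z c) = 0 by rewrite endo_D_part ca.1 linear0.
  have := represents_boundary ((-1 : k) ^ p%:Z *: endo_mul (endo_grading T p%:Z c) e').
  have -> t y : endo_D T (t *: y) = t *: endo_D T y by exact: linearZ.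
  rewrite (endo_D_mul e' (part_id (endo_grading T) p%:Z c)) Dcp.
  have -> : endo_mul 0 e' = 0 by apply: endo_ext.
  by rewrite add0r scalerA -expfzMl mulrNN mulr1 exp1rz scale1r.
by have := represents_sum s B; rewrite big1_eq.
Qed.

End Comparison.

(** * The Yoneda algebra of Delta *)

Section CohomologyModel.
Variables (k : fieldType) (L : falgType k) (M : lmodType L).
Variables (P : projective_resolution M) (T : total_resolution M).
Variable Y : forall p q, Ext_res P M p -> Ext_res P M q -> Ext_res P M (p + q).
Hypothesis Y_spec : forall p q (z : Ext_res P M p) (z' : Ext_res P M q),
  exists (f : cocycle P M p) (g : cocycle P M q),
    [/\ quo_class _ f = z, quo_class _ g = z' &
        class_of (fun x => submod_val f (chain_lift P g p x)) (Y z z')].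
Variables (I : finType) (e : I -> {linear T -> T}) (f : I -> {linear M -> M}).
Variable z : I -> Ext_res P M 0.
Hypothesis e_deg : forall j, hdeg 0 (e j).
Hypothesis e_d : forall j x, td T (e j x) = e j (td T x).
Hypothesis e_eps : forall j x, teps T (e j x) = f j (teps T x).
Hypothesis e_mul : forall j l x, e j (e l x) = if j == l then e j x else 0.
Hypothesis e_sum : forall x, \sum_j e j x = x.
Hypothesis fz : forall j, class_of (fun x : P 0 => f j (res_eps P x)) (z j).
Hypothesis f_neq0 : forall j, exists x, f j x != 0.

Lemma comparison_exists (M' : lmodType L) (S S' : total_resolution M') :
  exists c : {linear S -> S'}, [/\ hdeg 0 c, forall x, teps S' (c x) = teps S x &
    forall x, td S' (c x) = c (td S x)].
Proof.
apply: chain_map_exists => [[|a] x|x] //; first by move=> _; exact: teps_part.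
exact: teps_td.
Qed.

(** Degree 0 has no nonzero coboundaries and the augmentation is onto, so a trivial class would
    force [f j] to be 0. *)
Lemma f_class_neq0 j : z j != 0.
Proof.
apply/eqP => z0; have := fz j; rewrite z0 => /class_of0_inv[v [_ vE]].
have [x /eqP] := f_neq0 j; apply; have [y <-] := res_eps_surj P x.
by rewrite vE /= total_d0 linear0.
Qed.

Lemma coho_minimal_model : exists m : seq (coho P) -> coho P,
  [/\ A_infinity_structure (fun n a => coho_part n a = a)
        (fun (s : {ffun I -> k}) x => coho_mul Y (\sum_j s j *: coho_ext (z j)) x)
        (fun x (s : {ffun I -> k}) => coho_mul Y x (\sum_j s j *: coho_ext (z j))) m,
      forall x, m [:: x] = 0,
      forall x y, m [:: x; y] = coho_mul Y x y &
      forall zs, (3 <= size zs)%N -> (exists j, coho_ext (z j) \in zs) -> m zs = 0].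
Proof.
have [psi [psi_deg psi_eps psi_d]] := comparison_exists (total_complex P) T.
have [phi [phi_deg phi_eps phi_d]] := comparison_exists T (total_complex P).
have eb j : Submodule (@bounded_closed _ _ _ T) (e j) by exact: hdeg_bounded (e_deg j).
pose idem j : endo T := Submod (eb j).
have idem_part j : endo_grading T 0 (idem j) = idem j by exact/endo_grading_hdeg/e_deg.
have idem_sum x : endo_fun (\sum_j idem j) x = x by rewrite endo_sum; exact: e_sum.
apply: (@minimal_model k (coho P) (endo T) (@endo_mul _ _ _ T) (endo_D T) (endo_grading T)
  (dsum_grading (fun n => Ext_res P M n)) I idem (fun j => coho_ext (z j)) (coho_mul Y)
  (represents psi)).
- exact: endo_mul_linl.
- exact: endo_mul_linr.
- exact: endo_mulA.
- exact: endo_DD.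
- exact: endo_D_part.
- exact: endo_mul_part.
- by move=> n x y; exact: endo_D_mul.
- move=> j l; apply: endo_ext => x.
  by rewrite endo_mulE [LHS]e_mul; case: ifP.
- by move=> c; apply: endo_ext => x; rewrite endo_mulE idem_sum.
- by move=> c; apply: endo_ext => x; rewrite endo_mulE idem_sum.
- by move=> j; apply/endo_D0 => x; exact: e_d.
- exact: idem_part.
- exact: represents_lin.
- by move=> c a [].
- exact: represents_ex.
- exact: (represents_surj psi_deg psi_eps psi_d phi_deg phi_eps phi_d).
- exact: represents_boundary.
- exact: (represents_ker psi_deg psi_eps psi_d phi_deg phi_eps phi_d).
- exact: represents_zero.
- exact: (represents_mul psi_deg psi_eps psi_d phi_deg phi_eps phi_d Y_spec).
- exact: represents_part.
- exact: represents_neg.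
- move=> j; apply: (represents_idem psi_deg psi_eps (f := f j)); first exact: idem_part.
  + by move=> x; exact: e_d.
  + by move=> x; exact: e_eps.
  + exact: fz.
- move=> j; apply/eqP => /(congr1 (coho_comp 0)); rewrite coho_comp_ext coho_comp0.
  exact/eqP/f_class_neq0.
Qed.

End CohomologyModel.

(** * Strict idempotents on the sum of resolutions *)

Section SumIdempotents.
Variables (k : fieldType) (L : falgType k) (I : finType) (Delta : I -> lmodType L).
Variable Q : forall i, projective_resolution (Delta i).
Local Notation R := (sum_resolution Q).
Local Notation T := (total_complex R).

Lemma dsum_map_part (S : pzRingType) (J : choiceType) (V W : J -> lmodType S)
    (f : forall i, {linear V i -> W i}) j x :
  dsum_map f (dsum_part V j x) = dsum_part W j (dsum_map f x).
Proof. by rewrite /dsum_part /= dsum_map_inj dsum_map_proj. Qed.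

Lemma sum_dsum_part (S : pzRingType) (V : I -> lmodType S) x :
  \sum_j dsum_part V j x = x.
Proof.
apply: dsum_ext => i; rewrite linear_sum (bigD1 i) //= [X in X + _]dsum_injK.
by rewrite big1 ?addr0 // => j ji; exact: dsum_proj_inj_neq.
Qed.

Definition sum_idem j : {linear T -> T} :=
  dsum_map (V := R : nat -> lmodType L) (W := R : nat -> lmodType L)
    (fun b => dsum_part (fun i => Q i b : lmodType L) j).

Lemma sum_idem_inj j b v : sum_idem j (dsum_inj (V := R : nat -> lmodType L) (i := b) v) =
  dsum_inj (V := R : nat -> lmodType L) (dsum_part (fun i => Q i b : lmodType L) j v).
Proof. exact: dsum_map_inj. Qed.

Lemma sum_idem_deg j : hdeg 0 (sum_idem j).
Proof.
move=> a b x; rewrite addr0 eqz_nat => ab.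
by rewrite [tgr T a x]/(dsum_inj _) sum_idem_inj /= /dsum_part dsum_proj_inj_neq ?linear0.
Qed.

Lemma sum_idem_d j x : td T (sum_idem j x) = sum_idem j (td T x).
Proof.
apply: (@eq_on_inj _ _ _ _ (td T \o sum_idem j) (sum_idem j \o td T)) => -[|b] v /=.
  by rewrite sum_idem_inj !total_d0 linear0.
rewrite sum_idem_inj !total_dS sum_idem_inj; congr (dsum_inj _).
exact: dsum_map_part.
Qed.

Lemma sum_idem_eps j x : teps T (sum_idem j x) = dsum_part Delta j (teps T x).
Proof.
rewrite [LHS](_ : _ = res_eps R (dsum_proj 0 (sum_idem j x))) // dsum_map_proj.
exact: dsum_map_part.
Qed.

Lemma sum_idem_mul j l x : sum_idem j (sum_idem l x) = if j == l then sum_idem j x else 0.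
Proof.
apply: dsum_ext => b; rewrite !dsum_map_proj dsum_part_part.
by case: eqP => _; rewrite ?dsum_map_proj ?linear0.
Qed.

Lemma sum_idem_sum x : \sum_j sum_idem j x = x.
Proof.
apply: dsum_ext => b; rewrite linear_sum /=.
under eq_bigr do rewrite dsum_map_proj.
exact: sum_dsum_part.
Qed.

End SumIdempotents.

Lemma yoneda_spec (k : fieldType) (L : falgType k) (M : lmodType L) p q
    (z : Ext p M M) (z' : Ext q M M) :
  exists (f : cocycle (free_resolution M) M p) (g : cocycle (free_resolution M) M q),
    [/\ quo_class _ f = z, quo_class _ g = z' &
        class_of (P := free_resolution M)
          (fun x => submod_val f (chain_lift (free_resolution M) g p x)) (yoneda z z')].
Proof.
exists (quo_repr z), (quo_repr z'); split; [exact: reprK | exact: reprK |].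
by exists (Submod (yoneda_cocycle z z')).
Qed.

Lemma hom_Ext0_class (k : fieldType) (L : falgType k) (M : lmodType L) (f : {linear M -> M}) :
  class_of (P := free_resolution M) (fun x => f (res_eps (free_resolution M) x)) (hom_Ext0 f).
Proof. by exists (Submod (hom_cocycle f)). Qed.

Theorem theorem3p7 (k : closedFieldType) (L : falgType k)
    (d : Order.disp_t) (I : finPreorderType d) (Delta : I -> lmodType L)
    (H : strict_homological_system Delta) :
  exists m : seq (yoneda_algebra (Delta_sum Delta)) ->
             yoneda_algebra (Delta_sum Delta),
  [/\ A_infinity_structure (@yoneda_degree k L (Delta_sum Delta))
        (fun s x => yoneda_mul (S_elt Delta s) x)
        (fun x s => yoneda_mul x (S_elt Delta s)) m,
      forall x, m [:: x] = 0,
      forall x y, m [:: x; y] = yoneda_mul x y &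
      forall z, (3 <= size z)%N ->
        (exists j, idempotent_class Delta j \in z) -> m z = 0].
Proof.
(* Indecomposable modules are nonzero, so the classes e_j are nonzero and the idempotents are
   independent modulo boundaries. *)
have Delta_neq0 j : exists x, dsum_part Delta j x != 0.
  have [[v v0] _] := hs_indec (admissible_hs (strict_admissible H)) j.
  exists (dsum_inj v); apply: contraNneq v0 => /(congr1 (dsum_proj j)).
  by rewrite /dsum_part /= !dsum_injK linear0 => ->.
have degE : @yoneda_degree k L (Delta_sum Delta) =
    (fun n (a : coho (free_resolution (Delta_sum Delta))) => coho_part n a = a).
  apply: functional_extensionality_dep => n; apply: functional_extensionality_dep => a.
  apply: propositional_extensionality; split=> [[z ->]|<-].
    by rewrite /coho_part; congr coho_ext; exact: coho_comp_ext.
  by exists (coho_comp n a).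
rewrite degE.
(* For the free resolution and [yoneda], [coho] and [coho_mul] are [yoneda_algebra] and [yoneda_mul]
   by conversion; only the complex carrying the endomorphisms comes from the other resolution. *)
have [m [m1 m2 m3 m4]] := (@coho_minimal_model k L (Delta_sum Delta) (free_resolution (Delta_sum Delta))
  (total_complex (sum_resolution (fun i => free_resolution (Delta i))))
  (fun p q => @yoneda k L _ _ _ p q) (@yoneda_spec k L _) I
  (sum_idem (fun i => free_resolution (Delta i))) (dsum_part Delta)
  (fun j => hom_Ext0 (dsum_part Delta j))
  (fun j => sum_idem_deg j) (fun j x => sum_idem_d j x) (fun j x => sum_idem_eps j x)
  (fun j l x => sum_idem_mul j l x) (fun x => sum_idem_sum x)
  (fun j => hom_Ext0_class (dsum_part Delta j)) Delta_neq0).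
by exists m; split; [exact: m1 | exact: m2 | exact: m3 | exact: m4].
Qed.
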